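(* Let $\mathcal G$ be a connected noncompact metric graph with at least one terminal point, and consider the critical energy ($p=6$). Then: $\mu_{\mathcal G}=\mu_{\mathbb R^+}$; for every $\mu\in(\mu_{\mathbb R^+},\mu_{\mathbb R}]$, $\mathcal E_{\mathcal G}(\mu)=-\infty$; and for $\mu=\mu_{\mathbb R^+}$, $\mathcal E_{\mathcal G}(\mu)=0$, and this value is attained if and only if $\mathcal G$ is a halfline.
   Context: Metric graphs have finitely many edges and vertices, bounded edges identified with $[0,\ell_e]$ and halflines with $[0,\infty)$ (whose far endpoints are vertices at infinity); noncompact means at least one halfline. A terminal point is a vertex of degree one that is not a vertex at infinity (the free endpoint of a bounded edge). $H^1(\mathcal G)$: continuous functions, $H^1$ on each edge; $H^1_\mu(\mathcal G)$: those with $\|u\|_2^2=\mu$. $E(u,\mathcal G)=\frac12\int|u'|^2-\frac16\int|u|^6$, $\mathcal E_{\mathcal G}(\mu)=\inf_{H^1_\mu(\mathcal G)}E(\cdot,\mathcal G)$. For a graph $X$, $K_X=\sup_{u\in H^1(X),u\ne0}\frac{\|u\|_6^6}{\|u\|_2^4\|u'\|_2^2}$ and $\mu_X=\sqrt{3/K_X}$; in particular $\mu_{\mathbb R}=\pi\sqrt3/2$ and $\mu_{\mathbb R^+}=\pi\sqrt3/4$. *)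

(* Defs.v *)
From HB Require Import structures.
From mathcomp Require Import all_boot all_order all_algebra.
From mathcomp Require Import all_classical all_reals all_analysis.

Unset Strict Implicit.
Unset Printing Implicit Defensive.

Import Order.TTheory GRing.Theory Num.Theory.
Local Open Scope classical_set_scope.
Local Open Scope ring_scope.

(* Metric graphs with finitely many vertices and edges.                      *)
(* Finite vertices are 'I_nV.  Each edge e : 'I_nE is either bounded         *)
(* (bnd e = true), identified with [0, len e], its endpoint 0 attached to    *)
(* src e and its endpoint len e attached to tgt e; or a halfline             *)
(* (bnd e = false), identified with [0, +oo), its endpoint 0 attached to     *)
(* src e and its far endpoint being its own vertex at infinity (tgt e is     *)
(* then irrelevant).                                                         *)
Record graph (R : realType) := MkGraph {
  nV : nat;
  nE : nat;
  bnd : 'I_nE -> bool;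
  len : 'I_nE -> R;
  src : 'I_nE -> 'I_nV;
  tgt : 'I_nE -> 'I_nV }.
Arguments nV {R} g.
Arguments nE {R} g.
Arguments bnd {R} g _.
Arguments len {R} g _.
Arguments src {R} g _.
Arguments tgt {R} g _.

Section Graphs.
Variable R : realType.
Implicit Types G : graph R.

Definition wf_graph G : Prop := forall e, bnd G e -> 0 < len G e.

Definition edge_dom G (e : 'I_(nE G)) : set R :=
  if bnd G e then `[0, len G e]%classic else `[0, +oo[%classic.

(* degree of a finite vertex (a self-loop counts twice) *)
Definition degree G (v : 'I_(nV G)) : nat :=
  #|[set e | src G e == v]| + #|[set e | bnd G e && (tgt G e == v)]|.

Definition adj G : rel 'I_(nV G) :=
  fun v w => [exists e, bnd G e && (((src G e == v) && (tgt G e == w))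
                                   || ((src G e == w) && (tgt G e == v)))].

(* connectedness: all finite vertices are joined by paths of bounded edges
   (halflines hang at finite vertices, so this is connectedness of G) *)
Definition connected_graph G : Prop :=
  (0 < nV G)%N /\ forall v w : 'I_(nV G), connect (adj G) v w.

Definition noncompact G : Prop := exists e, ~~ bnd G e.

(* terminal point: finite vertex (i.e. not a vertex at infinity) of degree 1 *)
Definition has_terminal_point G : Prop := exists v, degree G v = 1%N.

(* G is a halfline (up to inessential vertices of degree 2): exactly one
   halfline and every finite vertex has degree at most 2; for a connected
   graph this means G is isometric to [0, +oo). *)
Definition is_halfline G : Prop :=
  #|[set e | ~~ bnd G e]| = 1%N /\ forall v, (degree G v <= 2)%N.

(* H^1(G): a function u on G is a family u e of real functions on the edges, *)
(* du e is its (weak) derivative on the edge.  On an interval, H^1 is the    *)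
(* space of absolutely continuous functions u with u, u' in L^2:             *)
(* u e x = u e 0 + int_0^x du e.  Continuity on G = agreement at vertices.   *)
Definition is_H1 G (u du : 'I_(nE G) -> R -> R) : Prop :=
  (forall e, measurable_fun (edge_dom G e) (u e)) /\
  (forall e, measurable_fun (edge_dom G e) (du e)) /\
  (forall e, (\int[lebesgue_measure]_(x in edge_dom G e) ((u e x) ^+ 2)%:E
                < +oo)%E) /\
  (forall e, (\int[lebesgue_measure]_(x in edge_dom G e) ((du e x) ^+ 2)%:E
                < +oo)%E) /\
  (forall e x, edge_dom G e x ->
     (\int[lebesgue_measure]_(t in `[0%R, x]%classic) (du e t)%:E)%E
       = (u e x - u e 0)%:E) /\
  (exists phi : 'I_(nV G) -> R, forall e,
     u e 0 = phi (src G e) /\ (bnd G e -> u e (len G e) = phi (tgt G e))).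

Definition Lp_pow G (p : nat) (u : 'I_(nE G) -> R -> R) : \bar R :=
  (\sum_(e < nE G)
     \int[lebesgue_measure]_(x in edge_dom G e) (`|u e x| ^+ p)%:E)%E.

Definition mass G u := Lp_pow G 2 u.

Definition energy G (u du : 'I_(nE G) -> R -> R) : \bar R :=
  ((2^-1)%:E * Lp_pow G 2 du - (6^-1)%:E * Lp_pow G 6 u)%E.

Definition ground_energy G (mu : R) : \bar R :=
  ereal_inf [set y | exists u du,
     is_H1 G u du /\ mass G u = mu%:E /\ y = energy G u du].

Definition GN_ratio G (u du : 'I_(nE G) -> R -> R) : \bar R :=
  if fine (Lp_pow G 2 du) == 0 then +oo%E
  else (fine (Lp_pow G 6 u) / ((fine (mass G u)) ^+ 2 * fine (Lp_pow G 2 du)))%:E.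

Definition K_const G : \bar R :=
  ereal_sup [set y | exists u du,
     is_H1 G u du /\ mass G u != 0%E /\ y = GN_ratio G u du].

(* mu_X = sqrt(3 / K_X)   (= 0 when K_X = +oo) *)
Definition mu_crit G : R := Num.sqrt (3 / fine (K_const G)).

(* the halfline R^+ and the line R (two halflines glued at one vertex) *)
Definition halfline_graph : graph R :=
  @MkGraph R 1 1 (fun _ => false) (fun _ => 0) (fun _ => ord0) (fun _ => ord0).

Definition line_graph : graph R :=
  @MkGraph R 1 2 (fun _ => false) (fun _ => 0) (fun _ => ord0) (fun _ => ord0).

End Graphs.
Arguments wf_graph {R}.
Arguments edge_dom {R}.
Arguments degree {R}.
Arguments adj {R}.
Arguments connected_graph {R}.
Arguments noncompact {R}.
Arguments has_terminal_point {R}.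
Arguments is_halfline {R}.
Arguments is_H1 {R}.
Arguments Lp_pow {R}.
Arguments mass {R}.
Arguments energy {R}.
Arguments ground_energy {R}.
Arguments GN_ratio {R}.
Arguments K_const {R}.
Arguments mu_crit {R}.

(* Main.v *)
Require Import Defs.
From HB Require Import structures.
From mathcomp Require Import all_boot all_order all_algebra.
From mathcomp Require Import all_classical all_reals all_analysis.
From mathcomp Require Import measurable_realfun ring lra.
Import Order.TTheory GRing.Theory Num.Theory.
Import numFieldNormedType.Exports.
Set Implicit Arguments.
Unset Strict Implicit.
Unset Printing Implicit Defensive.
Local Open Scope classical_set_scope.
Local Open Scope ring_scope.

(** The inequality behind the theorem is
    [int u'^2 >= b^2 int u^6] with [b = pi / (4 m)], [m] the mass of [u].
    Along a path running from a point where [|u| = M] is maximal to infinity, let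
    [s] be the mass still ahead.  Completing the square in
    [u' + b tan (c - 2 b s) u^3], whose cross term is the derivative of
    [b tan (c - 2 b s) u^4 / 2] up to a multiple of [u^6], bounds
    [int (u'^2 - b^2 u^6)] on the path below by [b M^4 tan (2 b m_r) / 2], where
    [m_r] is the mass off the path (take [c = pi / 2]); off the path [int u^6] is
    at most [M^4 m_r], and [tan x >= x] concludes.  Equality forces [m_r = 0].
    Cutting the path at a point with mass [s] ahead and using two different values
    of [c] on the two sides then shows that [u <> 0] when [s > 0] and that
    [u^2 <= C s], so by Gronwall's lemma [s] never vanishes; hence [u] vanishes
    nowhere on the path but identically off it, and the path is all of [G].

    Sharpness comes from the optimiser [sqrt (sech x)], concentrated near the
    terminal point and corrected by [- eps / sqrt (sech x)] to vanish at the other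
    end of a bounded edge. *)

(** * The calibration inequality *)

(** The tangent comes from the first-order equation of the optimiser: for [u = sqrt (sech x)] the
    mass between 0 and [x] is the Gudermannian of [x], whose tangent is [sinh x], so
    [u' = - tan S * u ^ 3 / 2]. Its mass on the halfline is [pi / 2], which corresponds to
    [b = 1 / 2]. In general [b = pi / (4 m)] makes the total angle [2 b m] equal to [pi / 2],
    exactly where the tangent blows up; the calibration is therefore proved for smaller angles and
    reaches the critical one as a limit. In the lemmas the angle is [c + 2 b S] with [S] the mass
    already traversed, so that the optimal choice is the initial angle [2 b m_r]. At mass
    [pi * sqrt 3 / 4] one has [b ^ 2 = 1 / 3], the ratio of the two coefficients of the energy, and
    the inequality says that the energy is nonnegative. Every admissible [c] gives a valid
    inequality. A function without slack for one [c] is thus constrained by all the others; the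
    equality case exploits this, and no Euler-Lagrange equation is derived. *)

Lemma locally_increasing_le (R : realType) (F E : R -> R) (p q : R) : p <= q ->
  (forall e, 0 < e -> exists2 d, 0 < d & forall x y, p <= x -> x <= y -> y <= q ->
     y - x <= d -> F x - F y <= e * (E y - E x)) ->
  F p <= F q.
Proof.
move=> pq FE; rewrite -subr_ge0; set D := F q - F p.
(* This replaces the sign of a derivative: on a uniform subdivision of mesh at most [d] the local
   errors telescope to [e * (E q - E p)], and [e] is arbitrary. *)
have key e : 0 < e -> - D <= e * (E q - E p).
  move=> /FE [d d0 step].
  have [n [n0 nd]] : exists n : nat, (0 < n)%N /\ (q - p) / n%:R <= d.
    exists (Num.trunc ((q - p) / d)).+1; split=> //.
    rewrite ler_pdivrMr // mulrC -ler_pdivrMr //.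
    exact/ltW/truncnS_gt.
  pose h := (q - p) / n%:R.
  have h0 : 0 <= h by rewrite /h divr_ge0 // subr_ge0.
  have main k : (k <= n)%N -> F p - F (p + k%:R * h) <= e * (E (p + k%:R * h) - E p).
    elim: k => [_|k IH kn]; first by rewrite !mul0r !addr0 !subrr mulr0.
    have {IH} := IH (ltnW kn).
    have hn : k.+1%:R * h <= q - p.
      rewrite /h mulrCA ler_piMr ?subr_ge0 //.
      by rewrite ler_pdivrMr ?ltr0n // mul1r ler_nat.
    have e1 : k.+1%:R * h = k%:R * h + h by rewrite -natr1 mulrDl mul1r.
    have kh0 : 0 <= k%:R * h by rewrite mulr_ge0.
    have := step (p + k%:R * h) (p + k.+1%:R * h).
    have -> : p + k.+1%:R * h - (p + k%:R * h) = h by rewrite e1; ring.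
    move=> /(_ _ _ _ nd) => /(_ ltac:(lra) ltac:(lra) ltac:(lra)).
    by lra.
  have := main n (leqnn n); rewrite /h mulrC divfK ?pnatr_eq0 -?lt0n //.
  have -> : p + (q - p) = q by ring.
  by rewrite /D; lra.
rewrite leNgt; apply/negP => D0.
have E0 : 0 < `|E q - E p| + 1 by rewrite ltr_wpDl.
have := key (- D / 2 / (`|E q - E p| + 1)) ltac:(by rewrite !divr_gt0 // oppr_gt0).
have le1 : (E q - E p) / (`|E q - E p| + 1) <= 1.
  rewrite ler_pdivrMr // mul1r; have := ler_norm (E q - E p); lra.
have -> : - D / 2 / (`|E q - E p| + 1) * (E q - E p) =
   (- D / 2) * ((E q - E p) / (`|E q - E p| + 1)) by ring.
have : (- D / 2) * ((E q - E p) / (`|E q - E p| + 1)) <= - D / 2 * 1.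
  by rewrite ler_wpM2l //; lra.
by lra.
Qed.

(* [S], [Q] and [W] stand for the integrals of [u ^ 2], [u' ^ 2] and [u ^ 6] from a
   base point; these five properties are all that is used of an H1 function. *)
Record profile (R : realType) (D : set R) (u S Q W : R -> R) : Prop := Profile {
  profile_CS : forall x y, D x -> D y -> x <= y ->
    (u y - u x) ^+ 2 <= (y - x) * (Q y - Q x) ;
  profile_Sge : forall l x y, D x -> D y -> x <= y ->
    (forall t, x <= t <= y -> l <= u t ^+ 2) -> l * (y - x) <= S y - S x ;
  profile_Sle : forall r x y, D x -> D y -> x <= y ->
    (forall t, x <= t <= y -> u t ^+ 2 <= r) -> S y - S x <= r * (y - x) ;
  profile_Wge : forall l x y, 0 <= l -> D x -> D y -> x <= y ->
    (forall t, x <= t <= y -> l <= u t ^+ 2) -> l ^+ 3 * (y - x) <= W y - W x ;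
  profile_Wle : forall r x y, 0 <= r -> D x -> D y -> x <= y ->
    (forall t, x <= t <= y -> u t ^+ 2 <= r) -> W y - W x <= r ^+ 2 * (S y - S x) }.

Lemma tan_mvt (R : realType) (x y : R) : - (pi / 2) < x -> x <= y -> y < pi / 2 ->
  exists2 z, x <= z <= y & tan y - tan x = (1 + tan z ^+ 2) * (y - x).
Proof.
move=> hx xy hy.
have cosn0 z : x <= z <= y -> cos z != 0.
  move=> /andP[xz zy]; apply: lt0r_neq0; apply: cos_gt0_pihalf.
  by rewrite (lt_le_trans hx xz) (le_lt_trans zy hy).
have [z zxy e] := @MVT_segment R tan (fun z => (cos z) ^- 2) x y xy
  (fun z hz => is_derive_tan (cosn0 z ltac:(by move: hz; rewrite in_itv /= => /andP[/ltW -> /ltW ->])))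
  ltac:(apply: derivable_within_continuous => z hz;
        exact: derivable_tan (cosn0 z ltac:(by move: hz; rewrite in_itv))).
exists z; first by move: zxy; rewrite in_itv.
by rewrite e cos2_tan2 // cosn0 //; move: zxy; rewrite in_itv.
Qed.

Lemma tan_le (R : realType) (x y : R) : - (pi / 2) < x -> x <= y -> y < pi / 2 ->
  tan x <= tan y.
Proof.
move=> hx xy hy; have [z _ e] := tan_mvt hx xy hy.
by rewrite -subr_ge0 e mulr_ge0 ?subr_ge0 // addr_ge0 // sqr_ge0.
Qed.

Lemma mulr_norm_le (R : realFieldType) (x y X Y : R) :
  `|x| <= X -> `|y| <= Y -> `|x * y| <= X * Y.
Proof. by move=> hx hy; rewrite normrM ler_pM. Qed.

(** One step of length [h]: [a] is the initial value of [u] and [d] its increment; [dQ], [sg], [w]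
    are the increments of [Q], [S], [W]; [Tx], [Ty] are the tangents at the two ends and [z] the
    tangent at a mean-value point. After expansion of the fourth power each factor is frozen, at the
    cost of a multiple of [h * dQ] or of [eta * h]. *)
Lemma calibration_step (R : realFieldType) (a d h dQ sg w b Tx Ty z M eta Tm : R) :
  0 <= b -> 0 < h -> 1 <= M -> 0 <= eta <= 1 -> 0 <= dQ -> 0 <= sg ->
  `|a| <= M -> `|d| <= eta -> d ^+ 2 <= h * dQ ->
  sg <= M ^+ 2 * h -> (a ^+ 2 - 2 * M * eta) * h <= sg ->
  w <= (a ^+ 2 + 3 * M * eta) ^+ 2 * sg ->
  Ty - Tx = 2 * b * sg * (1 + z ^+ 2) -> Tx <= z <= Ty ->
  `|z| <= Tm -> `|Ty| <= Tm ->
  - (6 * b * M ^+ 2 * Tm * h * dQ +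
     (15 + 2 * Tm ^+ 2 + 4 * (1 + Tm ^+ 2)) * b ^+ 2 * M ^+ 5 * eta * h) <=
  dQ - b ^+ 2 * w + b / 2 * ((a + d) ^+ 4 * Ty - a ^+ 4 * Tx).
Proof.
move=> b0 h0 M1 /andP[eta0 eta1] dQ0 sg0 aM deta d2 sgu sgl wu eT /andP[Tz zT] zm Tym.
have M0 : 0 <= M by lra.
have Tm0 : 0 <= Tm by apply: le_trans zm.
have a2M : a ^+ 2 <= M ^+ 2.
  by rewrite -real_normK ?num_real // ler_sqr ?nnegrE.
have z2T : z ^+ 2 <= Tm ^+ 2.
  by rewrite -real_normK ?num_real // ler_sqr ?nnegrE.
have a4M : a ^+ 4 <= M ^+ 4 by rewrite !(exprM _ 2 2) ler_sqr ?nnegrE ?sqr_ge0.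
have -> : (a + d) ^+ 4 * Ty - a ^+ 4 * Tx =
  4 * a ^+ 3 * d * Ty + d ^+ 2 * (6 * a ^+ 2 + 4 * a * d + d ^+ 2) * Ty
  + a ^+ 4 * (Ty - Tx) by ring.
have P2 : - (6 * b * M ^+ 2 * Tm * h * dQ) <=
    b / 2 * (d ^+ 2 * (6 * a ^+ 2 + 4 * a * d + d ^+ 2) * Ty).
  have dM : `|d| <= M by lra.
  have n1 : `|6 * a ^+ 2 + 4 * a * d + d ^+ 2| <= 12 * M ^+ 2.
    have := mulr_norm_le aM dM; have := mulr_norm_le dM dM; have := mulr_norm_le aM aM.
    have := sqr_ge0 M; rewrite -!expr2 -!mulrA !ler_norml => ? /andP[? ?] /andP[? ?] /andP[? ?].
    by apply/andP; split; lra.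
  have n2 : `|d ^+ 2 * (6 * a ^+ 2 + 4 * a * d + d ^+ 2) * Ty| <=
      h * dQ * (12 * M ^+ 2) * Tm.
    apply: mulr_norm_le => //; apply: mulr_norm_le => //.
    by rewrite ger0_norm ?sqr_ge0.
  have := ler_wpM2l b0 n2.
  have := ler_wpM2l b0 (lerNnormlW (lexx `|d ^+ 2 * (6 * a ^+ 2 + 4 * a * d + d ^+ 2) * Ty|)).
  by lra.
have P3 : - (15 * b ^+ 2 * M ^+ 5 * eta * h) <= b ^+ 2 * a ^+ 4 * sg - b ^+ 2 * w.
  have h1 : (a ^+ 2 + 3 * M * eta) ^+ 2 - a ^+ 4 <= 15 * M ^+ 3 * eta.
    have -> : (a ^+ 2 + 3 * M * eta) ^+ 2 - a ^+ 4 =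
      eta * M * (6 * a ^+ 2 + 9 * (M * eta)) by ring.
    have -> : 15 * M ^+ 3 * eta = eta * M * (15 * M ^+ 2) by ring.
    apply: ler_wpM2l; first exact: mulr_ge0.
    suff : M * eta <= M ^+ 2 by lra.
    by rewrite expr2 ler_wpM2l //; lra.
  have h2 : ((a ^+ 2 + 3 * M * eta) ^+ 2 - a ^+ 4) * sg <= 15 * M ^+ 3 * eta * (M ^+ 2 * h).
    apply: ler_pM => //.
    suff -> : (a ^+ 2 + 3 * M * eta) ^+ 2 - a ^+ 4 =
      eta * M * (6 * a ^+ 2 + 9 * (M * eta)) by rewrite !(sqr_ge0, mulr_ge0, addr_ge0).
    by ring.
  have h3 : w - a ^+ 4 * sg <= 15 * M ^+ 3 * eta * (M ^+ 2 * h) by lra.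
  have := ler_wpM2l (sqr_ge0 b) h3; lra.
have P4 : b ^+ 2 * a ^+ 6 * z ^+ 2 * h - 2 * Tm ^+ 2 * b ^+ 2 * M ^+ 5 * eta * h
    <= b ^+ 2 * a ^+ 4 * z ^+ 2 * sg.
  have c0 : 0 <= b ^+ 2 * a ^+ 4 * z ^+ 2.
    by rewrite !(sqr_ge0, exprn_even_ge0, mulr_ge0).
  have := ler_wpM2l c0 sgl.
  have : a ^+ 4 * z ^+ 2 <= M ^+ 4 * Tm ^+ 2.
    by rewrite ler_pM ?sqr_ge0 ?exprn_even_ge0.
  have k0 : 0 <= 2 * b ^+ 2 * M * eta * h by rewrite !(sqr_ge0, mulr_ge0) // ltW.
  by move=> /(ler_wpM2l k0); lra.
have P5 : - (4 * (1 + Tm ^+ 2) * b ^+ 2 * M ^+ 5 * eta * h) <=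
    2 * b * a ^+ 3 * d * (Ty - z).
  have n1 : `|a ^+ 3 * d| <= M ^+ 3 * eta.
    by apply: mulr_norm_le => //; rewrite normrX lerXn2r ?nnegrE.
  have n2 : `|Ty - z| <= 2 * b * (M ^+ 2 * h) * (1 + Tm ^+ 2).
    rewrite ger0_norm ?subr_ge0 //; apply: (@le_trans _ _ (Ty - Tx)); first by lra.
    rewrite eT; apply: ler_pM; [by rewrite !mulr_ge0|by rewrite addr_ge0 ?sqr_ge0| |by lra].
    by rewrite ler_wpM2l // mulr_ge0.
  have n3 := mulr_norm_le n1 n2.
  have := lerNnormlW n3 => n4.
  have := ler_wpM2l b0 n4; lra.
have P6 : 0 <= dQ + 2 * b * a ^+ 3 * d * z + b ^+ 2 * a ^+ 6 * z ^+ 2 * h.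
  rewrite -(pmulr_rge0 _ h0).
  have := sqr_ge0 (d + b * a ^+ 3 * z * h); lra.
rewrite eT; lra.
Qed.

Section ProfileTheory.
Variables (R : realType) (D : set R) (u S Q W : R -> R).
Hypothesis prf : profile D u S Q W.

Lemma profile_Q_le x y : D x -> D y -> x <= y -> Q x <= Q y.
Proof.
move=> Dx Dy; rewrite le_eqVlt => /orP[/eqP ->//|xy].
have := profile_CS prf Dx Dy (ltW xy).
move=> /(le_trans (sqr_ge0 _)); rewrite pmulr_rge0 ?subr_gt0 //.
by rewrite subr_ge0.
Qed.

Lemma profile_S_le x y : D x -> D y -> x <= y -> S x <= S y.
Proof.
move=> Dx Dy xy; rewrite -subr_ge0.
by have := profile_Sge prf Dx Dy xy (fun t _ => sqr_ge0 (u t)); rewrite mul0r.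
Qed.

Lemma profile_W_le x y : D x -> D y -> x <= y -> W x <= W y.
Proof.
move=> Dx Dy xy; rewrite -subr_ge0.
have := profile_Wge prf (lexx 0) Dx Dy xy (fun t _ => sqr_ge0 (u t)).
by rewrite expr0n mul0r.
Qed.

End ProfileTheory.

Lemma profile_sub (R : realType) (D D' : set R) (u S Q W : R -> R) :
  D' `<=` D -> profile D u S Q W -> profile D' u S Q W.
Proof.
move=> DD [a b c d e]; split=> *.
- exact: a (DD _ _) (DD _ _) _.
- exact: b (DD _ _) (DD _ _) _ _.
- exact: c (DD _ _) (DD _ _) _ _.
- exact: d (DD _ _) (DD _ _) _ _.
- exact: e (DD _ _) (DD _ _) _ _.
Qed.

(* Completing the square in [u' + b * tan (c + 2 b S) * u ^ 3], whose cross term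
   is a total derivative because [S' = u ^ 2] and [tan' = 1 + tan ^ 2]; as [u]
   is only absolutely continuous, the identity is replaced by a local
   inequality, with error small with respect to [dx + dQ]. *)
Lemma calibration (R : realType) (D : set R) (u S Q W : R -> R) (p q b c : R) :
  `[p, q]%classic `<=` D -> profile D u S Q W -> p <= q -> 0 <= b -> - (pi / 2) < c ->
  c + 2 * b * (S q - S p) < pi / 2 ->
  b / 2 * (u p ^+ 4 * tan c - u q ^+ 4 * tan (c + 2 * b * (S q - S p)))
  <= (Q q - Q p) - b ^+ 2 * (W q - W p).
Proof.
move=> Dpq /(profile_sub Dpq) prf pq b0 cl cu.
have Dx x : p <= x <= q -> `[p, q]%classic x by move=> ?; rewrite /= in_itv.
have Dp : `[p, q]%classic p by apply: Dx; rewrite lexx.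
have Dq : `[p, q]%classic q by apply: Dx; rewrite lexx pq.
pose A := Q q - Q p.
have A0 : 0 <= A by rewrite subr_ge0 (profile_Q_le prf).
(* A bound of [|u|] on the segment: Cauchy-Schwarz gives [(u x - u p) ^ 2 <= (q - p) * A], and
   [|t| <= 1 + t ^ 2] avoids the square root. *)
pose M := `|u p| + 1 + (q - p) * A.
have M1 : 1 <= M.
  have : 0 <= (q - p) * A by rewrite mulr_ge0 // subr_ge0.
  have := normr_ge0 (u p); rewrite /M; lra.
have uM x : p <= x <= q -> `|u x| <= M.
  move=> xpq; have /andP[px xq] := xpq.
  have h1 : (u x - u p) ^+ 2 <= (q - p) * A.
    apply: le_trans (profile_CS prf Dp (Dx _ xpq) px) _.
    apply: ler_pM; rewrite ?subr_ge0 //; last 1 first.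
    - by rewrite lerD2r; apply: (profile_Q_le prf) => //; exact: Dx.
    - by apply: (profile_Q_le prf) => //; exact: Dx.
    - by lra.
  have h2 : `|u x - u p| <= 1 + (u x - u p) ^+ 2.
    have := sqr_ge0 (1 - `|u x - u p|); rewrite -(real_normK (num_real (u x - u p))).
    have := sqr_ge0 (`|u x - u p|); lra.
  have -> : u x = u p + (u x - u p) by ring.
  apply: le_trans (ler_normD _ _) _; rewrite /M; lra.
pose th x := c + 2 * b * (S x - S p).
have thp : th p = c by rewrite /th subrr mulr0 addr0.
have th_le x y : p <= x -> x <= y -> y <= q -> th x <= th y.
  move=> px xy yq; rewrite lerD2l ler_wpM2l ?mulr_ge0 // lerD2r.
  by apply: (profile_S_le prf) => //; apply: Dx; lra.
have th_lo x : p <= x <= q -> - (pi / 2) < th x.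
  by move=> /andP[px xq]; apply: lt_le_trans cl _; rewrite -thp th_le.
have th_hi x : p <= x <= q -> th x < pi / 2.
  by move=> /andP[px xq]; apply: le_lt_trans cu; exact: th_le.
pose Tm := `|tan (th p)| + `|tan (th q)|.
have Tm0 : 0 <= Tm by rewrite addr_ge0.
have TTm z : th p <= z <= th q -> `|tan z| <= Tm.
  move=> /andP[pz zq].
  have t1 : tan (th p) <= tan z.
    apply: tan_le pz _; first by apply: th_lo; lra.
    by apply: le_lt_trans zq (th_hi _ _); lra.
  have t2 : tan z <= tan (th q).
    apply: tan_le zq _; last by apply: th_hi; lra.
    by apply: lt_le_trans pz; apply: th_lo; lra.
  have := ler_norm (tan (th q)); have := lerNnormlW (lexx `|tan (th p)|).
  have := normr_ge0 (tan (th q)); have := normr_ge0 (tan (th p)).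
  by rewrite ler_norml /Tm => *; apply/andP; split; lra.
pose C1 := 6 * b * M ^+ 2 * Tm.
pose C2 := (15 + 2 * Tm ^+ 2 + 4 * (1 + Tm ^+ 2)) * b ^+ 2 * M ^+ 5.
have M0 : 0 <= M by lra.
have C10 : 0 <= C1 by rewrite !(sqr_ge0, mulr_ge0).
have C20 : 0 <= C2.
  rewrite /C2 mulr_ge0 ?exprn_ge0 // mulr_ge0 ?sqr_ge0 //.
  have := sqr_ge0 Tm; lra.
pose F x := Q x - b ^+ 2 * W x + b / 2 * (u x ^+ 4 * tan (th x)).
suff : F p <= F q.
  by rewrite /F thp -/(th q); lra.
apply: (@locally_increasing_le _ F (fun x => x + Q x)) => // e e0.
(* [eta] bounds the oscillation of [u] on a step and absorbs the error [C2 * eta * h]. The two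
   entries of [d] serve Cauchy-Schwarz, which needs [d * A <= eta ^ 2], and the error
   [C1 * h * dQ]. *)
pose eta := Num.min 1 (e / (C2 + 1)).
have eta0 : 0 < eta.
  by rewrite /eta lt_min ltr01 divr_gt0 //; lra.
have eta1 : eta <= 1 by rewrite /eta ge_min lexx.
have etaC : C2 * eta <= e.
  have h : eta <= e / (C2 + 1) by rewrite /eta ge_min lexx orbT.
  have : eta * (C2 + 1) <= e by rewrite -ler_pdivlMr //; lra.
  by lra.
pose d := Num.min (eta ^+ 2 / (A + 1)) (e / (C1 + 1)).
have d0 : 0 < d.
  by rewrite /d lt_min !divr_gt0 ?exprn_gt0 //; lra.
have dA : d * A <= eta ^+ 2.
  have h : d <= eta ^+ 2 / (A + 1) by rewrite /d ge_min lexx.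
  have : d * (A + 1) <= eta ^+ 2 by rewrite -ler_pdivlMr //; lra.
  by lra.
have dC : C1 * d <= e.
  have h : d <= e / (C1 + 1) by rewrite /d ge_min lexx orbT.
  have : d * (C1 + 1) <= e by rewrite -ler_pdivlMr //; lra.
  by lra.
exists d => // x y px + yq; rewrite le_eqVlt => /orP[/eqP -> _|xy xyd].
  by rewrite !subrr mulr0.
have Ix : p <= x <= q by lra.
have Iy : p <= y <= q by lra.
pose h := y - x; have h0 : 0 < h by rewrite subr_gt0.
have near_x t : x <= t <= y -> `|u t - u x| <= eta.
  move=> /andP[xt ty]; have It : p <= t <= q by lra.
  rewrite -(@ler_pXn2r _ 2) ?nnegrE //; last exact: ltW.
  rewrite real_normK ?num_real //; apply: le_trans dA.
  apply: le_trans (profile_CS prf (Dx _ Ix) (Dx _ It) xt) _.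
  apply: ler_pM; rewrite ?subr_ge0 //.
  - by apply: (profile_Q_le prf) => //; exact: Dx.
  - by lra.
  - apply: lerD; first by apply: (profile_Q_le prf) => //; lra.
    by rewrite lerN2; apply: (profile_Q_le prf) => //; exact: Dx.
have uxM := uM _ Ix.
have u2lb t : x <= t <= y -> u x ^+ 2 - 2 * M * eta <= u t ^+ 2.
  move=> /near_x ht.
  have e1 : u t ^+ 2 = u x ^+ 2 + 2 * (u x * (u t - u x)) + (u t - u x) ^+ 2 by ring.
  have := lerNnormlW (mulr_norm_le uxM ht); have := sqr_ge0 (u t - u x); lra.
have u2ub t : x <= t <= y -> u t ^+ 2 <= u x ^+ 2 + 3 * M * eta.
  move=> /near_x ht.
  have e1 : u t ^+ 2 = u x ^+ 2 + 2 * (u x * (u t - u x)) + (u t - u x) * (u t - u x) by ring.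
  have := ler_normlW (mulr_norm_le uxM ht); have := ler_normlW (mulr_norm_le ht ht).
  have : eta * eta <= M * eta by apply: ler_wpM2r; lra.
  by lra.
have ux0 : 0 <= u x ^+ 2 + 3 * M * eta.
  by rewrite addr_ge0 ?sqr_ge0 // !mulr_ge0 //; lra.
have ut2M t : x <= t <= y -> u t ^+ 2 <= M ^+ 2.
  move=> ht; rewrite -real_normK ?num_real // ler_sqr ?nnegrE //; apply: uM; lra.
have hS := profile_Sle prf (Dx _ Ix) (Dx _ Iy) (ltW xy) ut2M.
have hSl := profile_Sge prf (Dx _ Ix) (Dx _ Iy) (ltW xy) u2lb.
have hW := profile_Wle prf ux0 (Dx _ Ix) (Dx _ Iy) (ltW xy) u2ub.
have [z /andP[z1 z2] ez] := tan_mvt (th_lo _ Ix) (th_le _ _ px (ltW xy) yq) (th_hi _ Iy).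
have zpq : th p <= z <= th q.
  apply/andP; split; [apply: le_trans z1|apply: le_trans z2 _].
  - by apply: th_le => //; lra.
  - by apply: th_le => //; lra.
have yx0 : x <= y <= y by lra.
have := @calibration_step R (u x) (u y - u x) h (Q y - Q x) (S y - S x) (W y - W x) b
  (tan (th x)) (tan (th y)) (tan z) M eta Tm b0 h0 M1 ltac:(lra)
  ltac:(by rewrite subr_ge0; apply: (profile_Q_le prf) (ltW xy); exact: Dx)
  ltac:(by rewrite subr_ge0; apply: (profile_S_le prf) (ltW xy); exact: Dx)
  uxM (near_x y yx0) (profile_CS prf (Dx _ Ix) (Dx _ Iy) (ltW xy)) hS hSl hW.
have -> : tan (th y) - tan (th x) = 2 * b * (S y - S x) * (1 + tan z ^+ 2).
  by rewrite ez /th; ring.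
move=> /(_ erefl).
have tz1 : tan (th x) <= tan z by exact: tan_le (th_lo _ Ix) z1 (le_lt_trans z2 (th_hi _ Iy)).
have tz2 : tan z <= tan (th y) by exact: tan_le (lt_le_trans (th_lo _ Ix) z1) z2 (th_hi _ Iy).
rewrite tz1 tz2 => /(_ isT (TTm _ zpq)) => /(_ ltac:(by apply: TTm; rewrite !th_le //; lra)).
have -> : u x + (u y - u x) = u y by ring.
rewrite -/C1 -/C2 /F => H.
have e1 : C1 * h * (Q y - Q x) <= e * (Q y - Q x).
  apply: ler_wpM2r; first by rewrite subr_ge0; apply: (profile_Q_le prf) (ltW xy); exact: Dx.
  by apply: le_trans dC; rewrite ler_wpM2l.
have e2 : C2 * eta * h <= e * h by rewrite ler_wpM2r // ltW.
have e3 : e * (y + Q y - (x + Q x)) = e * h + e * (Q y - Q x) by rewrite /h; ring.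
by rewrite e3; lra.
Qed.

(** On this radius Cauchy-Schwarz gives [|u t - u x| <= |u x| / 2]; [A + 1] in place of [A] keeps
    the denominator positive. *)
Lemma profile_near (R : realType) (D : set R) (u S Q W : R -> R) (A x t : R) :
  profile D u S Q W -> D x -> D t -> 0 <= A -> `|Q t - Q x| <= A ->
  `|t - x| <= u x ^+ 2 / (4 * (A + 1)) -> u x ^+ 2 / 4 <= u t ^+ 2.
Proof.
move=> prf Dx Dt A0 QA.
have A1 : 0 < 4 * (A + 1) by lra.
rewrite ler_pdivlMr // => tx.
have CS : (u t - u x) ^+ 2 <= `|t - x| * A.
  case: (leP x t) => [xt|/ltW tx'].
    apply: le_trans (profile_CS prf Dx Dt xt) _.
    rewrite (ger0_norm (_ : 0 <= t - x)) ?subr_ge0 // ler_wpM2l ?subr_ge0 //.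
    exact: le_trans (ler_norm _) QA.
  have -> : (u t - u x) ^+ 2 = (u x - u t) ^+ 2 by ring.
  apply: le_trans (profile_CS prf Dt Dx tx') _.
  rewrite distrC (ger0_norm (_ : 0 <= x - t)) ?subr_ge0 // ler_wpM2l ?subr_ge0 //.
  by rewrite distrC in QA; exact: le_trans (ler_norm _) QA.
have h1 : 4 * (u t - u x) ^+ 2 <= u x ^+ 2.
  have := normr_ge0 (t - x); lra.
have h2 : `|u t - u x| <= `|u x| / 2.
  rewrite -(@ler_pXn2r _ 2) ?nnegrE ?divr_ge0 // expr_div_n !real_normK ?num_real //; lra.
have h3 : `|u x| / 2 <= `|u t|.
  have := ler_normB (u t) (u t - u x).
  have -> : u t - (u t - u x) = u x by ring.
  by lra.
have : (`|u x| / 2) ^+ 2 <= `|u t| ^+ 2 by rewrite ler_sqr ?nnegrE ?divr_ge0.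
by rewrite expr_div_n !real_normK ?num_real //; lra.
Qed.

Section ProfileSegment.
Variables (R : realType) (D : set R) (u S Q W : R -> R) (p q : R).
Hypotheses (prf : profile D u S Q W) (Dpq : `[p, q]%classic `<=` D) (pq : p < q).

Let prf' := profile_sub Dpq prf.
Let inD x : p <= x -> x <= q -> `[p, q]%classic x.
Proof. by move=> px xq; rewrite /= in_itv /= px xq. Qed.

Let Qpq : 0 <= Q q - Q p.
Proof. by rewrite subr_ge0; apply: (profile_Q_le prf') (ltW pq); apply: inD => //; exact: ltW. Qed.

Let Qdist x y : p <= x -> x <= q -> p <= y -> y <= q -> `|Q x - Q y| <= Q q - Q p.
Proof.
move=> px xq py yq.
have h z : p <= z -> z <= q -> Q p <= Q z /\ Q z <= Q q.
  move=> pz zq; split; apply: (profile_Q_le prf') => //; apply: inD => //;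
  exact: ltW.
have [? ?] := h x px xq; have [? ?] := h y py yq.
by rewrite ler_norml; apply/andP; split; lra.
Qed.

Lemma profile_large_subsegment x : p <= x <= q -> u x != 0 ->
  exists x1 x2, [/\ p <= x1, x1 < x2, x2 <= q &
    forall t, x1 <= t <= x2 -> u x ^+ 2 / 4 <= u t ^+ 2].
Proof.
move=> /andP[px xq] ux0.
pose r := u x ^+ 2 / (4 * (Q q - Q p + 1)).
have r0 : 0 < r.
  by apply: divr_gt0; [rewrite exprn_even_gt0|have := Qpq; lra].
have near t : p <= t -> t <= q -> `|t - x| <= r -> u x ^+ 2 / 4 <= u t ^+ 2.
  move=> pt tq; apply: (profile_near prf' (inD px xq) (inD pt tq)) => //.
  exact: Qdist.
case: (ltP x q) => [xq'|qx].
  exists x, (Num.min (x + r) q); split => //.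
  - by rewrite lt_min xq' andbT ltrDl.
  - by rewrite ge_min lexx orbT.
  - move=> t /andP[xt]; rewrite le_min => /andP[tr tq].
    by apply: near; rewrite ?ger0_norm; lra.
exists (Num.max (x - r) p), x; split => //.
- by rewrite le_max lexx orbT.
- by rewrite gt_max; apply/andP; split; [rewrite ltrBlDr ltrDl|exact: lt_le_trans pq qx].
- move=> t /andP[]; rewrite ge_max => /andP[tr tp] tx.
  by apply: near; rewrite ?ler0_norm; lra.
Qed.

Lemma profile_S_lt x : p <= x <= q -> u x != 0 -> S p < S q.
Proof.
move=> xpq ux0; have [x1 [x2 [px1 x12 x2q h]]] := profile_large_subsegment xpq ux0.
have D1 : `[p, q]%classic x1 by apply: inD; lra.
have D2 : `[p, q]%classic x2 by apply: inD; lra.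
have := profile_Sge prf' D1 D2 (ltW x12) h.
have : S p <= S x1 by apply: (profile_S_le prf') => //; apply: inD; lra.
have : S x2 <= S q by apply: (profile_S_le prf') => //; apply: inD; lra.
have : 0 < u x ^+ 2 / 4 * (x2 - x1).
  by rewrite mulr_gt0 ?subr_gt0 // divr_gt0 // exprn_even_gt0.
by lra.
Qed.

Lemma profile_W_lt x : p <= x <= q -> u x != 0 -> W p < W q.
Proof.
move=> xpq ux0; have [x1 [x2 [px1 x12 x2q h]]] := profile_large_subsegment xpq ux0.
have D1 : `[p, q]%classic x1 by apply: inD; lra.
have D2 : `[p, q]%classic x2 by apply: inD; lra.
have l0 : 0 < u x ^+ 2 / 4 by rewrite divr_gt0 // exprn_even_gt0.
have := profile_Wge prf' (ltW l0) D1 D2 (ltW x12) h.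
have : W p <= W x1 by apply: (profile_W_le prf') => //; apply: inD; lra.
have : W x2 <= W q by apply: (profile_W_le prf') => //; apply: inD; lra.
have : 0 < (u x ^+ 2 / 4) ^+ 3 * (x2 - x1).
  by rewrite mulr_gt0 ?subr_gt0 // exprn_gt0.
by lra.
Qed.

Lemma profile_max : exists2 x, p <= x <= q &
  forall t, p <= t <= q -> `|u t| <= `|u x|.
Proof.
(* Clamping to [[p, q]] turns [u] into a function continuous on the whole line: [cl] is 1-Lipschitz
   and Cauchy-Schwarz makes [u] Hölder continuous on the segment. *)
pose cl t := Num.max p (Num.min t q).
have clI t : p <= cl t /\ cl t <= q.
  by rewrite /cl ge_max ge_min le_max lexx /= lexx orbT andbT (ltW pq).
have clid t : p <= t <= q -> cl t = t.
  by move=> /andP[pt tq]; rewrite /cl (min_idPl tq) (max_idPr pt).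
have cl1 s t : s <= t -> `|cl t - cl s| <= t - s.
  move=> st; rewrite /cl !minEle.
  by do ?[case: ifPn; rewrite -?ltNge => ?]; rewrite !maxEle;
    do ?[case: ifPn; rewrite -?ltNge => ?]; rewrite ler_norml; apply/andP; split; lra.
have cl2 s t : `|cl t - cl s| <= `|t - s|.
  case: (leP s t) => st.
    by rewrite (ger0_norm (_ : 0 <= t - s)) ?subr_ge0 // cl1.
  rewrite distrC (distrC t) (gtr0_norm (_ : 0 < s - t)) ?subr_gt0 //.
  exact: cl1 (ltW st).
have cont : continuous (fun t => `|u (cl t)|).
  move=> t; apply: cvg_norm; apply/cvgrPdist_le => e e0.
  have d0 : 0 < e ^+ 2 / (Q q - Q p + 1) by rewrite divr_gt0 ?exprn_gt0 //; have := Qpq; lra.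
  near=> s.
  have st : `|t - s| <= e ^+ 2 / (Q q - Q p + 1).
    by near: s; apply: cvgr_dist_le; [exact: cvg_id|exact: d0].
  rewrite -(@ler_pXn2r _ 2) ?nnegrE ?(ltW e0) // real_normK ?num_real //.
  rewrite ler_pdivlMr in st; last by have := Qpq; lra.
  have [pt tq] := clI t; have [ps sq] := clI s.
  have CS : (u (cl t) - u (cl s)) ^+ 2 <= `|cl t - cl s| * (Q q - Q p).
    case: (leP (cl s) (cl t)) => hst.
      apply: le_trans (profile_CS prf' (inD ps sq) (inD pt tq) hst) _.
      rewrite ger0_norm ?subr_ge0 // ler_wpM2l ?subr_ge0 //.
      by apply: le_trans (ler_norm _) (Qdist _ _ _ _).
    have -> : (u (cl t) - u (cl s)) ^+ 2 = (u (cl s) - u (cl t)) ^+ 2 by ring.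
    apply: le_trans (profile_CS prf' (inD pt tq) (inD ps sq) (ltW hst)) _.
    rewrite distrC gtr0_norm ?subr_gt0 // ler_wpM2l ?subr_ge0 ?(ltW hst) //.
    by apply: le_trans (ler_norm _) (Qdist _ _ _ _).
  have : `|cl t - cl s| * (Q q - Q p) <= `|t - s| * (Q q - Q p) by rewrite ler_wpM2r.
  have := normr_ge0 (t - s); lra.
have [x xpq hx] := EVT_max (ltW pq) (continuous_subspaceT cont).
exists x; first by move: xpq; rewrite in_itv.
move=> t tpq; have := hx t; rewrite in_itv /= => /(_ tpq).
by rewrite !clid //; move: xpq; rewrite in_itv.
Unshelve. all: end_near.
Qed.

End ProfileSegment.

Section ProfileHalfline.
Variables (R : realType) (u S Q W : R -> R) (p m q : R).
Hypothesis prf : profile `[p, +oo[%classic u S Q W.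
Hypotheses (Sm : forall x, p <= x -> S x - S p <= m)
           (Qq : forall x, p <= x -> Q x - Q p <= q).

Let inD x : p <= x -> `[p, +oo[%classic x.
Proof. by move=> px; rewrite /= in_itv /= px. Qed.

Let q0 : 0 <= q.
Proof. by have := Qq (lexx p); rewrite subrr. Qed.

(** A value [u x] persists up to a factor 2 on a length [u x ^ 2 / (4 * (q + 1))], which carries
    mass at least [u x ^ 4 / (16 * (q + 1))]. With [e] the total mass this is a global bound of [u];
    with [e] a small tail mass it is decay at infinity. *)
Lemma profile_tail_bound x e : p <= x -> (forall y, x <= y -> S y - S x <= e) ->
  u x ^+ 4 <= 16 * (q + 1) * e.
Proof.
move=> px Se.
pose r := u x ^+ 2 / (4 * (q + 1)).
have r0 : 0 <= r by rewrite divr_ge0 ?sqr_ge0 //; have := q0; lra.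
have py : p <= x + r by lra.
have := profile_Sge prf (inD px) (inD py) ltac:(lra) (l := u x ^+ 2 / 4).
have -> : x + r - x = r by ring.
move=> /(_ _)/le_trans H.
have hH : u x ^+ 2 / 4 * r <= e.
  apply: H; last by apply: Se; lra.
  move=> t /andP[xt tx]; have pt : p <= t by lra.
  apply: (profile_near prf (inD px) (inD pt) q0).
    rewrite ger0_norm; last by rewrite subr_ge0 (profile_Q_le prf) //; exact: inD.
    have := Qq pt; have : Q p <= Q x by rewrite (profile_Q_le prf) //; exact: inD.
    by lra.
  by rewrite ger0_norm ?subr_ge0 // lerBlDl.
have e4 : u x ^+ 4 = u x ^+ 2 / 4 * r * (16 * (q + 1)).
  by rewrite /r; field; have := q0; lra.
by rewrite e4 mulrC ler_wpM2l //; have := q0; lra.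
Qed.

Lemma profile_small_value n e : p <= n -> 0 < e -> exists2 x, n <= x & `|u x| <= e.
Proof.
move=> pn e0; apply: contrapT => H.
have big x : n <= x -> e ^+ 2 <= u x ^+ 2.
  move=> nx; rewrite -[leRHS]real_normK ?num_real // ler_sqr ?nnegrE ?(ltW e0) //; apply: ltW.
  by rewrite ltNge; apply/negP => ux; apply: H; exists x.
have m0 : 0 <= m by have := Sm (lexx p); rewrite subrr.
pose y := n + (m + 1) / e ^+ 2.
have ny : n <= y by rewrite lerDl divr_ge0 ?sqr_ge0 //; lra.
have py : p <= y by lra.
have := profile_Sge prf (inD pn) (inD py) ny (fun t ht => big t (proj1 (andP ht))).
have -> : e ^+ 2 * (y - n) = m + 1.
  by rewrite /y; field; rewrite lt0r_neq0.
have := Sm py; have : S p <= S n by rewrite (profile_S_le prf) //; exact: inD.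
by lra.
Qed.

(** The calibration on [[p, x]] is used at far points [x] where [u x] is small, which exist because
    the mass is finite. Since [c + 2 b m] stays strictly below [pi / 2], the tangent at [x] is
    bounded and the boundary term there disappears. *)
Lemma calibration_halfline b c w : 0 <= b -> - (pi / 2) < c ->
  c + 2 * b * m < pi / 2 ->
  (forall e, 0 < e -> exists2 x, p <= x & w - e <= W x - W p) ->
  b / 2 * (u p ^+ 4 * tan c) <= q - b ^+ 2 * w.
Proof.
move=> b0 cl cu Ww; apply/ler_addgt0Pr => e e0.
have T0 : 0 <= `|tan (c + 2 * b * m)| by [].
set T := `|tan (c + 2 * b * m)| in T0 *.
pose e1 := e / (2 * (b ^+ 2 + 1)).
have b20 := sqr_ge0 b.
have e10 : 0 < e1 by rewrite divr_gt0 //; lra.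
have be1 : b ^+ 2 * e1 <= e / 2.
  have : e1 * (2 * (b ^+ 2 + 1)) = e by rewrite /e1; field; lra.
  by lra.
have [x0 px0 Wx0] := Ww _ e10.
have bT0 : 0 <= b / 2 * T by rewrite mulr_ge0 // divr_ge0.
(* The bound by 1 is what gives [u x ^ 4 <= |u x|]. *)
pose e2 := Num.min 1 (e / 2 / (b / 2 * T + 1)).
have e20 : 0 < e2.
  by rewrite lt_min ltr01 /= !divr_gt0 //; lra.
have e21 : e2 <= 1 by rewrite ge_min lexx.
have be2 : b / 2 * T * e2 <= e / 2.
  have : e2 <= e / 2 / (b / 2 * T + 1) by rewrite ge_min lexx orbT.
  by rewrite ler_pdivlMr; lra.
have [x x0x ux] := profile_small_value px0 e20.
have px : p <= x by lra.
have Dpx : `[p, x]%classic `<=` `[p, +oo[%classic.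
  by move=> t; rewrite /= !in_itv /= => /andP[-> _].
have S0 : 0 <= S x - S p by rewrite subr_ge0 (profile_S_le prf) //; exact: inD.
have thm : c + 2 * b * (S x - S p) <= c + 2 * b * m.
  by rewrite lerD2l ler_wpM2l ?mulr_ge0 // Sm.
have := calibration Dpx prf px b0 cl (le_lt_trans thm cu).
have Wx : W x0 <= W x by rewrite (profile_W_le prf) //; exact: inD.
have tT : tan (c + 2 * b * (S x - S p)) <= T.
  apply: le_trans (ler_norm _); apply: tan_le => //.
  by apply: lt_le_trans cl _; rewrite lerDl !mulr_ge0.
have u4 : u x ^+ 4 <= e2.
  have -> : u x ^+ 4 = `|u x| ^+ 4 by rewrite -normrX ger0_norm // exprn_even_ge0.
  by apply: (le_trans _ ux); rewrite exprS ler_piMr // exprn_ile1 //; exact: le_trans ux e21.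
have u40 : 0 <= u x ^+ 4 by rewrite exprn_even_ge0.
have k1 : u x ^+ 4 * tan (c + 2 * b * (S x - S p)) <= e2 * T.
  apply: le_trans (ler_wpM2l u40 tT) _; exact: ler_wpM2r.
have k2 : b / 2 * (u x ^+ 4 * tan (c + 2 * b * (S x - S p))) <= b / 2 * (e2 * T).
  by rewrite ler_wpM2l // divr_ge0.
have k3 : b ^+ 2 * (w - e1) <= b ^+ 2 * (W x - W p) by rewrite ler_wpM2l //; lra.
have := Qq px.
by lra.
Qed.

End ProfileHalfline.

(** * H1 functions on an edge *)

Section SegmentIntegral.
Context {R : realType}.
Local Notation mu := (@lebesgue_measure R).
Implicit Types (f g : R -> R) (x y r : R).

Lemma Rintegral_segB f x y : mu.-integrable `[0, y]%classic (EFin \o f) ->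
  0 <= x -> x <= y ->
  \int[mu]_(t in `[0, y]) f t - \int[mu]_(t in `[0, x]) f t =
  \int[mu]_(t in `[x, y]) f t.
Proof.
move=> itf x0 xy; rewrite Rintegral_itvB ?bnd_simp //.
rewrite Rintegral_itv_obnd_cbnd //.
apply: integrableS itf => //; apply: subset_itv; rewrite bnd_simp //.
Qed.

Lemma integrable_seg f x y : mu.-integrable `[0, y]%classic (EFin \o f) ->
  0 <= x -> mu.-integrable `[x, y]%classic (EFin \o f).
Proof.
move=> itf x0; apply: integrableS itf => //; apply: subset_itv; rewrite bnd_simp //.
Qed.

Lemma lebesgue_measure_seg x y : x <= y -> mu `[x, y]%classic = (y - x)%:E.
Proof.
move=> xy; rewrite lebesgue_measure_itv /= lte_fin; case: ifPn => [_|].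
  by rewrite EFinB.
by rewrite -leNgt => yx; rewrite (le_anti (introT andP (conj xy yx))) subrr.
Qed.

Lemma Rintegral_cst_seg x y r : x <= y -> \int[mu]_(t in `[x, y]) r = r * (y - x).
Proof. by move=> xy; rewrite Rintegral_cst //= lebesgue_measure_seg. Qed.

Lemma integrable_cst_seg x y r : mu.-integrable `[x, y]%classic (EFin \o fun=> r).
Proof.
apply: measurable_bounded_integrable => //.
  case: (leP x y) => xy /=; first by rewrite lebesgue_measure_seg // ltry.
  by rewrite set_itv_ge ?measure0 // bnd_simp -ltNge.
exact: bounded_cst.
Qed.

Lemma Rintegral_seg_ge f x y r : x <= y -> mu.-integrable `[x, y]%classic (EFin \o f) ->
  (forall t, x <= t <= y -> r <= f t) -> r * (y - x) <= \int[mu]_(t in `[x, y]) f t.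
Proof.
move=> xy itf rf; rewrite -Rintegral_cst_seg //.
by apply: le_Rintegral => //; exact: integrable_cst_seg.
Qed.

Lemma Rintegral_seg_le f x y r : x <= y -> mu.-integrable `[x, y]%classic (EFin \o f) ->
  (forall t, x <= t <= y -> f t <= r) -> \int[mu]_(t in `[x, y]) f t <= r * (y - x).
Proof.
move=> xy itf rf; rewrite -Rintegral_cst_seg //.
by apply: le_Rintegral => //; exact: integrable_cst_seg.
Qed.

(** Integrate [(f - l) ^ 2 >= 0] with [l] the mean value of [f]; comparison with a constant is all
    that is required. *)
Lemma Rintegral_CS f x y : x <= y -> mu.-integrable `[x, y]%classic (EFin \o f) ->
  mu.-integrable `[x, y]%classic (EFin \o (fun t => f t ^+ 2)) ->
  (\int[mu]_(t in `[x, y]) f t) ^+ 2 <= (y - x) * \int[mu]_(t in `[x, y]) f t ^+ 2.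
Proof.
rewrite le_eqVlt => /orP[/eqP <- _ _|xy itf itf2].
  by rewrite set_itv1 !Rintegral_set1 expr0n subrr mul0r.
set I := \int[mu]_(t in `[x, y]) f t; set J := \int[mu]_(t in `[x, y]) _.
have yx : 0 < y - x by rewrite subr_gt0.
pose l := I / (y - x).
have itc : mu.-integrable `[x, y]%classic (EFin \o fun=> l ^+ 2) by exact: integrable_cst_seg.
have itl : mu.-integrable `[x, y]%classic (EFin \o (fun t => 2 * l * f t)).
  rewrite (_ : _ \o _ = fun t => ((2 * l)%:E * (f t)%:E)%E) //.
  exact: integrableZl.
have itp : mu.-integrable `[x, y]%classic (EFin \o (fun t => f t ^+ 2 + l ^+ 2)).
  rewrite (_ : _ \o _ = fun t => ((f t ^+ 2)%:E + (l ^+ 2)%:E)%E) //.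
  exact: integrableD.
have : 2 * l * I <= J + l ^+ 2 * (y - x).
  rewrite -(Rintegral_cst_seg (l ^+ 2) (ltW xy)) -RintegralD // -RintegralZl //.
  apply: le_Rintegral => // t _.
  have := sqr_ge0 (f t - l); lra.
have -> : I = l * (y - x) by rewrite /l divfK // lt0r_neq0.
move=> h; rewrite exprMn expr2 (expr2 (y - x)) mulrA (mulrC (y - x)) ler_pM2r //.
by lra.
Qed.

End SegmentIntegral.

Section H1Interval.
Context {R : realType}.
Local Notation mu := (@lebesgue_measure R).
Variables (D : set R) (u du : R -> R).
Hypotheses (mD : measurable D) (D_ge0 : forall x, D x -> 0 <= x)
  (D_down : forall x, D x -> `[0, x]%classic `<=` D)
  (mu_D : measurable_fun D u) (mdu_D : measurable_fun D du)
  (u2oo : (\int[mu]_(x in D) ((u x) ^+ 2)%:E < +oo)%E)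
  (du2oo : (\int[mu]_(x in D) ((du x) ^+ 2)%:E < +oo)%E)
  (duE : forall x, D x -> (\int[mu]_(t in `[0%R, x]%classic) (du t)%:E)%E = (u x - u 0)%:E).

Lemma integrable_sqr (E : set R) (f : R -> R) : measurable_fun E f ->
  (\int[mu]_(x in E) ((f x) ^+ 2)%:E < +oo)%E ->
  mu.-integrable E (EFin \o (fun x => f x ^+ 2)).
Proof.
move=> mf foo; apply/integrableP; split.
  by apply/measurable_EFinP; exact: measurable_funX.
under eq_integral do rewrite /= ger0_norm ?sqr_ge0 //.
exact: foo.
Qed.

Let it_u2 : mu.-integrable D (EFin \o (fun x => u x ^+ 2)).
Proof. exact: integrable_sqr. Qed.
Let it_du2 : mu.-integrable D (EFin \o (fun x => du x ^+ 2)).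
Proof. exact: integrable_sqr. Qed.

Let it_u2s y : D y -> mu.-integrable `[0, y]%classic (EFin \o (fun x => u x ^+ 2)).
Proof. by move=> Dy; apply: integrableS it_u2 => //; exact: D_down. Qed.
Let it_du2s y : D y -> mu.-integrable `[0, y]%classic (EFin \o (fun x => du x ^+ 2)).
Proof. by move=> Dy; apply: integrableS it_du2 => //; exact: D_down. Qed.

Let it_dus y : D y -> mu.-integrable `[0, y]%classic (EFin \o du).
Proof.
move=> Dy.
have it1 : mu.-integrable `[0, y]%classic (EFin \o (fun x => 1 + du x ^+ 2)).
  rewrite (_ : _ \o _ = fun t => (1%:E + (du t ^+ 2)%:E)%E) //.
  apply: integrableD => //; [exact: integrable_cst_seg|exact: it_du2s].
apply: le_integrable it1 => //.
  by apply/measurable_EFinP; apply: measurable_funS mdu_D => //; exact: D_down.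
move=> x _ /=; rewrite lee_fin [leRHS]ger0_norm ?addr_ge0 ?sqr_ge0 //.
have := sqr_ge0 (1 - `|du x|); rewrite -[du x ^+ 2]real_normK ?num_real //.
have := sqr_ge0 (`|du x|); lra.
Qed.

Definition cum (f : R -> R) (x : R) := \int[mu]_(t in `[0, x]) f t.

Let SS := cum (fun x => u x ^+ 2).
Let QQ := cum (fun x => du x ^+ 2).
Let WW := cum (fun x => u x ^+ 6).

Let uB x y : D x -> D y -> x <= y -> u y - u x = \int[mu]_(t in `[x, y]) du t.
Proof.
move=> Dx Dy xy; rewrite -Rintegral_segB //; [|exact: it_dus|exact: D_ge0].
by rewrite /Rintegral !duE //= opprB addrA subrK.
Qed.

Let H1_CS x y : D x -> D y -> x <= y -> (u y - u x) ^+ 2 <= (y - x) * (QQ y - QQ x).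
Proof.
move=> Dx Dy xy; have x0 := D_ge0 Dx.
rewrite uB // /QQ /cum Rintegral_segB //; last exact: it_du2s.
by apply: Rintegral_CS => //; apply: integrable_seg => //; [exact: it_dus|exact: it_du2s].
Qed.

Let u_bounded y : D y -> exists B, forall t, 0 <= t <= y -> u t ^+ 2 <= B.
Proof.
move=> Dy; exists (2 * u 0 ^+ 2 + 2 * (y * QQ y)) => t /andP[t0 ty].
have Dt : D t by apply: (D_down Dy); rewrite /= in_itv /= t0 ty.
have D0 : D 0 by apply: (D_down Dy); rewrite /= in_itv /= lexx (le_trans t0 ty).
have Q0 : QQ 0 = 0 by rewrite /QQ /cum set_itv1 Rintegral_set1.
have Qty : QQ t <= QQ y.
  rewrite -subr_ge0 /QQ /cum Rintegral_segB //; last exact: it_du2s.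
  by apply: Rintegral_ge0 => *; exact: sqr_ge0.
have Qt0 : 0 <= QQ t by apply: Rintegral_ge0 => *; exact: sqr_ge0.
have := H1_CS D0 Dt t0; rewrite Q0 !subr0 => h.
have h2 : t * QQ t <= y * QQ y by rewrite ler_pM.
have := sqr_ge0 (u t - 2 * u 0); lra.
Qed.

Let mu6 (E : set R) : measurable E -> E `<=` D -> measurable_fun E (fun x => u x ^+ 6).
Proof. by move=> mE ED; apply: measurable_funX; apply: measurable_funS mu_D. Qed.

Let it_u6s y : D y -> mu.-integrable `[0, y]%classic (EFin \o (fun x => u x ^+ 6)).
Proof.
move=> Dy; have [B hB] := u_bounded Dy.
apply: measurable_bounded_integrable => //.
- by rewrite /= lebesgue_measure_seg ?ltry // D_ge0.
- by apply: mu6 => //; exact: D_down.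
exists (B ^+ 3); split; first exact: num_real.
move=> M BM t; rewrite /= in_itv /= => ht; apply: le_trans (ltW BM).
rewrite ger0_norm ?exprn_even_ge0 // (exprM _ 2 3).
by rewrite lerXn2r ?nnegrE ?sqr_ge0 // ?(le_trans _ (hB _ ht)) ?sqr_ge0 // hB.
Qed.

Lemma H1_profile : profile D u SS QQ WW.
Proof.
split=> [x y|l x y Dx Dy xy H|r x y Dx Dy xy H|l x y l0 Dx Dy xy H|r x y r0 Dx Dy xy H].
- exact: H1_CS.
- rewrite /SS /cum Rintegral_segB ?D_ge0 //; last exact: it_u2s.
  by apply: Rintegral_seg_ge => //; apply: integrable_seg; rewrite ?D_ge0 //; exact: it_u2s.
- rewrite /SS /cum Rintegral_segB ?D_ge0 //; last exact: it_u2s.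
  by apply: Rintegral_seg_le => //; apply: integrable_seg; rewrite ?D_ge0 //; exact: it_u2s.
- rewrite /WW /cum Rintegral_segB ?D_ge0 //; last exact: it_u6s.
  apply: Rintegral_seg_ge => //; first by apply: integrable_seg; rewrite ?D_ge0 //; exact: it_u6s.
  by move=> t /H lt; rewrite (exprM _ 2 3) lerXn2r ?nnegrE ?sqr_ge0.
- rewrite /WW /SS /cum !Rintegral_segB ?D_ge0 //; [|exact: it_u2s|exact: it_u6s].
  have it2 : mu.-integrable `[x, y]%classic (EFin \o (fun x => u x ^+ 2)).
    by apply: integrable_seg; rewrite ?D_ge0 //; exact: it_u2s.
  rewrite -RintegralZl //; apply: le_Rintegral => //.
  + by apply: integrable_seg; rewrite ?D_ge0 //; exact: it_u6s.
  + rewrite (_ : _ \o _ = fun t => ((r ^+ 2)%:E * (u t ^+ 2)%:E)%E) //.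
    exact: integrableZl.
  move=> t; rewrite /= in_itv /= => /H ht.
  rewrite (exprD _ 4 2) ler_wpM2r ?sqr_ge0 // (exprM _ 2 2).
  by rewrite lerXn2r ?nnegrE ?sqr_ge0.
Qed.

Lemma H1_cum0 : [/\ SS 0 = 0, QQ 0 = 0 & WW 0 = 0].
Proof. by split; rewrite /SS /QQ /WW /cum set_itv1 Rintegral_set1. Qed.

Lemma H1_cumE y : D y ->
  [/\ \int[mu]_(x in `[0%R, y]%classic) (u x ^+ 2)%:E = (SS y)%:E,
      \int[mu]_(x in `[0%R, y]%classic) (du x ^+ 2)%:E = (QQ y)%:E &
      \int[mu]_(x in `[0%R, y]%classic) (u x ^+ 6)%:E = (WW y)%:E]%E.
Proof.
move=> Dy; split; rewrite /SS /QQ /WW /cum /Rintegral fineK //.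
- exact: integrable_fin_num (it_u2s Dy).
- exact: integrable_fin_num (it_du2s Dy).
- exact: integrable_fin_num (it_u6s Dy).
Qed.

End H1Interval.

(** Monotone convergence along [[0, n + 1]]. Stating [l] as a supremum rather than as a limit is the
    form in which the tails are used afterwards. *)
Lemma cum_halfline {R : realType} (f : R -> R) : (forall x, 0 <= f x) ->
  (@lebesgue_measure R).-integrable `[0, +oo[%classic (EFin \o f) ->
  exists l, [/\ (\int[lebesgue_measure]_(x in `[0%R, +oo[%classic) (f x)%:E = l%:E)%E,
    forall x, 0 <= x -> cum f x <= l &
    forall e, 0 < e -> exists2 x, 0 <= x & l - e <= cum f x].
Proof.
move=> f0 itf.
have fin : (\int[@lebesgue_measure R]_(x in `[0%R, +oo[%classic) (f x)%:E \is a fin_num)%E.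
  exact: integrable_fin_num.
have its x : (@lebesgue_measure R).-integrable `[0, x]%classic (EFin \o f).
  by apply: integrableS itf => //; apply: subset_itvl.
have cumE x : (\int[lebesgue_measure]_(t in `[0%R, x]%classic) (f t)%:E = (cum f x)%:E)%E.
  by rewrite /cum /Rintegral fineK //; exact: integrable_fin_num (its x).
have mf : measurable_fun (`[0, +oo[%classic : set R) (EFin \o f) by case/integrableP: itf.
exists (\int[lebesgue_measure]_(x in `[0, +oo[) f x)%R; split.
- by rewrite /Rintegral fineK.
- move=> x x0; rewrite -lee_fin -cumE /Rintegral fineK //.
  apply: ge0_subset_integral => //; last exact: subset_itvl.
  by move=> t _; rewrite lee_fin.
- move=> e e0.
  have cv : (\int[@lebesgue_measure R]_(x in `[0%R, i.+1%:R]%classic) (f x)%:E)%E @[i --> \oo]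
      --> (\int[@lebesgue_measure R]_(x in `[0%R, +oo[%classic) (f x)%:E)%E.
    rewrite itv0y_bigcup0S; apply: ge0_nondecreasing_set_cvg_integral.
    - move=> i j ij; rewrite subsetEset; apply: subset_itvl.
      by rewrite bnd_simp ler_nat ltnS.
    - by [].
    - by move=> i; apply: measurable_funS mf => //; exact: subset_itvl.
    - by move=> i x _; rewrite lee_fin.
  apply: contrapT => H.
  have : (\int[@lebesgue_measure R]_(x in `[0%R, +oo[%classic) (f x)%:E <=
      (\int[lebesgue_measure]_(x in `[0, +oo[) f x - e)%:E)%E.
    rewrite -(cvg_lim _ cv) //; apply: lime_le.
      by apply/cvg_ex; eexists; exact: cv.
    apply: nearW => n; rewrite cumE lee_fin; rewrite leNgt; apply/negP => h.
    by apply: H; exists n.+1%:R => //; exact: ltW.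
  by rewrite -{1}(fineK fin) lee_fin /Rintegral; lra.
Qed.

(** * Tangent inequalities and concatenation of calibrated pieces *)

Lemma tan_gt0 (R : realType) (y : R) : 0 < y -> y < pi / 2 -> 0 < tan y.
Proof.
move=> y0 y1; rewrite -(@tan0 R) ltr_tan // in_itv /=; have := pi_gt0 R; lra.
Qed.

Lemma tan_ge_id (R : realType) (y : R) : 0 <= y -> y < pi / 2 -> y <= tan y.
Proof.
move=> y0 y1; have [|z _] := tan_mvt _ y0 y1; first by have := pi_gt0 R; lra.
rewrite tan0 !subr0 => ->; have := sqr_ge0 (tan z); nra.
Qed.

Lemma tan_gt_id (R : realType) (y : R) : 0 < y -> y < pi / 2 -> y < tan y.
Proof.
move=> y0 y1; have y2 : y / 2 <= tan (y / 2) by apply: tan_ge_id; lra.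
(* The mean-value point is sought in [[y / 2, y]]: on [[0, y]] it might be 0, where [tan' = 1] gives
   no strict inequality. *)
have [||z /andP[z1 z2] ez] := tan_mvt (x := y / 2) _ _ y1; [have := pi_gt0 R; lra|lra|].
have tz : 0 < tan z by apply: tan_gt0; lra.
have tz2 : 0 < tan z ^+ 2 by rewrite exprn_gt0.
have : 0 < tan z ^+ 2 * (y - y / 2) by rewrite mulr_gt0 //; lra.
lra.
Qed.

(** Left continuity of the tangent through the mean value theorem; between the midpoint [c0] of
    [- (pi / 2)] and [c] its derivative is at most [T]. *)
Lemma tan_left_closed (R : realType) (A B c : R) : 0 <= A ->
  - (pi / 2) < c -> c < pi / 2 ->
  (forall x, - (pi / 2) < x -> x < c -> A * tan x <= B) -> A * tan c <= B.
Proof.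
move=> A0 cl cu H; apply/ler_addgt0Pr => e e0.
pose c0 := (c - pi / 2) / 2.
have c0c : c0 < c by rewrite /c0; lra.
have c0l : - (pi / 2) < c0 by rewrite /c0; lra.
pose T := 1 + tan c0 ^+ 2 + tan c ^+ 2.
have T0 : 0 < T by rewrite /T; have := sqr_ge0 (tan c0); have := sqr_ge0 (tan c); lra.
have AT0 : 0 <= A * T by rewrite mulr_ge0 // ltW.
pose d := Num.min (c - c0) (e / (A * T + 1)).
have d0 : 0 < d by rewrite /d lt_min subr_gt0 c0c divr_gt0 //; lra.
have d1 : d <= c - c0 by rewrite /d ge_min lexx.
have d2 : A * T * d <= e.
  have : d <= e / (A * T + 1) by rewrite /d ge_min lexx orbT.
  by rewrite ler_pdivlMr; lra.
have [||z /andP[z1 z2] ez] := tan_mvt (x := c - d) _ _ cu; [lra|lra|].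
have tz : tan z ^+ 2 <= tan c0 ^+ 2 + tan c ^+ 2.
  have t1 : tan c0 <= tan z by apply: tan_le; lra.
  have t2 : tan z <= tan c by apply: tan_le; lra.
  have := sqr_ge0 (tan c0); have := sqr_ge0 (tan c) => ? ?.
  by case: (leP 0 (tan z)) => ?; nra.
have := H (c - d) ltac:(lra) ltac:(lra) => h.
have : A * (tan c - tan (c - d)) <= A * T * d.
  rewrite ez -mulrA ler_wpM2l // (_ : c - (c - d) = d); last by ring.
  by rewrite ler_wpM2r ?(ltW d0) // /T; lra.
by lra.
Qed.

(* A segment carrying mass [m], kinetic term [q] and sextic term [w], with end
   values [U] and [V], is calibrated if it satisfies the conclusion of
   [calibration]; a ray is a segment whose far end value is 0. *)
Definition calibrated_seg (R : realType) (b U V m q w : R) : Prop := 0 <= m /\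
  forall c, - (pi / 2) < c -> c + 2 * b * m < pi / 2 ->
  b / 2 * (U ^+ 4 * tan c - V ^+ 4 * tan (c + 2 * b * m)) <= q - b ^+ 2 * w.

Definition calibrated_ray (R : realType) (b U m q w : R) : Prop := 0 <= m /\
  forall c, - (pi / 2) < c -> c + 2 * b * m < pi / 2 ->
  b / 2 * (U ^+ 4 * tan c) <= q - b ^+ 2 * w.

Section Calibrated.
Context {R : realType}.
Variable b : R.
Hypothesis b0 : 0 < b.
Implicit Types U V X m q w : R.

(** The second piece starts at the angle where the first one ends, so the two boundary terms at [V]
    cancel. *)
Lemma calibrated_seg_ray U V m1 q1 w1 m2 q2 w2 :
  calibrated_seg b U V m1 q1 w1 -> calibrated_ray b V m2 q2 w2 ->
  calibrated_ray b U (m1 + m2) (q1 + q2) (w1 + w2).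
Proof.
move=> [m10 sg] [m20 ry]; split; first exact: addr_ge0.
move=> c cl cu.
have bm1 : 0 <= 2 * b * m1 by rewrite !mulr_ge0 // ltW.
have bm2 : 0 <= 2 * b * m2 by rewrite !mulr_ge0 // ltW.
have := sg c cl ltac:(lra); have := ry (c + 2 * b * m1) ltac:(lra) ltac:(lra).
lra.
Qed.

Lemma calibrated_seg_seg U V X m1 q1 w1 m2 q2 w2 :
  calibrated_seg b U V m1 q1 w1 -> calibrated_seg b V X m2 q2 w2 ->
  calibrated_seg b U X (m1 + m2) (q1 + q2) (w1 + w2).
Proof.
move=> [m10 sg] [m20 ry]; split; first exact: addr_ge0.
move=> c cl cu.
have bm1 : 0 <= 2 * b * m1 by rewrite !mulr_ge0 // ltW.
have bm2 : 0 <= 2 * b * m2 by rewrite !mulr_ge0 // ltW.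
have := sg c cl ltac:(lra); have := ry (c + 2 * b * m1) ltac:(lra) ltac:(lra).
have -> : c + 2 * b * (m1 + m2) = c + 2 * b * m1 + 2 * b * m2 by ring.
lra.
Qed.

Lemma calibrated_seg_nil U : calibrated_seg b U U 0 0 0.
Proof. by split=> // c _ _; rewrite !mulr0 addr0 !subrr mulr0. Qed.

(** A ray has no far-end term, so the angle there may reach [pi / 2], where the tangent is
    infinite. *)
Lemma calibrated_ray_lim U m q w c : calibrated_ray b U m q w ->
  - (pi / 2) < c -> c < pi / 2 -> c + 2 * b * m <= pi / 2 ->
  b / 2 * (U ^+ 4 * tan c) <= q - b ^+ 2 * w.
Proof.
move=> [m0 ry] cl cu cm; rewrite mulrA.
apply: tan_left_closed => //.
  by rewrite mulr_ge0 ?exprn_even_ge0 // divr_ge0 // ltW.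
by move=> x xl xc; rewrite -mulrA; apply: ry => //; lra.
Qed.

Lemma ray_rest_le U mP qP wP mr q w : calibrated_ray b U mP qP wP ->
  0 < mP -> 0 <= mr -> 2 * b * (mP + mr) = pi / 2 ->
  qP <= q -> w <= wP + U ^+ 4 * mr ->
  b ^+ 2 * w <= q /\ (U != 0 -> q = b ^+ 2 * w -> mr = 0).
Proof.
move=> ry mP0 mr0 tot qq ww.
have p0 := pi_gt0 R.
have bmP : 0 < 2 * b * mP by rewrite !mulr_gt0.
have bmr : 0 <= 2 * b * mr by rewrite !mulr_ge0 // ltW.
have U0 : 0 <= U ^+ 4 by rewrite exprn_even_ge0.
(* The initial angle [2 * b * mr] puts the final angle exactly at [pi / 2]; [0 < mP] keeps it below
   [pi / 2] itself. *)
have h := calibrated_ray_lim (c := 2 * b * mr) ry ltac:(lra) ltac:(lra) ltac:(lra).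
have hw : b ^+ 2 * w <= b ^+ 2 * (wP + U ^+ 4 * mr) by rewrite ler_wpM2l ?sqr_ge0.
have bU : 0 <= b / 2 * U ^+ 4 by rewrite mulr_ge0 // divr_ge0 // ltW.
have ht : b / 2 * U ^+ 4 * (2 * b * mr) <= b / 2 * U ^+ 4 * tan (2 * b * mr).
  by rewrite ler_wpM2l // tan_ge_id //; lra.
split; first by lra.
move=> Un0 qe; apply/eqP; rewrite eq_le mr0 andbT leNgt; apply/negP => mrp.
have bUp : 0 < b / 2 * U ^+ 4 by rewrite mulr_gt0 ?divr_gt0 // exprn_even_gt0.
have : b / 2 * U ^+ 4 * (2 * b * mr) < b / 2 * U ^+ 4 * tan (2 * b * mr).
  by rewrite ltr_pM2l // tan_gt_id //; [rewrite !mulr_gt0|lra].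
by lra.
Qed.

(** With [U = 0] the cut carries no boundary term, so the angles on its two sides may be chosen
    independently. Starting the segment at [b * s] and the ray at [- (b * s)] keeps both admissible
    and leaves the gain [b / 2 * M ^ 4 * tan (b * s) > 0], against equality. *)
Lemma split_neq0 M U m1 q1 w1 s q2 w2 : calibrated_seg b M U m1 q1 w1 ->
  calibrated_ray b U s q2 w2 -> 2 * b * (m1 + s) = pi / 2 ->
  q1 + q2 = b ^+ 2 * (w1 + w2) -> M != 0 -> 0 < s -> U != 0.
Proof.
move=> [m10 sg] [_ ry] tot eqw M0 s0; apply/eqP => U0.
have p0 := pi_gt0 R.
have bs : 0 < b * s by rewrite mulr_gt0.
have bm1 : 0 <= b * m1 by rewrite mulr_ge0 // ltW.
have h1 := sg (b * s) ltac:(lra) ltac:(lra).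
have h2 := ry (- (b * s)) ltac:(lra) ltac:(lra).
have bM : 0 < b / 2 * M ^+ 4 by rewrite mulr_gt0 ?divr_gt0 // exprn_even_gt0.
have ht : 0 < tan (b * s) by apply: tan_gt0; lra.
have : 0 < b / 2 * M ^+ 4 * tan (b * s) by rewrite mulr_gt0.
rewrite U0 expr0n /= !mul0r in h1 h2; lra.
Qed.

(** Put [y = 2 b s]. The segment runs from angle [- y] to [pi / 2 - 2 y] and the ray from
    [pi / 2 - y] to [pi / 2]. The mismatch at the cut gives [U ^ 4 * (cot y - cot (2 y)) <= M ^ 4 *
    tan y]; since [cot y - cot (2 y) = 1 / sin (2 y)], this is [U ^ 4 <= 2 * M ^ 4 * sin y ^ 2], and
    [sin y <= y] concludes. *)
Lemma split_sqr_le M U m1 q1 w1 s q2 w2 : calibrated_seg b M U m1 q1 w1 ->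
  calibrated_ray b U s q2 w2 -> 2 * b * (m1 + s) = pi / 2 ->
  q1 + q2 = b ^+ 2 * (w1 + w2) -> `|U| <= `|M| -> 0 < s ->
  U ^+ 2 <= 4 * b * M ^+ 2 * s.
Proof.
move=> [m10 sg] ry tot eqw UM s0; have p2 := pi_ge2 R.
have M20 := sqr_ge0 M.
have U2M2 : U ^+ 2 <= M ^+ 2.
  by rewrite -[leLHS]real_normK ?num_real // -[leRHS]real_normK ?num_real // ler_sqr ?nnegrE.
(* Without mass before the cut, [y = pi / 2] and the angle [- y] is not admissible; there
   [|U| <= |M|] is enough because [pi >= 1]. *)
have := m10; rewrite le_eqVlt => /orP[/eqP m1E|m1p].
  have -> : 4 * b * M ^+ 2 * s = pi * M ^+ 2.
    have : 2 * b * s = pi / 2 by rewrite -tot -m1E add0r.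
    by move=> h; rewrite -[pi](@divfK _ 2) // -h; ring.
  have : 1 * M ^+ 2 <= pi * M ^+ 2 by apply: ler_wpM2r => //; lra.
  by lra.
set y := 2 * b * s.
have y0 : 0 < y by rewrite !mulr_gt0.
have y1 : y < pi / 2 by rewrite -tot mulrDr -/y ltrDr !mulr_gt0.
have h1 := sg (- y) ltac:(lra).
have e1 : - y + 2 * b * m1 = pi / 2 - 2 * y.
  by rewrite -tot /y; ring.
rewrite e1 in h1; have {h1} h1 := h1 ltac:(lra).
have h2 := calibrated_ray_lim (c := pi / 2 - y) ry ltac:(lra) ltac:(lra) ltac:(rewrite -/y; lra).
have sy : 0 < sin y by apply: sin_gt0_pi; lra.
have sy2 : 0 < sin (2 * y) by apply: sin_gt0_pi; lra.
have cy : 0 < cos y by apply: cos_gt0_pihalf; lra.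
have t1 : tan (pi / 2 - y) = cos y / sin y.
  rewrite /tan sinB cosB sin_pihalf cos_pihalf; congr (_ / _); ring.
have t2 : tan (pi / 2 - 2 * y) = cos (2 * y) / sin (2 * y).
  rewrite /tan sinB cosB sin_pihalf cos_pihalf; congr (_ / _); ring.
have h : b / 2 * (U ^+ 4 * (tan (pi / 2 - y) - tan (pi / 2 - 2 * y)) - M ^+ 4 * tan y) <= 0.
  by move: h1; rewrite tanN; lra.
rewrite pmulr_rle0 ?divr_gt0 // subr_le0 t1 t2 /tan in h.
have s2 : sin (2 * y) = 2 * (sin y * cos y) by rewrite mulr_natl sin_mulr2n; ring.
have c2 : cos (2 * y) = 1 - 2 * sin y ^+ 2.
  by rewrite mulr_natl cos_mulr2n; have := cos2Dsin2 y; lra.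
have cs : cos y ^+ 2 = 1 - sin y ^+ 2 by have := cos2Dsin2 y; lra.
have dE : cos y / sin y - cos (2 * y) / sin (2 * y) = (2 * (sin y * cos y))^-1.
  rewrite s2 c2; apply: (mulIf (x := 2 * (sin y * cos y))).
    by rewrite !mulf_neq0 // lt0r_neq0.
  rewrite mulVf; last by rewrite !mulf_neq0 // lt0r_neq0.
  rewrite mulrBl divfK; last by rewrite !mulf_neq0 // lt0r_neq0.
  have -> : cos y / sin y * (2 * (sin y * cos y)) = 2 * cos y ^+ 2.
    by field; rewrite lt0r_neq0.
  by rewrite cs; ring.
rewrite dE ler_pdivrMr ?mulr_gt0 // in h.
have h' : U ^+ 4 <= 2 * M ^+ 4 * sin y ^+ 2.
  suff <- : M ^+ 4 * (sin y / cos y) * (2 * (sin y * cos y)) = 2 * M ^+ 4 * sin y ^+ 2 by [].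
  by field; rewrite lt0r_neq0.
have sle : sin y <= y.
  have [|z _ ez] := @MVT_segment R sin cos 0 y (ltW y0) (fun x _ => is_derive_sin x).
    by apply: continuous_subspaceT => z; exact: continuous_sin.
  by rewrite -[sin y]subr0 -(@sin0 R) ez subr0; have := cos_le1 z; nra.
have s2y : sin y ^+ 2 <= y ^+ 2 by rewrite ler_sqr ?nnegrE ?(ltW sy) ?(ltW y0).
have M40 : 0 <= M ^+ 4 by rewrite exprn_even_ge0.
have e2 : 4 * b * M ^+ 2 * s = 2 * M ^+ 2 * y by rewrite /y; ring.
rewrite e2 -(@ler_pXn2r _ 2) ?nnegrE ?sqr_ge0 //; last by rewrite mulr_ge0 ?(ltW y0) // mulr_ge0.
have -> : (U ^+ 2) ^+ 2 = U ^+ 4 by rewrite -exprM.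
have -> : (2 * M ^+ 2 * y) ^+ 2 = 4 * M ^+ 4 * y ^+ 2 by ring.
have : M ^+ 4 * sin y ^+ 2 <= M ^+ 4 * y ^+ 2 by rewrite ler_wpM2l.
have : 0 <= M ^+ 4 * y ^+ 2 by rewrite mulr_ge0 // sqr_ge0.
by lra.
Qed.

End Calibrated.

Lemma profile_seg (R : realType) (D : set R) (u S Q W : R -> R) (b p q : R) :
  profile D u S Q W -> `[p, q]%classic `<=` D -> 0 <= b -> p <= q ->
  calibrated_seg b (u p) (u q) (S q - S p) (Q q - Q p) (W q - W p).
Proof.
move=> prf Dpq b0 pq; split.
  rewrite subr_ge0; apply: (profile_S_le prf) => //; apply: Dpq;
  by rewrite /= in_itv /= ?lexx ?pq.
by move=> c cl cu; exact: calibration Dpq prf pq b0 cl cu.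
Qed.

(** Reflection reverses the primitives, and the minus signs make them nondecreasing again; a profile
    only sees their increments. *)
Lemma profile_rev (R : realType) (l : R) (u S Q W : R -> R) :
  profile `[0, l]%classic u S Q W ->
  profile `[0, l]%classic (fun x => u (l - x)) (fun x => - S (l - x))
    (fun x => - Q (l - x)) (fun x => - W (l - x)).
Proof.
move=> [h1 h2 h3 h4 h5].
have D x : `[0, l]%classic x -> `[0, l]%classic (l - x).
  by rewrite /= !in_itv /= => ?; lra.
have B (F : R -> R) x y : - F (l - y) - - F (l - x) = F (l - x) - F (l - y) by ring.
have Y (x y : R) : y - x = l - x - (l - y) by ring.
split=> [x y /D Dx /D Dy xy|k x y /D Dx /D Dy xy H|k x y /D Dx /D Dy xy H
  |k x y k0 /D Dx /D Dy xy H|k x y k0 /D Dx /D Dy xy H];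
  have lyx : l - y <= l - x by lra.
- rewrite B (Y x y) (_ : (_ - _) ^+ 2 = (u (l - x) - u (l - y)) ^+ 2); last by ring.
  exact: h1.
- rewrite B (Y x y); apply: h2 => // t ht.
  by rewrite (_ : t = l - (l - t)); [apply: H; lra|ring].
- rewrite B (Y x y); apply: h3 => // t ht.
  by rewrite (_ : t = l - (l - t)); [apply: H; lra|ring].
- rewrite B (Y x y); apply: h4 => // t ht.
  by rewrite (_ : t = l - (l - t)); [apply: H; lra|ring].
- rewrite !B; apply: h5 => // t ht.
  by rewrite (_ : t = l - (l - t)); [apply: H; lra|ring].
Qed.

(* Gronwall: the remaining mass [S q - S] cannot vanish in finite length when
   its rate of decrease [u ^ 2] is at most a multiple of itself. *)
Lemma profile_no_extinction (R : realType) (u S Q W : R -> R) (p q C : R) :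
  profile `[p, q]%classic u S Q W -> p <= q -> 0 <= C -> u q = 0 ->
  (forall x, p <= x <= q -> S x < S q -> u x ^+ 2 <= C * (S q - S x)) ->
  S p = S q.
Proof.
move=> prf pq C0 uq H.
have inD x : p <= x -> x <= q -> `[p, q]%classic x.
  by move=> px xq; rewrite /= in_itv /= px xq.
(* Going back from [q] in steps of length [r], the remaining mass [d] at the start of a step
   satisfies [d <= C * d * r <= d / 2], hence vanishes. *)
pose r := (2 * (C + 1))^-1.
have r0 : 0 < r by rewrite invr_gt0; lra.
have Cr : C * r <= 2^-1.
  by rewrite ler_pdivrMr; lra.
have key n x : p <= x -> x <= q -> q - x <= n%:R * r -> S x = S q.
  elim: n x => [|n IH] x px xq.
    by rewrite mul0r subr_le0 => qx; congr S; lra.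
  rewrite -natr1 mulrDl mul1r => hx.
  pose y := Num.min q (x + r).
  have yq : y <= q by rewrite ge_min lexx.
  have yr : y <= x + r by rewrite ge_min lexx orbT.
  have xy : x <= y by rewrite le_min xq lerDl ltW.
  have Sy : S y = S q.
    apply: IH => //; first by lra.
    have nr0 : 0 <= n%:R * r by rewrite mulr_ge0 // ltW.
    by rewrite lerBlDr -lerBlDl le_min; apply/andP; split; lra.
  have Sx : S x <= S q by apply: (profile_S_le prf); [apply: inD; lra|apply: inD; lra|lra].
  have := profile_Sle (r := C * (S q - S x)) prf (inD _ px xq) (inD y ltac:(lra) yq) xy.
  move=> /(_ _) h.
  have {}h : S y - S x <= C * (S q - S x) * (y - x).
    apply: h => t /andP[xt ty].
    have It : p <= t <= q by lra.
    have StS : S t <= S q by apply: (profile_S_le prf); [apply: inD; lra|apply: inD; lra|lra].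
    case: (ltP (S t) (S q)) => [St|St].
      apply: le_trans (H _ It St) _; rewrite ler_wpM2l // lerD2l lerN2.
      by apply: (profile_S_le prf); [apply: inD; lra|apply: inD; lra|lra].
    (* The bound on [u ^ 2] is assumed only while mass remains; once none does, a nonzero value at
       [t < q] would create some. *)
    suff -> : u t = 0 by rewrite expr0n mulr_ge0 // subr_ge0.
    case: (ltP t q) => [tq|qt]; last by rewrite (_ : t = q) //; lra.
    apply/eqP; apply: contraT => ut.
    have sub : `[t, q]%classic `<=` `[p, q]%classic.
      by apply: subset_itvr; rewrite bnd_simp; lra.
    by have := profile_S_lt prf sub tq (x := t) ltac:(lra) ut; rewrite ltNge St.
  have h2 : C * (S q - S x) * (y - x) <= C * (S q - S x) * r.
    by apply: ler_wpM2l; [rewrite mulr_ge0 // subr_ge0|lra].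
  have h3 : C * r * (S q - S x) <= 2^-1 * (S q - S x).
    by rewrite ler_wpM2r // subr_ge0.
  by apply/eqP; rewrite eq_le Sx /=; rewrite Sy in h; lra.
apply: (key (Num.trunc ((q - p) / r)).+1) => //.
by rewrite -ler_pdivrMr // ltW // truncnS_gt.
Qed.

(* [m], [q] and [w] are the total integrals over each edge. *)
Record h1_data (R : realType) (G : graph R) (u S Q W : 'I_(nE G) -> R -> R)
    (m q w : 'I_(nE G) -> R) (phi : 'I_(nV G) -> R) : Prop := H1Data {
  h1_profile : forall e, profile (edge_dom G e) (u e) (S e) (Q e) (W e) ;
  h1_0 : forall e, [/\ S e 0 = 0, Q e 0 = 0 & W e 0 = 0] ;
  h1_bnd : forall e, bnd G e ->
    [/\ S e (len G e) = m e, Q e (len G e) = q e & W e (len G e) = w e] ;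
  h1_half : forall e, ~~ bnd G e ->
    [/\ forall x, 0 <= x -> S e x <= m e, forall x, 0 <= x -> Q e x <= q e,
        forall x, 0 <= x -> W e x <= w e,
        forall d, 0 < d -> exists2 x, 0 <= x & m e - d <= S e x &
        forall d, 0 < d -> exists2 x, 0 <= x & w e - d <= W e x] ;
  h1_src : forall e, u e 0 = phi (src G e) ;
  h1_tgt : forall e, bnd G e -> u e (len G e) = phi (tgt G e) }.

Section H1Data.
Context {R : realType} {G : graph R}.
Local Notation mu := (@lebesgue_measure R).
Implicit Types (e : 'I_(nE G)) (u du : 'I_(nE G) -> R -> R).

Lemma edge_dom_bnd e : bnd G e -> edge_dom G e = `[0, len G e]%classic.
Proof. by rewrite /edge_dom => ->. Qed.

Lemma edge_dom_half e : ~~ bnd G e -> edge_dom G e = `[0, +oo[%classic.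
Proof. by rewrite /edge_dom => /negbTE ->. Qed.

Lemma measurable_edge_dom e : measurable (edge_dom G e : set R).
Proof. by rewrite /edge_dom; case: ifP. Qed.

Lemma edge_dom_ge0 e x : edge_dom G e x -> 0 <= x.
Proof. by rewrite /edge_dom; case: ifP => _; rewrite /= in_itv /= => /andP[]. Qed.

Lemma edge_dom_down e x : edge_dom G e x -> `[0, x]%classic `<=` edge_dom G e.
Proof.
rewrite /edge_dom; case: ifP => _; rewrite /= in_itv /= => /andP[_ xl];
  by apply: subset_itvl; rewrite bnd_simp.
Qed.

Lemma edge_dom0 e : wf_graph G -> edge_dom G e 0.
Proof.
move=> wf; rewrite /edge_dom; case: ifPn => h; rewrite /= in_itv /= lexx //=.
by apply: ltW; exact: wf.
Qed.

Lemma is_H1_data u du : wf_graph G -> is_H1 G u du ->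
  exists S Q W m q w phi, [/\ h1_data u S Q W m q w phi,
    mass G u = (\sum_e m e)%:E, Lp_pow G 2 du = (\sum_e q e)%:E &
    Lp_pow G 6 u = (\sum_e w e)%:E].
Proof.
move=> wf [mu_ [mdu [u2 [du2 [duE [phi hphi]]]]]].
pose S e := cum (fun x => u e x ^+ 2).
pose Q e := cum (fun x => du e x ^+ 2).
pose W e := cum (fun x => u e x ^+ 6).
have prf e : profile (edge_dom G e) (u e) (S e) (Q e) (W e).
  exact: (H1_profile (measurable_edge_dom e) (@edge_dom_ge0 e) (@edge_dom_down e)
    (mu_ e) (mdu e) (u2 e) (du2 e) (duE e)).
have c0 e : [/\ S e 0 = 0, Q e 0 = 0 & W e 0 = 0] by exact: H1_cum0.
pose ok e (mqw : R * R * R) := let: (m, q, w) := mqw in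
  [/\ (\int[mu]_(x in edge_dom G e) (u e x ^+ 2)%:E = m%:E)%E,
      (\int[mu]_(x in edge_dom G e) (du e x ^+ 2)%:E = q%:E)%E,
      (\int[mu]_(x in edge_dom G e) (u e x ^+ 6)%:E = w%:E)%E,
      (bnd G e -> [/\ S e (len G e) = m, Q e (len G e) = q & W e (len G e) = w]) &
      (~~ bnd G e -> [/\ forall x, 0 <= x -> S e x <= m, forall x, 0 <= x -> Q e x <= q,
        forall x, 0 <= x -> W e x <= w,
        forall d, 0 < d -> exists2 x, 0 <= x & m - d <= S e x &
        forall d, 0 < d -> exists2 x, 0 <= x & w - d <= W e x])].
have main e : exists mqw, ok e mqw.
  case: (boolP (bnd G e)) => be.
    have Dl : edge_dom G e (len G e).
      by rewrite edge_dom_bnd //= in_itv /= lexx andbT ltW // wf.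
    have [Hm Hq Hw] := H1_cumE (measurable_edge_dom e) (@edge_dom_ge0 e) (@edge_dom_down e)
      (mu_ e) (mdu e) (u2 e) (du2 e) (duE e) Dl.
    exists (S e (len G e), Q e (len G e), W e (len G e)).
    by split=> //; rewrite ?be // edge_dom_bnd.
  have DE := edge_dom_half be.
  have i2 := integrable_sqr (mu_ e) (u2 e).
  have id2 := integrable_sqr (mdu e) (du2 e).
  have prfe := prf e.
  have := mu_ e; rewrite DE => mue.
  rewrite DE in i2 id2 prfe.
  have [m [Em Sm Sm']] := cum_halfline (fun x => sqr_ge0 (u e x)) i2.
  have [q [Eq Qq _]] := cum_halfline (fun x => sqr_ge0 (du e x)) id2.
  have [S0 Q0 W0] := c0 e.
  (* H1 asks nothing of the integral of [u ^ 6]; on a halfline this bound of [u ^ 4] makes it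
     finite, since [u ^ 6 <= 16 * (q + 1) * m * u ^ 2]. *)
  have bd x : 0 <= x -> u e x ^+ 4 <= 16 * (q + 1) * m.
    move=> x0; apply: (profile_tail_bound prfe) => //.
    - by move=> y y0; rewrite Q0 subr0; exact: Qq.
    - move=> y xy; have := Sm y (le_trans x0 xy).
      have : 0 <= S e x.
        by rewrite -S0; apply: (profile_S_le prfe) => //; rewrite /= in_itv /= ?lexx ?x0.
      by rewrite /S; lra.
  have i6 : mu.-integrable `[0, +oo[%classic (EFin \o (fun x => u e x ^+ 6)).
    have i6' : mu.-integrable `[0, +oo[%classic
        (EFin \o (fun x => 16 * (q + 1) * m * u e x ^+ 2)).
      rewrite (_ : _ \o _ = fun t => ((16 * (q + 1) * m)%:E * (u e t ^+ 2)%:E)%E) //.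
      exact: integrableZl.
    apply: le_integrable i6' => //.
      by apply/measurable_EFinP; exact: measurable_funX.
    move=> x /=; rewrite in_itv /= andbT => x0; rewrite lee_fin.
    have := bd x x0 => bdx.
    have h0 : 0 <= 16 * (q + 1) * m by apply: le_trans bdx; rewrite exprn_even_ge0.
    rewrite ger0_norm ?exprn_even_ge0 // ger0_norm; last by rewrite mulr_ge0 ?sqr_ge0.
    by rewrite (exprD _ 4 2) ler_wpM2r ?sqr_ge0.
  have u60 x : 0 <= u e x ^+ 6 by rewrite exprn_even_ge0.
  have [w [Ew Ww Ww']] := cum_halfline u60 i6.
  exists (m, q, w); split=> //; first by rewrite DE Em.
  - by rewrite DE Eq.
  - by rewrite DE Ew.
  - by rewrite (negbTE be).
have [F hF] := choice main.
have conv (p : nat) (f : _ -> R -> R) (g : R -> R) e : (forall x, `|f e x| ^+ p = g x) ->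
    (\int[mu]_(x in edge_dom G e) (`|f e x| ^+ p)%:E =
     \int[mu]_(x in edge_dom G e) (g x)%:E)%E.
  by move=> fg; under eq_integral do rewrite fg.
have sqn (x : R) : `|x| ^+ 2 = x ^+ 2 by rewrite real_normK ?num_real.
have sxn (x : R) : `|x| ^+ 6 = x ^+ 6 by rewrite !(exprM _ 2 3) sqn.
exists S, Q, W, (fun e => (F e).1.1), (fun e => (F e).1.2), (fun e => (F e).2), phi.
split.
- split => // e.
  + by have := hF e; rewrite /ok; case: (F e) => [[? ?] ?] [].
  + by have := hF e; rewrite /ok; case: (F e) => [[? ?] ?] [].
  + by have [] := hphi e.
  + by have [] := hphi e.
- rewrite /mass /Lp_pow -sumEFin; apply: eq_bigr => e _.
  rewrite (conv 2%N u (fun x => u e x ^+ 2)) //.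
  by have := hF e; rewrite /ok; case: (F e) => [[? ?] ?] [].
- rewrite /Lp_pow -sumEFin; apply: eq_bigr => e _.
  rewrite (conv 2%N du (fun x => du e x ^+ 2)) //.
  by have := hF e; rewrite /ok; case: (F e) => [[? ?] ?] [].
- rewrite /Lp_pow -sumEFin; apply: eq_bigr => e _.
  rewrite (conv 6%N u (fun x => u e x ^+ 6)) //.
  by have := hF e; rewrite /ok; case: (F e) => [[? ?] ?] [].
Qed.

End H1Data.

(** * Paths to infinity *)

Section SimplePaths.
Context {R : realType}.
Variable G : graph R.
Implicit Types (e : 'I_(nE G)) (v w : 'I_(nV G)) (L : seq 'I_(nE G)).

Definition touches e v := (src G e == v) || (bnd G e && (tgt G e == v)).

Definition joins e v w :=
  bnd G e && ((src G e == v) && (tgt G e == w) || (src G e == w) && (tgt G e == v)).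

(* [spath v L]: the edges [L], in this order, form a path without repeated
   vertices from [v] to infinity. *)
Inductive spath : 'I_(nV G) -> seq 'I_(nE G) -> Prop :=
| spath_half e : ~~ bnd G e -> spath (src G e) [:: e]
| spath_step e v w L : joins e v w -> spath w L -> ~~ has (touches^~ v) L ->
    spath v (e :: L).

Definition edge_deg e v : nat := (src G e == v) + (bnd G e && (tgt G e == v)).

Lemma joins_sym e v w : joins e v w = joins e w v.
Proof. by rewrite /joins orbC. Qed.

Lemma joins_touches e v w : joins e v w -> touches e v.
Proof.
by rewrite /joins /touches => /andP[-> /orP[/andP[-> _]|/andP[_ ->]]]; rewrite ?orbT.
Qed.

Lemma spath_touches v L : spath v L -> has (touches^~ v) L.
Proof.
case=> [e _|e {}v w {}L ej _ _] /=; first by rewrite /touches eqxx.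
by rewrite (joins_touches ej).
Qed.

Lemma spath_from_touched v w L : spath v L -> has (touches^~ w) L ->
  exists L', spath w L'.
Proof.
elim=> [e be|e {}v v' {}L ej pL IH nv] /=.
  rewrite orbF /touches (negbTE be) orbF => /eqP <-.
  by exists [:: e]; exact: spath_half.
case/orP => [ew|/IH //].
have [<-|vw] := eqVneq v w; first by exists (e :: L); exact: spath_step ej pL nv.
suff -> : w = v' by exists L.
move: ew ej; rewrite /touches /joins => /orP[/eqP ->|/andP[_ /eqP ->]] /andP[_].
  by rewrite (negbTE (_ : w != v)) 1?eq_sym //= => /andP[/eqP].
by rewrite (eq_sym w v) (negbTE vw) andbF orbF => /andP[_ /eqP].
Qed.

(** When the path from [w] already visits [v], prolonging it by [e] would repeat [v]; its part from
    [v] onwards is taken instead. *)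
Lemma spath_joins e v w L : joins e v w -> spath w L -> exists L', spath v L'.
Proof.
move=> ej pL; case: (boolP (has (touches^~ v) L)) => h.
  exact: spath_from_touched pL h.
by exists (e :: L); exact: spath_step ej pL h.
Qed.

Lemma spath_exists v : connected_graph G -> noncompact G -> exists L, spath v L.
Proof.
move=> [_ conn] [e be].
have /connectP[p pp ep] := conn v (src G e).
elim: p v pp ep => [|w p IH] v /=.
  by move=> _ <-; exists [:: e]; exact: spath_half.
move=> /andP[/existsP[e' ej] pp] ep.
by have [L pL] := IH w pp ep; exact: spath_joins ej pL.
Qed.

Lemma spath_uniq v L : spath v L -> uniq L.
Proof.
elim=> // e {}v w {}L ej _ uL nv /=; rewrite uL andbT.
apply: contra nv => eL; apply/hasP; exists e => //; exact: joins_touches ej.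
Qed.

Lemma spath_avoid_start e v L : bnd G e -> spath v L -> src G e = v -> e \in L ->
  exists2 L', e \notin L' & spath (src G e) L' \/ spath (tgt G e) L'.
Proof.
move=> be; case=> [e' be' _|e' {}v w L' ej pL nv ev].
  by rewrite inE => /eqP ee; rewrite ee (negbTE be') in be.
rewrite inE => /orP[/eqP ee|eL']; last first.
  by case/negP: nv; apply/hasP; exists e => //; rewrite /touches ev eqxx.
exists L'.
  by apply: contra nv => eL; apply/hasP; exists e => //; rewrite /touches ev eqxx.
move: ej; rewrite -ee /joins => /andP[_ /orP[]/andP[/eqP h1 /eqP h2]].
  by right; rewrite h2.
by left; rewrite h1.
Qed.

(** If a path from the source of [e] uses [e], then [e] is its first edge, since that vertex is not
    visited again, and the rest of the path starts at the other end. This gives a way from an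
    interior point of [e] to infinity that leaves [e] once and for all. *)
Lemma spath_avoid e : connected_graph G -> noncompact G -> bnd G e ->
  exists2 L, e \notin L & spath (src G e) L \/ spath (tgt G e) L.
Proof.
move=> cG nG be; have [L pL] := spath_exists (src G e) cG nG.
case: (boolP (e \in L)) => [eL|eL]; last by exists L => //; left.
exact: spath_avoid_start pL _ eL.
Qed.

(** Compared with the degree in the graph, this count decides whether an edge outside the path can
    attach to it. *)
Lemma spath_deg v L w : spath v L ->
  (\sum_(e <- L) edge_deg e w)%N =
    if w == v then 1%N else if has (touches^~ w) L then 2%N else 0%N.
Proof.
elim=> [e be|e {}v v' {}L ej pL IH nv] /=.
  rewrite big_seq1 /edge_deg /touches (negbTE be) /= addn0 orbF eq_sym.
  by case: eqP.
rewrite big_cons IH.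
have vv' : v != v'.
  by apply: contra nv => /eqP ->; exact: spath_touches pL.
have e1 : edge_deg e w = ((w == v) + (w == v'))%N.
  move: ej; rewrite /edge_deg => /andP[-> /orP[]/andP[/eqP -> /eqP ->]].
    by rewrite /= eq_sym (eq_sym v').
  by rewrite /= addnC eq_sym (eq_sym v').
have e2 : touches e w = (w == v) || (w == v').
  move: ej; rewrite /touches => /andP[-> /orP[]/andP[/eqP -> /eqP ->]].
    by rewrite /= eq_sym (eq_sym v').
  by rewrite /= orbC eq_sym (eq_sym v').
rewrite e1 e2; have [wv|wv] := eqVneq w v.
  by rewrite wv (negbTE vv') (negbTE nv).
by have [wv'|wv'] := eqVneq w v'.
Qed.

Lemma spath_count_half v L : spath v L -> (\sum_(e <- L) (~~ bnd G e : nat))%N = 1%N.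
Proof.
elim=> [e be|e {}v v' {}L /andP[be _] pL IH nv]; first by rewrite big_seq1 be.
by rewrite big_cons be IH.
Qed.


Lemma degreeE v : degree G v = (\sum_e edge_deg e v)%N.
Proof.
rewrite /degree big_split /=; congr (_ + _)%N; rewrite -sum1_card big_mkcond /=;
  apply: eq_bigr => e _; rewrite [_ \in _]asboolb.
  by case: (src G e == v).
by case: (bnd G e && _).
Qed.

Lemma card_halflines : #|[set e | ~~ bnd G e]| = (\sum_e (~~ bnd G e : nat))%N.
Proof.
rewrite -sum1_card big_mkcond /=; apply: eq_bigr => e _.
by rewrite [_ \in _]asboolb; case: (bnd G e).
Qed.

Lemma sum_spath_all v L (F : 'I_(nE G) -> nat) : spath v L -> (forall e, e \in L) ->
  (\sum_e F e = \sum_(e <- L) F e)%N.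
Proof.
move=> pL allL; rewrite -big_enum /=; apply: perm_big.
apply: uniq_perm; [exact: enum_uniq|exact: spath_uniq pL|].
by move=> e; rewrite mem_enum allL.
Qed.

Lemma spath_cover_halfline v L : spath v L -> (forall e, e \in L) -> is_halfline G.
Proof.
move=> pL allL; split.
  by rewrite card_halflines (sum_spath_all _ pL allL) (spath_count_half pL).
move=> w; rewrite degreeE (sum_spath_all _ pL allL) (spath_deg w pL).
by case: ifP => //; case: ifP.
Qed.

Lemma edge_deg_gt0 e v : touches e v -> (0 < edge_deg e v)%N.
Proof. by rewrite /touches /edge_deg; case: (src G e == v) => //= ->. Qed.

Lemma sum_spath_le v L e w : spath v L -> e \notin L ->
  (\sum_(e' <- L) edge_deg e' w + edge_deg e w <= degree G w)%N.
Proof.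
move=> pL eL; rewrite degreeE (bigD1 e) //= addnC leq_add2l.
rewrite (big_uniq _ (spath_uniq pL)) /= big_mkcond [leqRHS]big_mkcond /=.
apply: leq_sum => e' _; case: ifP => // e'L.
by case: eqP => // ee; rewrite -ee e'L in eL.
Qed.

(** The path exhausts the degree of each vertex it visits, one at the terminal point and two
    elsewhere. No further edge can touch it, and connectedness does the rest. *)
Lemma halfline_spath_cover v L : connected_graph G -> is_halfline G ->
  degree G v = 1%N -> spath v L -> forall e, e \in L.
Proof.
move=> [_ conn] [_ deg2] dv pL.
have closedL w e : has (touches^~ w) L -> touches e w -> e \in L.
  move=> wL ew; apply: contraT => eL.
  have := sum_spath_le w pL eL; rewrite (spath_deg w pL) wL.
  have := edge_deg_gt0 ew; case: eqP => [->|_] d0.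
    by rewrite dv; case: (edge_deg e v) d0.
  by move=> /leq_trans /(_ (deg2 w)); case: (edge_deg e w) d0.
have all_touched w : has (touches^~ w) L.
  have /connectP[p pp ->] := conn v w.
  have : has (touches^~ v) L by exact: spath_touches pL.
  elim: p v pp {dv pL conn} => [|x p IH] v //= /andP[/existsP[e ej] pp] vL.
  apply: IH => //; apply/hasP; exists e.
    apply: closedL vL _; exact: (joins_touches ej).
  by apply: (joins_touches (w := v)); rewrite joins_sym.
by move=> e; apply: (closedL (src G e)) => //; rewrite /touches eqxx.
Qed.

End SimplePaths.

(** * The inequality on the graph and its equality case *)

Lemma sum_split (R : realType) (n : nat) (K : seq 'I_n) (f : 'I_n -> R) : uniq K ->
  \sum_e f e = \sum_(e <- K) f e + \sum_(e | e \notin K) f e.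
Proof. by move=> uK; rewrite (bigID (mem K)) /= (big_uniq _ uK). Qed.

Section LowerBound.
Context {R : realType} {G : graph R}.
Variables (u S Q W : 'I_(nE G) -> R -> R) (m q w : 'I_(nE G) -> R) (phi : 'I_(nV G) -> R).
Hypotheses (wf : wf_graph G) (H : h1_data u S Q W m q w phi).
Implicit Types (e : 'I_(nE G)) (v : 'I_(nV G)) (L : seq 'I_(nE G)) (b c x M : R).

Let prf e := h1_profile H e.

Lemma h1_profile_half e x : ~~ bnd G e -> 0 <= x ->
  profile `[x, +oo[%classic (u e) (S e) (Q e) (W e).
Proof.
move=> be x0; apply: profile_sub (prf e); rewrite edge_dom_half //.
by apply: subset_itvr; rewrite bnd_simp.
Qed.

Lemma h1_profile_bnd e : bnd G e ->
  profile `[0, len G e]%classic (u e) (S e) (Q e) (W e).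
Proof. by move=> be; have := prf e; rewrite edge_dom_bnd. Qed.

Lemma edge_dom_seg e x y : 0 <= x -> edge_dom G e y -> `[x, y]%classic `<=` edge_dom G e.
Proof.
move=> x0 Dy; apply: subset_trans (edge_dom_down Dy).
by apply: subset_itvr; rewrite bnd_simp.
Qed.

(** Hides the orientation of [e]: its profile is read from [v] to [v'], reflected when the source of
    [e] is [v']. *)
Lemma h1_traverse e v v' : joins e v v' ->
  exists u' S' Q' W' : R -> R, [/\ profile `[0, len G e]%classic u' S' Q' W',
    u' 0 = phi v /\ u' (len G e) = phi v',
    [/\ S' (len G e) - S' 0 = m e, Q' (len G e) - Q' 0 = q e & W' (len G e) - W' 0 = w e] &
    forall x, 0 <= x <= len G e -> exists2 y, 0 <= y <= len G e & u' x = u e y].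
Proof.
move=> /andP[be ej]; have [S0 Q0 W0] := h1_0 H e.
have [Sl Ql Wl] := h1_bnd H be.
case/orP: ej => /andP[/eqP es /eqP et].
  exists (u e), (S e), (Q e), (W e); split.
  - exact: h1_profile_bnd.
  - by rewrite (h1_src H) (h1_tgt H) // es et.
  - by rewrite S0 Q0 W0 Sl Ql Wl !subr0.
  - by move=> x hx; exists x.
eexists _, _, _, _; split; first exact: profile_rev (h1_profile_bnd be).
- by rewrite /= subr0 subrr (h1_src H) (h1_tgt H) // es et.
- by rewrite /= subr0 subrr S0 Q0 W0 Sl Ql Wl !opprK !oppr0 !add0r.
- by move=> x hx; exists (len G e - x) => //; lra.
Qed.

Lemma len_gt0 e v v' : joins e v v' -> 0 < len G e.
Proof. by case/andP => be _; exact: wf. Qed.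

Lemma seg_edge b e v v' : 0 < b -> joins e v v' ->
  calibrated_seg b (phi v) (phi v') (m e) (q e) (w e).
Proof.
move=> b0 ej; have [u' [S' [Q' [W' [p' [<- <-] [<- <- <-] _]]]]] := h1_traverse ej.
by apply: (profile_seg p') => //; apply: ltW => //; exact: len_gt0 ej.
Qed.

Lemma ray_half b e x : 0 < b -> ~~ bnd G e -> 0 <= x ->
  calibrated_ray b (u e x) (m e - S e x) (q e - Q e x) (w e - W e x).
Proof.
move=> b0 be x0; have [h1 h2 h3 h4 h5] := h1_half H be.
split; first by rewrite subr_ge0 h1.
move=> c cl cu; apply: (calibration_halfline (h1_profile_half be x0)) cl cu _ => //.
- by move=> y xy; rewrite lerD2r h1 // (le_trans x0 xy).
- by move=> y xy; rewrite lerD2r h2 // (le_trans x0 xy).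
- exact: ltW.
- move=> d d0; have [y y0 hy] := h5 d d0.
  have pf := h1_profile_half be (lexx 0).
  exists (Num.max x y); first by rewrite le_max lexx.
  have : W e y <= W e (Num.max x y).
    apply: (profile_W_le pf); rewrite /= ?in_itv /= ?y0 ?le_max ?x0 ?lexx ?orbT //.
  by lra.
Qed.

Lemma ray_spath b v L : 0 < b -> spath v L ->
  calibrated_ray b (phi v) (\sum_(e <- L) m e) (\sum_(e <- L) q e) (\sum_(e <- L) w e).
Proof.
move=> b0; elim=> [e be|e {}v v' {}L ej pL IH nv].
  have := ray_half b0 be (lexx 0); have [-> -> ->] := h1_0 H e.
  by rewrite !subr0 !big_seq1 (h1_src H).
rewrite !big_cons; apply: calibrated_seg_ray IH => //; exact: seg_edge.
Qed.

Lemma h1_m_ge0 e : 0 <= m e.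
Proof.
have [S0 Q0 W0] := h1_0 H e; case: (boolP (bnd G e)) => be.
  have [<- _ _] := h1_bnd H be; rewrite -{1}S0.
  have l0 := wf be.
  by apply: (profile_S_le (h1_profile_bnd be)); rewrite ?ltW //= in_itv /= lexx ltW.
by have [h _ _ _ _] := h1_half H be; rewrite -S0 h.
Qed.

Lemma h1_q_ge0 e : 0 <= q e.
Proof.
have [S0 Q0 W0] := h1_0 H e; case: (boolP (bnd G e)) => be.
  have [_ <- _] := h1_bnd H be; rewrite -{1}Q0.
  have l0 := wf be.
  by apply: (profile_Q_le (h1_profile_bnd be)); rewrite ?ltW //= in_itv /= lexx ltW.
by have [_ h _ _ _] := h1_half H be; rewrite -Q0 h.
Qed.

Lemma h1_W_le_S e x y M : (forall t, edge_dom G e t -> `|u e t| <= M) -> 0 <= M ->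
  0 <= x -> x <= y -> edge_dom G e y -> W e y - W e x <= M ^+ 4 * (S e y - S e x).
Proof.
move=> uM M0 x0 xy Dy.
have -> : M ^+ 4 = (M ^+ 2) ^+ 2 by rewrite -exprM.
have sub := edge_dom_seg x0 Dy.
have p' := profile_sub sub (prf e).
apply: (profile_Wle p'); rewrite ?sqr_ge0 //= ?in_itv /= ?lexx ?xy //.
move=> t ht; rewrite -real_normK ?num_real // ler_sqr ?nnegrE //; apply: uM; exact: sub.
Qed.

Lemma h1_w_le_m e M : (forall t, edge_dom G e t -> `|u e t| <= M) -> 0 <= M ->
  w e <= M ^+ 4 * m e.
Proof.
move=> uM M0; have [S0 Q0 W0] := h1_0 H e; case: (boolP (bnd G e)) => be.
  have [<- _ <-] := h1_bnd H be; have l0 := wf be.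
  have := h1_W_le_S uM M0 (lexx 0) (ltW l0); rewrite S0 W0 !subr0; apply.
  by rewrite edge_dom_bnd //= in_itv /= lexx ltW.
have [h1 _ _ _ h5] := h1_half H be.
apply/ler_addgt0Pr => d d0; have [x x0 hx] := h5 d d0.
have := h1_W_le_S uM M0 (lexx 0) x0; rewrite S0 W0 !subr0 edge_dom_half //= in_itv /= x0.
move=> /(_ isT) h; have : M ^+ 4 * S e x <= M ^+ 4 * m e.
  by rewrite ler_wpM2l ?exprn_ge0 // h1.
by lra.
Qed.

Lemma h1_m_gt0 e x : edge_dom G e x -> u e x != 0 -> 0 < m e.
Proof.
move=> Dx ux; have [S0 _ _] := h1_0 H e; have x0 := edge_dom_ge0 Dx.
case: (boolP (bnd G e)) => be.
  have [<- _ _] := h1_bnd H be; rewrite -S0.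
  apply: (profile_S_lt (h1_profile_bnd be)) ux => //; first exact: wf.
  by move: Dx; rewrite edge_dom_bnd //= in_itv.
have [h _ _ _ _] := h1_half H be; apply: lt_le_trans (h (x + 1) _); last by lra.
rewrite -S0; apply: (profile_S_lt (h1_profile_half be (lexx 0))) ux; [|lra|lra].
exact: subset_itvl.
Qed.

Lemma h1_w_gt0 e x : edge_dom G e x -> u e x != 0 -> 0 < w e.
Proof.
move=> Dx ux; have [_ _ W0] := h1_0 H e; have x0 := edge_dom_ge0 Dx.
case: (boolP (bnd G e)) => be.
  have [_ _ <-] := h1_bnd H be; rewrite -W0.
  apply: (profile_W_lt (h1_profile_bnd be)) ux => //; first exact: wf.
  by move: Dx; rewrite edge_dom_bnd //= in_itv.
have [_ _ h _ _] := h1_half H be; apply: lt_le_trans (h (x + 1) _); last by lra.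
rewrite -W0; apply: (profile_W_lt (h1_profile_half be (lexx 0))) ux; [|lra|lra].
exact: subset_itvl.
Qed.

Lemma h1_w_ge0 e : 0 <= w e.
Proof.
have [S0 Q0 W0] := h1_0 H e; case: (boolP (bnd G e)) => be.
  have [_ _ <-] := h1_bnd H be; rewrite -{1}W0.
  have l0 := wf be.
  by apply: (profile_W_le (h1_profile_bnd be)); rewrite ?ltW //= in_itv /= lexx ltW.
by have [_ _ h _ _] := h1_half H be; rewrite -W0 h.
Qed.

Lemma h1_touch_m_gt0 e v : touches e v -> phi v != 0 -> 0 < m e.
Proof.
rewrite /touches => /orP[/eqP <-|/andP[be /eqP <-]].
  by rewrite -(h1_src H); apply: h1_m_gt0; exact: edge_dom0.
rewrite -(h1_tgt H) //; apply: h1_m_gt0.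
by rewrite edge_dom_bnd //= in_itv /= lexx andbT ltW // wf.
Qed.

Lemma sum_m_ge0 L : 0 <= \sum_(e <- L) m e.
Proof. by apply: sumr_ge0 => e _; exact: h1_m_ge0. Qed.

Lemma spath_m_gt0 v L : spath v L -> phi v != 0 -> 0 < \sum_(e <- L) m e.
Proof.
move=> pL pv; have /hasP[e eL ev] := spath_touches pL.
rewrite (perm_big _ (perm_to_rem eL)) big_cons /=.
by rewrite ltr_wpDr ?sum_m_ge0 // (h1_touch_m_gt0 ev).
Qed.

(** Induction along the path. The prefix [m1], [q1], [w1] collects what lies between the maximum and
    [v], and the hypotheses keep the total angle at [pi / 2] and the inequality saturated, so each
    point of the path is a cut to which the two splitting lemmas apply. *)
Lemma spath_nonvanishing b M v L m1 q1 w1 : 0 < b -> M != 0 ->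
  (forall e x, edge_dom G e x -> `|u e x| <= `|M|) ->
  spath v L -> calibrated_seg b M (phi v) m1 q1 w1 ->
  2 * b * (m1 + \sum_(e <- L) m e) = pi / 2 ->
  q1 + \sum_(e <- L) q e = b ^+ 2 * (w1 + \sum_(e <- L) w e) ->
  0 < \sum_(e <- L) m e ->
  forall v', has (fun e => touches e v') L -> phi v' != 0.
Proof.
move=> b0 M0 uM pL; elim: pL m1 q1 w1 => [e be|e {}v v1 {}L ej pL IH nv] m1 q1 w1 sg tot eqw mL v'.
  rewrite /= orbF /touches (negbTE be) orbF => /eqP <-.
  exact: (split_neq0 b0 sg (ray_spath b0 (spath_half be)) tot eqw).
have pv : phi v != 0.
  exact: (split_neq0 b0 sg (ray_spath b0 (spath_step ej pL nv)) tot eqw).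
have l0 := len_gt0 ej.
have [u' [S' [Q' [W' [p' [u0 ul] [Sl Ql Wl] uu']]]]] := h1_traverse ej.
have subl x : 0 <= x <= len G e -> `[0, x]%classic `<=` `[0, len G e]%classic.
  by move=> /andP[_ ?]; apply: subset_itvl; rewrite bnd_simp.
have subr x : 0 <= x <= len G e -> `[x, len G e]%classic `<=` `[0, len G e]%classic.
  by move=> /andP[? _]; apply: subset_itvr; rewrite bnd_simp.
(* The mass does not run out within [e]. Otherwise [u] vanishes at [v1], the bound of [u ^ 2] by the
   mass ahead holds on all of [e], and Gronwall leaves no mass on [e] either. *)
have sL : 0 < \sum_(e <- L) m e.
  rewrite lt_def sum_m_ge0 andbT; apply/eqP => sL0.
  have me : 0 < m e by move: mL; rewrite big_cons sL0 addr0.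
  have pv1 : phi v1 = 0.
    by apply/eqP; apply: contraT => h; have := spath_m_gt0 pL h; rewrite sL0 ltxx.
  have : S' 0 = S' (len G e).
    apply: (profile_no_extinction (C := 4 * b * M ^+ 2) p' (ltW l0)) => [||x hx Sx].
    - by rewrite mulr_ge0 ?sqr_ge0 // mulr_ge0 // ltW.
    - by rewrite ul.
    have /andP[x0 xl] := hx.
    have sg1 := profile_seg p' (subl _ hx) (ltW b0) x0.
    have sg2 := profile_seg p' (subr _ hx) (ltW b0) xl.
    rewrite u0 in sg1; rewrite ul in sg2.
    have pre := calibrated_seg_seg b0 sg sg1.
    have suf := calibrated_seg_ray b0 sg2 (ray_spath b0 pL).
    have := split_sqr_le b0 pre suf.
    rewrite sL0 addr0; apply; last by rewrite subr_gt0.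
    - rewrite -tot big_cons sL0 addr0 -Sl; congr (_ * _); ring.
    - move: eqw; rewrite !big_cons -Ql -Wl => eqw.
      have -> : q1 + (Q' x - Q' 0) + (Q' (len G e) - Q' x + \sum_(e0 <- L) q e0) =
        q1 + (Q' (len G e) - Q' 0 + \sum_(j <- L) q j) by ring.
      by rewrite eqw; congr (_ * _); ring.
    - by have [y hy ->] := uu' x hx; apply: uM; rewrite edge_dom_bnd //=; case/andP: ej.
  by move=> hS; move: Sl; rewrite hS subrr => h; rewrite -h ltxx in me.
have IH' := IH (m1 + m e) (q1 + q e) (w1 + w e)
  (calibrated_seg_seg b0 sg (seg_edge b0 ej)) _ _ sL.
rewrite /= => /orP[ev'|]; last first.
  by apply: IH'; [rewrite -tot big_cons addrA|move: eqw; rewrite !big_cons !addrA].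
have [->|vv'] := eqVneq v' v; first exact: pv.
have -> : v' = v1.
  move: ev' ej; rewrite /touches /joins => /orP[/eqP h|/andP[_ /eqP h]] /andP[_].
    by rewrite h (negbTE vv') /= => /andP[/eqP].
  by rewrite h (negbTE vv') andbF orbF => /andP[_ /eqP].
by apply: IH'; [rewrite -tot big_cons addrA|move: eqw; rewrite !big_cons !addrA|
  exact: spath_touches].
Qed.

End LowerBound.

Section GraphInequality.
Context {R : realType} {G : graph R}.
Variables (u S Q W : 'I_(nE G) -> R -> R) (m q w : 'I_(nE G) -> R) (phi : 'I_(nV G) -> R).
Hypotheses (wf : wf_graph G) (cG : connected_graph G) (nG : noncompact G)
  (H : h1_data u S Q W m q w phi).
Implicit Types (e : 'I_(nE G)) (v : 'I_(nV G)) (L : seq 'I_(nE G)) (b c x M : R).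

Let prf e := h1_profile H e.

Lemma h1_edge_max e : exists2 x, edge_dom G e x &
  forall t, edge_dom G e t -> `|u e t| <= `|u e x|.
Proof.
case: (boolP (bnd G e)) => be.
  have l0 := wf be.
  have [x hx mx] := profile_max (h1_profile_bnd H be) (@subset_refl _ _) l0.
  by exists x => [|t]; rewrite edge_dom_bnd //= in_itv //; exact: mx.
have p0 := h1_profile_half H be (lexx 0).
have [Sm Qq _ Sm' _] := h1_half H be; have [S0 Q0 _] := h1_0 H e.
rewrite edge_dom_half //.
case: (pselect (exists2 t, 0 <= t & u e t != 0)) => [[t0 t00 ut0]|none]; last first.
  exists 0 => [|t]; rewrite /= in_itv /= ?lexx // andbT => t0.
  suff -> : u e t = 0 by rewrite normr0.
  by apply/eqP; apply: contraT => ut; case: none; exists t.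
have q0 : 0 <= q e by exact: (h1_q_ge0 wf H).
(* With this much mass or less ahead, the tail bound reads [u t ^ 4 <= u t0 ^ 4]; the supremum is
   therefore attained on a bounded interval containing [t0]. *)
pose d := u e t0 ^+ 4 / (16 * (q e + 1)).
have k0 : 0 < 16 * (q e + 1) by lra.
have d0 : 0 < d by rewrite divr_gt0 // exprn_even_gt0.
have [n n0 hn] := Sm' d d0.
have small t : n <= t -> `|u e t| <= `|u e t0|.
  move=> nt; have t0' : 0 <= t by lra.
  have := profile_tail_bound p0 (q := q e) _ t0' (e := d).
  move=> /(_ _ _) h.
  have {}h : u e t ^+ 4 <= 16 * (q e + 1) * d.
    apply: h => [x x0|y ty]; first by rewrite Q0 subr0; exact: Qq.
    have : S e n <= S e t by apply: (profile_S_le p0); rewrite /= ?in_itv /= ?n0 ?t0'.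
    have := Sm y (le_trans t0' ty); lra.
  rewrite /d mulrC divfK ?lt0r_neq0 // in h.
  rewrite -(@ler_pXn2r _ 4) ?nnegrE // -!normrX.
  by rewrite !ger0_norm ?exprn_even_ge0.
pose N := Num.max n t0 + 1.
have N1 : n < N by rewrite /N ltr_pwDr // le_max lexx.
have N2 : t0 < N by rewrite /N ltr_pwDr // le_max lexx orbT.
have sub0N : `[0, N]%classic `<=` `[0, +oo[%classic by exact: subset_itvl.
have [x hx mx] := profile_max p0 sub0N ltac:(lra).
exists x; first by rewrite /= in_itv /= andbT; case/andP: hx.
move=> t; rewrite /= in_itv /= andbT => t1.
case: (leP t N) => tN; first by apply: mx; rewrite t1 tN.
apply: le_trans (small t _) (mx t0 _); lra.
Qed.

Lemma h1_max : exists e0 x0, edge_dom G e0 x0 /\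
  forall e x, edge_dom G e x -> `|u e x| <= `|u e0 x0|.
Proof.
have [X DX mX] : exists2 X : 'I_(nE G) -> R, (forall e, edge_dom G e (X e)) &
    forall e t, edge_dom G e t -> `|u e t| <= `|u e (X e)|.
  have /choice[X hX] : forall e, exists x, edge_dom G e x /\
      forall t, edge_dom G e t -> `|u e t| <= `|u e x|.
    by move=> e; have [x ? ?] := h1_edge_max e; exists x.
  by exists X => e; have [] := hX e.
have [e1 _] := nG.
have [e0 _ he0] := @Order.TotalTheory.arg_maxP _ _ _ e1 xpredT (fun e => `|u e (X e)|) isT.
exists e0, (X e0); split=> // e x Dx; apply: le_trans (mX e x Dx) _.
exact: he0.
Qed.

Let msum := \sum_e m e.

Section Rest.
Variables (b M : R) (K : seq 'I_(nE G)).
Hypotheses (uK : uniq K) (M0 : 0 <= M)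
  (uM : forall e x, edge_dom G e x -> `|u e x| <= M).

Lemma rest_m_ge0 : 0 <= \sum_(e | e \notin K) m e.
Proof. by apply: sumr_ge0 => e _; exact: (h1_m_ge0 wf H). Qed.

Lemma rest_q_ge0 : 0 <= \sum_(e | e \notin K) q e.
Proof. by apply: sumr_ge0 => e _; exact: (h1_q_ge0 wf H). Qed.

Lemma rest_w_le : \sum_(e | e \notin K) w e <= M ^+ 4 * \sum_(e | e \notin K) m e.
Proof.
by rewrite mulr_sumr; apply: ler_sum => e _; apply: (h1_w_le_m wf H (uM (e := e))).
Qed.

End Rest.

Lemma pow4_norm (x : R) : `|x| ^+ 4 = x ^+ 4.
Proof. by rewrite -normrX ger0_norm // exprn_even_ge0. Qed.

(* If the maximum is attained inside an edge, the mass left out of the path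
   from there to infinity is positive and the inequality is strict. *)
Lemma interior_max_strict b e0 x0 : 0 < b -> 2 * b * msum = pi / 2 ->
  (forall e x, edge_dom G e x -> `|u e x| <= `|u e0 x0|) -> u e0 x0 != 0 ->
  edge_dom G e0 x0 -> 0 < x0 -> (bnd G e0 -> x0 < len G e0) ->
  b ^+ 2 * \sum_e w e < \sum_e q e.
Proof.
move=> b0 tot uM U0 Dx xp xl; have [S0 Q0 W0] := h1_0 H e0.
have MM : 0 <= `|u e0 x0| by [].
suff [mP [qP [wP [mr [ry mP0 mr0 mE [qE wE]]]]]] : exists mP qP wP mr,
    [/\ calibrated_ray b (u e0 x0) mP qP wP, 0 < mP, 0 < mr, mP + mr = msum &
     qP <= \sum_e q e /\ \sum_e w e <= wP + u e0 x0 ^+ 4 * mr].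
  rewrite -mE in tot.
  have [le1 eq1] := ray_rest_le b0 ry mP0 (ltW mr0) tot qE wE.
  rewrite lt_neqAle le1 andbT; apply/eqP => eqw.
  by have := eq1 U0 (esym eqw) => h; rewrite h ltxx in mr0.
have W1 : W e0 x0 <= u e0 x0 ^+ 4 * S e0 x0.
  have := h1_W_le_S H (uM e0) MM (lexx 0) (ltW xp) Dx.
  by rewrite W0 S0 !subr0 pow4_norm.
have Q1 : 0 <= Q e0 x0.
  rewrite -Q0; apply: (profile_Q_le (prf e0)) (ltW xp) => //; exact: edge_dom0.
have S1 : 0 < S e0 x0.
  rewrite -S0; apply: (profile_S_lt (prf e0)) U0 => //; first exact: edge_dom_down.
  by rewrite lexx ltW.
case: (boolP (bnd G e0)) => be.
  have {}xl := xl be; have l0 := wf be.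
  have [Sl Ql Wl] := h1_bnd H be.
  have Dl : edge_dom G e0 (len G e0) by rewrite edge_dom_bnd //= in_itv /= lexx ltW.
  have sub2 : `[x0, len G e0]%classic `<=` edge_dom G e0 by apply: edge_dom_seg => //; exact: ltW.
  have S2 : S e0 x0 < S e0 (len G e0).
    by apply: (profile_S_lt (prf e0)) U0 => //; rewrite lexx ltW.
  have W2 := h1_W_le_S H (uM e0) MM (ltW xp) (ltW xl) Dl.
  rewrite pow4_norm in W2.
  have Q2 : Q e0 x0 <= Q e0 (len G e0) by apply: (profile_Q_le (prf e0)) (ltW xl).
  (* The path leaves [e0] through one of its ends and never returns to it, so the piece of [e0] on
     the other side of [x0] stays outside, with positive mass because [u e0 x0] is not 0. *)
  have [L e0L pL] := spath_avoid cG nG be.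
  have uL : uniq (e0 :: L).
    by rewrite /= e0L; case: pL => /spath_uniq.
  have mL := sum_m_ge0 wf H L.
  have := rest_m_ge0 (e0 :: L); have := rest_q_ge0 (e0 :: L).
  have := rest_w_le (e0 :: L) MM uM; rewrite pow4_norm.
  rewrite /msum !(sum_split _ uL) !big_cons.
  set mR := \sum_(e | _) m e; set qR := \sum_(e | _) q e; set wR := \sum_(e | _) w e.
  move=> wR1 qR0 mR0.
  case: pL => pL.
    have pr := profile_rev (h1_profile_bnd H be).
    have := profile_seg pr (b := b) (p := len G e0 - x0) (q := len G e0) _ (ltW b0) _.
    rewrite /= subrr opprK (_ : len G e0 - (len G e0 - x0) = x0); last by ring.
    rewrite S0 Q0 W0 oppr0 !add0r !opprK => sg.
    have {}sg : calibrated_seg b (u e0 x0) (u e0 0) (S e0 x0) (Q e0 x0) (W e0 x0).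
      apply: sg; first by apply: subset_itvr; rewrite bnd_simp; lra.
      by lra.
    rewrite (h1_src H) in sg.
    have ry := calibrated_seg_ray b0 sg (ray_spath wf H b0 pL).
    eexists _, _, _, (S e0 (len G e0) - S e0 x0 + mR); split; [exact: ry|lra|lra| |split].
    - by rewrite -Sl; ring.
    - by lra.
    - by rewrite -Wl; lra.
  have sg := profile_seg (prf e0) sub2 (ltW b0) (ltW xl).
  rewrite (h1_tgt H) // in sg.
  have ry := calibrated_seg_ray b0 sg (ray_spath wf H b0 pL).
  eexists _, _, _, (S e0 x0 + mR); split; [exact: ry|lra|lra| |split].
  - by rewrite -Sl; ring.
  - by lra.
  - by rewrite -Wl; lra.
have ry := ray_half H b0 be (ltW xp).
have [Sm Qq Ww _ _] := h1_half H be.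
have uL : uniq [:: e0] by [].
have := rest_m_ge0 [:: e0]; have := rest_q_ge0 [:: e0].
have := rest_w_le [:: e0] MM uM; rewrite pow4_norm.
rewrite /msum !(sum_split _ uL) !big_seq1.
set mR := \sum_(e | _) m e; set qR := \sum_(e | _) q e; set wR := \sum_(e | _) w e.
move=> wR1 qR0 mR0.
eexists _, _, _, (S e0 x0 + mR); split; [exact: ry| |lra|ring|split; lra].
have S3 : S e0 x0 < S e0 (x0 + 1).
  apply: (profile_S_lt (prf e0)) U0; [|lra|lra].
  by apply: edge_dom_seg (ltW xp) _; rewrite edge_dom_half //= in_itv /= andbT; lra.
have := Sm (x0 + 1) ltac:(lra); lra.
Qed.

(** In the equality case all mass lies on the path and [u] is nonzero at each of its vertices. An
    edge attached to the path from outside would carry mass, so there is none, and by connectedness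
    the path is the whole graph. *)
Lemma vertex_max_le b v : 0 < b -> 2 * b * msum = pi / 2 ->
  (forall e x, edge_dom G e x -> `|u e x| <= `|phi v|) -> phi v != 0 ->
  b ^+ 2 * \sum_e w e <= \sum_e q e /\
  (\sum_e q e = b ^+ 2 * \sum_e w e -> is_halfline G).
Proof.
move=> b0 tot uM U0; have [L pL] := spath_exists v cG nG.
have uL := spath_uniq pL; have ry := ray_spath wf H b0 pL.
have mL := spath_m_gt0 wf H pL U0.
have := rest_m_ge0 L; have := rest_q_ge0 L.
have := rest_w_le L (normr_ge0 _) uM; rewrite pow4_norm.
rewrite /msum (sum_split _ uL) in tot.
rewrite !(sum_split _ uL) => wR qR mR.
have [le1 eq1] := @ray_rest_le _ _ b0 _ _ _ _ _
  (\sum_(e <- L) q e + \sum_(e | e \notin L) q e)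
  (\sum_(e <- L) w e + \sum_(e | e \notin L) w e) ry mL mR tot ltac:(lra) ltac:(lra).
split=> // eqw; have mr0 := eq1 U0 eqw.
have mout e : e \notin L -> m e = 0.
  move=> eL; move/eqP: mr0; rewrite psumr_eq0; last by move=> e' _; exact: (h1_m_ge0 wf H).
  by move=> /allP /(_ e (mem_index_enum e)); rewrite eL /= => /eqP.
rewrite mr0 mulr0 in wR; rewrite mr0 addr0 in tot.
(* The inequality for the path alone, with nothing left off it. Off the path the sextic terms are at
   most 0 and the kinetic ones at least 0, so equality descends to the path. *)
have [le2 _] := @ray_rest_le _ _ b0 _ _ _ _ 0 (\sum_(e <- L) q e) (\sum_(e <- L) w e) ry mL
  (lexx 0) ltac:(by rewrite addr0) (lexx _) ltac:(by rewrite mulr0 addr0).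
have eqL : \sum_(e <- L) q e = b ^+ 2 * \sum_(e <- L) w e.
  apply/eqP; rewrite eq_le le2 andbT.
  have : b ^+ 2 * \sum_(e | e \notin L) w e <= 0 by rewrite mulr_ge0_le0 ?sqr_ge0.
  by lra.
have nz := @spath_nonvanishing _ _ _ _ _ _ _ _ _ _ wf H b (phi v) v L 0 0 0 b0 U0 uM pL
  (calibrated_seg_nil b _) ltac:(by rewrite add0r) ltac:(by rewrite !add0r) mL.
have inL e v' : has (fun e => touches e v') L -> touches e v' -> e \in L.
  move=> /nz pv' ev'; apply: contraT => eL.
  by have := h1_touch_m_gt0 wf H ev' pv'; rewrite mout // ltxx.
apply: (spath_cover_halfline pL) => e.
have along p y : path (adj G) y p -> has (fun e => touches e y) L ->
    has (fun e => touches e (last y p)) L.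
  elim: p y => [|x p IH] y //= /andP[/existsP[e' ej] pp] yL.
  apply: IH => //; apply/hasP; exists e'; first exact: inL yL (joins_touches ej).
  by apply: (joins_touches (w := y)); rewrite joins_sym.
have all_touched v' : has (fun e => touches e v') L.
  have [_ conn] := cG; have /connectP[p pp ->] := conn v v'.
  exact: along pp (spath_touches pL).
by apply: (inL _ (src G e)) => //; rewrite /touches eqxx.
Qed.

(** The maximum of [|u|] lies at a vertex or strictly inside an edge, and only the first case allows
    equality. It is nonzero because the mass is positive. *)
Lemma h1_inequality : 0 < msum ->
  [/\ 0 < \sum_e w e,
   (pi / (4 * msum)) ^+ 2 * \sum_e w e <= \sum_e q e &
   (\sum_e q e = (pi / (4 * msum)) ^+ 2 * \sum_e w e -> is_halfline G)].
Proof.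
move=> ms0; set b := pi / (4 * msum).
have b0 : 0 < b by rewrite divr_gt0 ?pi_gt0 // mulr_gt0.
have tot : 2 * b * msum = pi / 2 by rewrite /b; field; rewrite lt0r_neq0.
have [e0 [x0 [Dx uM]]] := h1_max.
have U0 : u e0 x0 != 0.
  apply/eqP => U0; rewrite U0 normr0 in uM.
  suff : msum <= 0 by rewrite leNgt ms0.
  apply: sumr_le0 => e _.
  have u0 x : edge_dom G e x -> u e x ^+ 2 <= 0.
    by move=> /uM; rewrite normr_le0 => /eqP ->; rewrite expr0n.
  have [S0 _ _] := h1_0 H e.
  have Sx x : edge_dom G e x -> S e x <= 0.
    move=> Dex; have x0' := edge_dom_ge0 Dex.
    have := profile_Sle (r := 0) (prf e) (edge_dom0 e wf) Dex x0'.
    rewrite S0 mul0r subr0; apply => t ht; apply: u0; exact: edge_dom_down Dex _ ht.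
  case: (boolP (bnd G e)) => be.
    have [<- _ _] := h1_bnd H be; apply: Sx.
    by rewrite edge_dom_bnd //= in_itv /= lexx ltW // wf.
  have [_ _ _ h _] := h1_half H be.
  apply/ler_addgt0Pr => d d0; have [x x0' hx] := h d d0.
  have : S e x <= 0 by apply: Sx; rewrite edge_dom_half //= in_itv /= x0'.
  by lra.
have w0 : 0 < \sum_e w e.
  rewrite (bigD1 e0) //= ltr_wpDr ?(h1_w_gt0 wf H Dx U0) //.
  by apply: sumr_ge0 => e _; exact: (h1_w_ge0 wf H).
have vmax v : `|phi v| = `|u e0 x0| -> [/\ 0 < \sum_e w e,
    b ^+ 2 * \sum_e w e <= \sum_e q e & \sum_e q e = b ^+ 2 * \sum_e w e -> is_halfline G].
  move=> pv; have pv0 : phi v != 0 by rewrite -normr_eq0 pv normr_eq0.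
  rewrite -pv in uM.
  by have [? ?] := vertex_max_le b0 tot uM pv0.
have := edge_dom_ge0 Dx; rewrite le_eqVlt => /orP[/eqP x00|x0p].
  by apply: (vmax (src G e0)); rewrite -x00 (h1_src H).
case: (pselect (bnd G e0 /\ x0 = len G e0)) => [[be xl]|nl].
  by apply: (vmax (tgt G e0)); rewrite xl (h1_tgt H).
have lt : b ^+ 2 * \sum_e w e < \sum_e q e.
  apply: (interior_max_strict b0 tot uM U0 Dx x0p) => be.
  rewrite lt_neqAle; apply/andP; split; first by apply/eqP => h; exact: nl.
  by move: Dx; rewrite edge_dom_bnd //= in_itv /= => /andP[].
split=> //; first exact: ltW.
by move=> h; rewrite h ltxx in lt.
Qed.

End GraphInequality.

(** * Trial functions *)

Section AffineFTC.
Context {R : realType}.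
Local Notation mu := (@lebesgue_measure R).
Implicit Types (h H : R -> R) (a k l x : R).

Lemma is_derive_continuous h H : (forall x, is_derive x (1 : R) H (h x)) -> continuous H.
Proof.
move=> dH x; apply/differentiable_continuous/derivable1_diffP.
by have [] := dH x.
Qed.

Lemma is_derive_affine h H a k : (forall x, is_derive x (1 : R) H (h x)) ->
  forall x, is_derive x (1 : R) (fun t => H (a + k * t)) (k * h (a + k * x)).
Proof.
move=> dH x.
have d1 : is_derive x (1 : R) (fun t => a + k * t) k.
  by apply: is_derive_eq; rewrite add0r mul1r; exact: mulr1.
rewrite mulrC; exact: (@is_derive1_comp R H (fun t => a + k * t) x _ _ (dH (a + k * x)) d1).
Qed.

Lemma continuous_affine h a k : continuous h -> continuous (fun x => h (a + k * x)).
Proof.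
move=> ch x; apply: (@continuous_comp _ _ _ (fun x => a + k * x) h); last exact: ch.
by apply: cvgD; [exact: cvg_cst|apply: cvgM; [exact: cvg_cst|exact: cvg_id]].
Qed.

Lemma FTC2_affine h H a k l : 0 <= l -> (forall x, is_derive x (1 : R) H (h x)) ->
  continuous h ->
  (\int[mu]_(x in `[0%R, l]%classic) (k * h (a + k * x))%:E = (H (a + k * l) - H a)%:E)%E.
Proof.
rewrite le_eqVlt => /orP[/eqP <-|l0] dH ch.
  by rewrite set_itv1 integral_set1 mulr0 addr0 subrr.
have dK := is_derive_affine a k dH.
have cK := is_derive_continuous dK.
rewrite (@continuous_FTC2 _ (fun x => k * h (a + k * x)) (fun x => H (a + k * x)) 0 l) //.
- by rewrite mulr0 addr0 EFinB.
- apply: continuous_subspaceT => x; apply: cvgM; first exact: cvg_cst.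
  exact: continuous_affine.
- split.
  + by move=> x _; have [] := dK x.
  + by apply: cvg_at_right_filter; exact: cK.
  + by apply: cvg_at_left_filter; exact: cK.
- by move=> x _; rewrite derive1E; have [_ ->] := dK x.
Qed.

Lemma FTC2_affine_sgn h H a k l : 0 <= l -> k ^+ 2 = 1 ->
  (forall x, is_derive x (1 : R) H (h x)) -> continuous h ->
  (\int[mu]_(x in `[0%R, l]%classic) (h (a + k * x))%:E = (k * (H (a + k * l) - H a))%:E)%E.
Proof.
move=> l0 k1 dH ch.
have -> : k * (H (a + k * l) - H a) = (k \*o H) (a + k * l) - (k \*o H) a.
  by rewrite /= mulrBr.
rewrite -(@FTC2_affine (k \*o h) (k \*o H)) //.
  by apply: eq_integral => x _; rewrite /= mulrA -expr2 k1 mul1r.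
by move=> x; apply: cvgM; [exact: cvg_cst|exact: ch].
Qed.

Lemma FTC2y_affine h H a l : (forall x, 0 <= h x) ->
  (forall x, is_derive x (1 : R) H (h x)) -> continuous h -> H x @[x --> +oo] --> l ->
  (\int[mu]_(x in `[0%R, +oo[%classic) (h (a + 1 * x))%:E = (l - H a)%:E)%E.
Proof.
move=> h0 dH ch Hl.
have dK := is_derive_affine a 1 dH.
have cK := is_derive_continuous dK.
rewrite (@ge0_continuous_FTC2y _ (fun x => h (a + 1 * x)) (fun x => H (a + 1 * x)) 0 l) //.
- by rewrite mulr0 addr0 EFinB.
- by apply: continuous_subspaceT; exact: continuous_affine.
- apply: (@cvg_comp _ _ _ (fun x => a + 1 * x) H _ +oo) => //.
  apply/cvgryPge => r; near=> x.
  rewrite mul1r -lerBlDl; near: x; apply: nbhs_pinfty_ge; exact: num_real.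
- by apply: cvg_at_right_filter; exact: cK.
- by move=> x _; rewrite derive1E; have [_ ->] := dK x; rewrite mul1r.
Unshelve. all: end_near.
Qed.

End AffineFTC.

(* The contribution of one edge to an integral of [h = H'] along a path, the
   edge being parametrised by [a + k * x] with [k = 1] or [k = -1]; [l] is the
   limit of [H] at infinity. *)
Definition edge_val (R : realType) (G : graph R) (a k : 'I_(nE G) -> R)
    (H : R -> R) (l : R) (e : 'I_(nE G)) : R :=
  if bnd G e then k e * (H (a e + k e * len G e) - H (a e)) else l - H (a e).

Section Builder.
Context {R : realType} {G : graph R}.
Local Notation mu := (@lebesgue_measure R).
Variables (L : seq 'I_(nE G)) (F dF A B hB C hC : R -> R) (a k : 'I_(nE G) -> R)
  (phi : 'I_(nV G) -> R) (lA lB lC : R).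
Hypotheses (wf : wf_graph G) (uL : uniq L)
  (FdF : forall x, is_derive x (1 : R) F (dF x)) (cdF : continuous dF)
  (AF : forall x, is_derive x (1 : R) A (F x ^+ 2))
  (Bh : forall x, is_derive x (1 : R) B (hB x)) (chB : continuous hB)
  (dFhB : forall x, dF x ^+ 2 <= hB x)
  (Ch : forall x, is_derive x (1 : R) C (hC x)) (chC : continuous hC)
  (hCF : forall x, hC x <= F x ^+ 6)
  (k1 : forall e, k e ^+ 2 = 1)
  (phi_src : forall e, e \in L -> F (a e) = phi (src G e))
  (phi_tgt : forall e, e \in L -> bnd G e -> F (a e + k e * len G e) = phi (tgt G e))
  (phi0_src : forall e, e \notin L -> phi (src G e) = 0)
  (phi0_tgt : forall e, e \notin L -> bnd G e -> phi (tgt G e) = 0)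
  (halflines : forall e, e \in L -> ~~ bnd G e -> [/\ k e = 1, (forall x, 0 <= hC x),
     A x @[x --> +oo] --> lA, B x @[x --> +oo] --> lB & C x @[x --> +oo] --> lC]).
Implicit Types (e : 'I_(nE G)).

Let u e x := if e \in L then F (a e + k e * x) else 0.
Let du e x := if e \in L then k e * dF (a e + k e * x) else 0.

Let cF : continuous F. Proof. exact: is_derive_continuous FdF. Qed.

Let cX (f : R -> R) n : continuous f -> continuous (fun x => f x ^+ n).
Proof.
move=> cf x; apply: (@continuous_comp _ _ _ f (fun y => y ^+ n)); first exact: cf.
exact: exprn_continuous.
Qed.

Let cFX n : continuous (fun x => F x ^+ n). Proof. exact: cX. Qed.

Let cdF2 : continuous (fun x => dF x ^+ 2). Proof. exact: cX. Qed.

Let ms (D : set R) (h : R -> R) : measurable D -> continuous h -> measurable_fun D h.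
Proof. by move=> mD ch; apply: measurable_funTS; exact: continuous_measurable_fun. Qed.

Let cu e : continuous (u e).
Proof.
rewrite /u; case: (e \in L) => x; last exact: cvg_cst.
exact: (continuous_affine cF).
Qed.

Let cdu e : continuous (du e).
Proof.
rewrite /du; case: (e \in L) => x; last exact: cvg_cst.
apply: cvgM; first exact: cvg_cst.
exact: (continuous_affine cdF).
Qed.

Lemma edge_int_le (h g H : R -> R) l e : (forall x, 0 <= h x) -> (forall x, h x <= g x) ->
  (forall x, is_derive x (1 : R) H (g x)) -> continuous h -> continuous g ->
  (~~ bnd G e -> k e = 1 /\ H x @[x --> +oo] --> l) ->
  (\int[mu]_(x in edge_dom G e) (h (a e + k e * x))%:E <= (edge_val a k H l e)%:E)%E.
Proof.
move=> h0 hg dH ch cg hl.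
apply: (@le_trans _ _ (\int[mu]_(x in edge_dom G e) (g (a e + k e * x))%:E)%E).
  apply: ge0_le_integral => //.
  - exact: measurable_edge_dom.
  - by move=> x _; rewrite lee_fin.
  - apply/measurable_EFinP; apply: ms; first exact: measurable_edge_dom.
    exact: continuous_affine.
  - apply/measurable_EFinP; apply: ms; first exact: measurable_edge_dom.
    exact: continuous_affine.
  - by move=> x _; rewrite lee_fin.
rewrite /edge_val; case: ifPn => be.
  rewrite edge_dom_bnd // (FTC2_affine_sgn _ (H := H)) //; exact/ltW/wf.
have [ke Hl] := hl be; rewrite edge_dom_half // ke (FTC2y_affine _ _ dH cg Hl) // => x.
exact: le_trans (hg x).
Qed.

Lemma edge_int_ge (h g H : R -> R) l e : (forall x, 0 <= g x) -> (forall x, h x <= g x) ->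
  (forall x, is_derive x (1 : R) H (h x)) -> continuous h -> continuous g ->
  (~~ bnd G e -> [/\ k e = 1, (forall x, 0 <= h x) & H x @[x --> +oo] --> l]) ->
  ((edge_val a k H l e)%:E <= \int[mu]_(x in edge_dom G e) (g (a e + k e * x))%:E)%E.
Proof.
move=> g0 hg dH ch cg hl.
apply: (@le_trans _ _ (\int[mu]_(x in edge_dom G e) (h (a e + k e * x))%:E)%E).
  rewrite /edge_val; case: ifPn => be.
    rewrite edge_dom_bnd // (FTC2_affine_sgn _ (H := H)) //; exact/ltW/wf.
  by have [ke h0 Hl] := hl be; rewrite edge_dom_half // ke (FTC2y_affine _ h0 dH ch Hl).
case: (boolP (bnd G e)) => be; last first.
  have [ke h0 Hl] := hl be; apply: ge0_le_integral => //.
  - exact: measurable_edge_dom.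
  - by move=> x _; rewrite lee_fin.
  - apply/measurable_EFinP; apply: ms; first exact: measurable_edge_dom.
    exact: continuous_affine.
  - apply/measurable_EFinP; apply: ms; first exact: measurable_edge_dom.
    exact: continuous_affine.
  - by move=> x _; rewrite lee_fin.
(* On a bounded edge the minorant [h] may be negative, as the one of the corrected optimiser is
   where [sech] is small; integrability on a compact segment replaces positivity. *)
rewrite edge_dom_bnd //; apply: le_integral => //.
- apply: continuous_compact_integrable; first exact: segment_compact.
  by apply: continuous_subspaceT; exact: continuous_affine.
- apply: continuous_compact_integrable; first exact: segment_compact.
  by apply: continuous_subspaceT; exact: continuous_affine.
- by move=> x _; rewrite lee_fin.
Qed.

(** Transplants [F] to the edges of [L] and extends it by 0, [phi] expressing continuity. The mass
    must be exact because the ground energy prescribes it; the other two integrals are only compared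
    with explicit antiderivatives. *)
Lemma build_H1 : exists u du, [/\ is_H1 G u du,
  mass G u = (\sum_(e <- L) edge_val a k A lA e)%:E,
  (Lp_pow G 2 du <= (\sum_(e <- L) edge_val a k B lB e)%:E)%E &
  ((\sum_(e <- L) edge_val a k C lC e)%:E <= Lp_pow G 6 u)%E].
Proof.
have iu e : e \in L ->
    (\int[mu]_(x in edge_dom G e) (u e x ^+ 2)%:E = (edge_val a k A lA e)%:E)%E.
  move=> eL; under eq_integral do rewrite /u eL.
  apply/eqP; rewrite eq_le; apply/andP; split.
    apply: (edge_int_le (fun x => sqr_ge0 (F x)) (fun x => lexx _) AF (@cFX 2) (@cFX 2)).
    by move=> be; have [] := halflines eL be.
  apply: (edge_int_ge (fun x => sqr_ge0 (F x)) (fun x => lexx _) AF (@cFX 2) (@cFX 2)).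
  by move=> be; have [? ? ? ? ?] := halflines eL be; split=> // x; exact: sqr_ge0.
have idu e : e \in L ->
    (\int[mu]_(x in edge_dom G e) (du e x ^+ 2)%:E <= (edge_val a k B lB e)%:E)%E.
  move=> eL; under eq_integral do rewrite /du eL exprMn k1 mul1r.
  apply: (edge_int_le (fun x => sqr_ge0 (dF x)) dFhB Bh cdF2 chB).
  by move=> be; have [] := halflines eL be.
have iw e : e \in L ->
    ((edge_val a k C lC e)%:E <= \int[mu]_(x in edge_dom G e) (u e x ^+ 6)%:E)%E.
  move=> eL; under eq_integral do rewrite /u eL.
  apply: (edge_int_ge _ hCF Ch chC (@cFX 6)); first by move=> x; rewrite exprn_even_ge0.
  by move=> be; have [] := halflines eL be.
have z2 (f : 'I_(nE G) -> R -> R) e n : (forall x, f e x = 0) ->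
    (\int[mu]_(x in edge_dom G e) (f e x ^+ n.+1)%:E = 0)%E.
  by move=> f0; under eq_integral do rewrite f0 expr0n /=; rewrite integral0.
have u0 e x : e \notin L -> u e x = 0 by rewrite /u => /negbTE ->.
have du0 e x : e \notin L -> du e x = 0 by rewrite /du => /negbTE ->.
have sumL (f : 'I_(nE G) -> \bar R) : (forall e, e \notin L -> f e = 0%E) ->
    (\sum_e f e = \sum_(e <- L) f e)%E.
  move=> f0; rewrite (bigID (mem L)) /= [X in (_ + X)%E]big1 // adde0.
  by rewrite (big_uniq _ uL).
have sqn (x : R) : `|x| ^+ 2 = x ^+ 2 by rewrite real_normK ?num_real.
have sxn (x : R) : `|x| ^+ 6 = x ^+ 6 by rewrite !(exprM _ 2 3) sqn.
have lp2 (f : 'I_(nE G) -> R -> R) : Lp_pow G 2 f =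
    (\sum_e \int[mu]_(x in edge_dom G e) (f e x ^+ 2)%:E)%E.
  by apply: eq_bigr => e _; under eq_integral do rewrite sqn.
have lp6 (f : 'I_(nE G) -> R -> R) : Lp_pow G 6 f =
    (\sum_e \int[mu]_(x in edge_dom G e) (f e x ^+ 6)%:E)%E.
  by apply: eq_bigr => e _; under eq_integral do rewrite sxn.
exists u, du; split.
- split; first by move=> e; apply: ms; [exact: measurable_edge_dom|exact: cu].
  split; first by move=> e; apply: ms; [exact: measurable_edge_dom|exact: cdu].
  split=> [e|].
    case: (boolP (e \in L)) => eL; first by rewrite iu // ltry.
    by rewrite z2 ?ltry // => x; exact: u0.
  split=> [e|].
    case: (boolP (e \in L)) => eL; first exact: le_lt_trans (idu e eL) (ltry _).
    by rewrite z2 ?ltry // => x; exact: du0.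
  split=> [e x Dx|].
    have x0 := edge_dom_ge0 Dx; rewrite /u /du; case: ifP => eL.
      by rewrite (FTC2_affine _ _ x0 FdF cdF) mulr0 addr0.
    by rewrite subrr integral0.
  exists phi => e; rewrite /u; case: ifPn => eL.
    by rewrite mulr0 addr0; split; [exact: phi_src|exact: phi_tgt].
  by split; [rewrite phi0_src|move=> be; rewrite phi0_tgt].
- rewrite /mass lp2 sumL; last by move=> e eL; apply: z2 => x; exact: u0.
  rewrite -sumEFin big_seq [RHS]big_seq; apply: eq_bigr => e eL; exact: iu.
- rewrite lp2 sumL; last by move=> e eL; apply: z2 => x; exact: du0.
  rewrite -sumEFin big_seq [leRHS]big_seq; apply: lee_sum => e eL; exact: idu.
- rewrite lp6 sumL; last by move=> e eL; apply: z2 => x; exact: u0.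
  rewrite -sumEFin big_seq [leRHS]big_seq; apply: lee_sum => e eL; exact: iw.
Qed.

End Builder.

Section PointwiseDerive.
Context {R : realType}.
Implicit Types (f g : R -> R) (x c df dg : R).

Lemma derive_eq f x df df' : is_derive x (1 : R) f df -> df = df' -> is_derive x (1 : R) f df'.
Proof. by move=> h <-. Qed.

Lemma derive_add f g x df dg : is_derive x (1 : R) f df -> is_derive x (1 : R) g dg ->
  is_derive x (1 : R) (fun t => f t + g t) (df + dg).
Proof. by move=> hf hg; exact: is_deriveD. Qed.

Lemma derive_sub f g x df dg : is_derive x (1 : R) f df -> is_derive x (1 : R) g dg ->
  is_derive x (1 : R) (fun t => f t - g t) (df - dg).
Proof. by move=> hf hg; exact: is_deriveB. Qed.

Lemma derive_scale f x c df : is_derive x (1 : R) f df ->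
  is_derive x (1 : R) (fun t => c * f t) (c * df).
Proof. by move=> hf; exact: (@is_deriveZ R _ _ f c x 1 df hf). Qed.

Lemma derive_mul f g x df dg : is_derive x (1 : R) f df -> is_derive x (1 : R) g dg ->
  is_derive x (1 : R) (fun t => f t * g t) (df * g x + f x * dg).
Proof.
move=> hf hg; apply: derive_eq (is_deriveM hf hg) _.
by rewrite /GRing.scale /= addrC (mulrC _ df).
Qed.

Lemma derive_inv f x df : f x != 0 -> is_derive x (1 : R) f df ->
  is_derive x (1 : R) (fun t => (f t)^-1) (- (df / f x ^+ 2)).
Proof.
move=> f0 hf; apply: derive_eq (@is_deriveV R f x df 1 f0 hf) _.
by rewrite /GRing.scale /= mulNr mulrC.
Qed.

Lemma derive1_cstfun x c : is_derive x (1 : R) (fun=> c) 0.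
Proof. exact: is_derive_cst. Qed.

Lemma derive1_idfun x : is_derive x (1 : R) (fun t => t) 1.
Proof. exact: is_derive_id. Qed.

End PointwiseDerive.

(** * The optimiser and its antiderivatives *)

Section Sech.
Context {R : realType}.
Implicit Types (x y eps : R).

Definition sech x : R := 2 / (expR x + expR (- x)).
Definition tanh x : R := (expR x - expR (- x)) / (expR x + expR (- x)).
Definition sinh x : R := (expR x - expR (- x)) / 2.
Definition rsech x : R := Num.sqrt (sech x).
Definition gudermann x : R := 2 * atan (expR x) - pi / 2.

Let cosh2_gt0 x : 0 < expR x + expR (- x).
Proof. by rewrite addr_gt0 ?expR_gt0. Qed.

Let cosh2_neq0 x : expR x + expR (- x) != 0.
Proof. by rewrite lt0r_neq0. Qed.

Let expN x : expR x * expR (- x) = 1.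
Proof. by rewrite -expRD subrr expR0. Qed.

Lemma sech_gt0 x : 0 < sech x. Proof. by rewrite divr_gt0. Qed.

Lemma sech_neq0 x : sech x != 0. Proof. by rewrite lt0r_neq0 ?sech_gt0. Qed.

Lemma rsech_gt0 x : 0 < rsech x. Proof. by rewrite sqrtr_gt0 sech_gt0. Qed.

Lemma rsech_neq0 x : rsech x != 0. Proof. by rewrite lt0r_neq0 ?rsech_gt0. Qed.

Lemma rsech_sqr x : rsech x ^+ 2 = sech x.
Proof. by rewrite sqr_sqrtr // ltW // sech_gt0. Qed.

Lemma sech2Dtanh2 x : sech x ^+ 2 + tanh x ^+ 2 = 1.
Proof.
have e := expN x; rewrite /sech /tanh !expr_div_n -mulrDl.
apply: (mulIf (x := (expR x + expR (- x)) ^+ 2)); first by rewrite expf_neq0.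
rewrite divfK ?expf_neq0 // mul1r; ring: e.
Qed.

Lemma tanh2_le1 x : tanh x ^+ 2 <= 1.
Proof. by have := sech2Dtanh2 x; have := sqr_ge0 (sech x); lra. Qed.

Lemma is_derive_expRN x : is_derive x (1 : R) (fun t => expR (- t)) (- expR (- x)).
Proof.
have := @is_derive1_comp R expR -%R x _ _ (is_derive_expR (- x)) (is_deriveNid x 1).
by rewrite mulrN1.
Qed.

Let dcosh2 x : is_derive x (1 : R) (fun t => expR t + expR (- t)) (expR x - expR (- x)).
Proof. exact: derive_add (is_derive_expR x) (is_derive_expRN x). Qed.

Let dsinh2 x : is_derive x (1 : R) (fun t => expR t - expR (- t)) (expR x + expR (- x)).
Proof.
by have := derive_sub (is_derive_expR x) (is_derive_expRN x); rewrite opprK.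
Qed.

Let dcoshV x :=
  @derive_inv R (fun t => expR t + expR (- t)) x _ (cosh2_neq0 x) (dcosh2 x).

Lemma is_derive_sech x : is_derive x (1 : R) sech (- (sech x * tanh x)).
Proof.
apply: derive_eq (derive_scale 2 (dcoshV x)) _.
by rewrite /sech /tanh; field.
Qed.

Lemma is_derive_tanh x : is_derive x (1 : R) tanh (sech x ^+ 2).
Proof.
apply: derive_eq (derive_mul (dsinh2 x) (dcoshV x)) _.
apply: (mulIf (x := (expR x + expR (- x)) ^+ 2)); first by rewrite expf_neq0.
rewrite /sech expr_div_n divfK ?expf_neq0 //.
have e := expN x.
transitivity ((expR x + expR (- x)) ^+ 2 - (expR x - expR (- x)) ^+ 2); last by ring: e.
by field.
Qed.

Lemma is_derive_sinh x : is_derive x (1 : R) sinh (sech x)^-1.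
Proof.
have := derive_scale 2^-1 (dsinh2 x).
rewrite (_ : (fun t => _) = sinh); last by apply/funext => t; rewrite /sinh mulrC.
by move=> h; apply: derive_eq h _; rewrite /sech invf_div mulrC.
Qed.

Lemma is_derive_gudermann x : is_derive x (1 : R) gudermann (sech x).
Proof.
have h1 := @is_derive1_comp R atan expR x _ _ (is_derive1_atan (expR x)) (is_derive_expR x).
apply: derive_eq (derive_sub (derive_scale 2 h1) (derive1_cstfun x (pi / 2))) _.
have e := expN x; have c0 := cosh2_neq0 x.
have c1 : 1 + expR x ^+ 2 != 0 by rewrite lt0r_neq0 // ltr_wpDr ?sqr_ge0.
rewrite /sech subr0; apply: (mulIf c0); rewrite divfK //.
apply: (mulIf c1); transitivity (2 * (expR x * (expR x + expR (- x)))); first by field.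
by ring: e.
Qed.

Lemma is_derive_rsech x : is_derive x (1 : R) rsech (- (tanh x / 2 * rsech x)).
Proof.
have h := @is_derive1_comp R Num.sqrt sech x _ _ (is_derive1_sqrt (sech_gt0 x)) (is_derive_sech x).
apply: derive_eq h _.
rewrite -/(rsech x) -{1}rsech_sqr.
by field; rewrite rsech_neq0.
Qed.

End Sech.

(* One-sided bounds on the kinetic and sextic terms suffice: they bound the
   energy from above, and the sharp inequality bounds it from below. *)
Record trial (R : realType) (F dF A B hB C hC : R -> R) : Prop := Trial {
  trial_dF : forall x, is_derive x (1 : R) F (dF x) ;
  trial_cdF : continuous dF ;
  trial_A : forall x, is_derive x (1 : R) A (F x ^+ 2) ;
  trial_B : forall x, is_derive x (1 : R) B (hB x) ;
  trial_chB : continuous hB ;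
  trial_hB : forall x, dF x ^+ 2 <= hB x ;
  trial_C : forall x, is_derive x (1 : R) C (hC x) ;
  trial_chC : continuous hC ;
  trial_hC : forall x, hC x <= F x ^+ 6 }.

Section TrialTheory.
Context {R : realType}.
Implicit Types (f g h H F dF A B hB C hC : R -> R) (x y c k r eps T : R).

Lemma continuous_mulf f g : continuous f -> continuous g -> continuous (fun x => f x * g x).
Proof. by move=> cf cg x; apply: cvgM; [exact: cf|exact: cg]. Qed.

Lemma continuous_addf f g : continuous f -> continuous g -> continuous (fun x => f x + g x).
Proof. by move=> cf cg x; apply: cvgD; [exact: cf|exact: cg]. Qed.

Lemma continuous_cstf c : continuous (fun _ : R => c).
Proof. by move=> x; exact: cvg_cst. Qed.

Lemma derive_dilate H h r c x : (forall x, is_derive x (1 : R) H (h x)) ->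
  is_derive x (1 : R) (fun t => c * H (r * t)) (c * (r * h (r * x))).
Proof.
move=> dH; apply: derive_scale.
have := is_derive_affine 0 r dH x.
rewrite (_ : (fun t => H (0 + r * t)) = fun t => H (r * t)) ?add0r //.
by apply/funext => t; rewrite add0r.
Qed.

Lemma continuous_dilate h r : continuous h -> continuous (fun x => h (r * x)).
Proof.
move=> ch; have := continuous_affine (a := 0) (k := r) ch.
rewrite (_ : (fun t => h (0 + r * t)) = fun t => h (r * t)) //.
by apply/funext => t; rewrite add0r.
Qed.

(* The L2-invariant dilations [k * sqrt l * F (l * x)] with [l = r ^ 2]. *)
Lemma trial_dilate F dF A B hB C hC k r : trial F dF A B hB C hC ->
  trial (fun x => k * r * F (r ^+ 2 * x)) (fun x => k * r * (r ^+ 2 * dF (r ^+ 2 * x)))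
    (fun x => k ^+ 2 * A (r ^+ 2 * x))
    (fun x => k ^+ 2 * r ^+ 4 * B (r ^+ 2 * x))
    (fun x => k ^+ 2 * r ^+ 4 * (r ^+ 2 * hB (r ^+ 2 * x)))
    (fun x => k ^+ 6 * r ^+ 4 * C (r ^+ 2 * x))
    (fun x => k ^+ 6 * r ^+ 4 * (r ^+ 2 * hC (r ^+ 2 * x))).
Proof.
move=> [t1 t2 t3 t4 t5 t6 t7 t8 t9]; split.
- by move=> x; exact: derive_dilate.
- by do 2![apply: continuous_mulf; [exact: continuous_cstf|]]; exact: continuous_dilate.
- by move=> x; apply: derive_eq (derive_dilate _ _ _ t3) _; ring.
- by move=> x; exact: derive_dilate.
- by do 2![apply: continuous_mulf; [exact: continuous_cstf|]]; exact: continuous_dilate.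
- move=> x; have := t6 (r ^+ 2 * x).
  have c0 : 0 <= k ^+ 2 * r ^+ 4 * r ^+ 2.
    by rewrite mulr_ge0 ?sqr_ge0 // mulr_ge0 ?sqr_ge0 // exprn_even_ge0.
  by move=> /(ler_wpM2l c0); lra.
- by move=> x; exact: derive_dilate.
- by do 2![apply: continuous_mulf; [exact: continuous_cstf|]]; exact: continuous_dilate.
- move=> x; have := t9 (r ^+ 2 * x).
  have c0 : 0 <= k ^+ 6 * r ^+ 4 * r ^+ 2.
    by rewrite mulr_ge0 ?sqr_ge0 // mulr_ge0 ?sqr_ge0 // exprn_even_ge0.
  by move=> /(ler_wpM2l c0); lra.
Qed.

Let csech := is_derive_continuous (@is_derive_sech R).
Let ctanh := is_derive_continuous (@is_derive_tanh R).
Let crsech := is_derive_continuous (@is_derive_rsech R).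

Let drsechV x : is_derive x (1 : R) (fun t => (rsech t)^-1) (tanh x / 2 / rsech x).
Proof.
apply: derive_eq (derive_inv (rsech_neq0 x) (is_derive_rsech x)) _.
by field; rewrite rsech_neq0.
Qed.
Let crsechV := is_derive_continuous drsechV.

Let dsechV x : is_derive x (1 : R) (fun t => (sech t)^-1) (tanh x / sech x).
Proof.
apply: derive_eq (derive_inv (sech_neq0 x) (is_derive_sech x)) _.
by field; rewrite sech_neq0.
Qed.
Let csechV := is_derive_continuous dsechV.

Lemma derive_sech_tanh x :
  is_derive x (1 : R) (fun t => sech t * tanh t) (2 * sech x ^+ 3 - sech x).
Proof.
apply: derive_eq (derive_mul (is_derive_sech x) (is_derive_tanh x)) _.
have h : tanh x ^+ 2 = 1 - sech x ^+ 2 by have := sech2Dtanh2 x; lra.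
transitivity (- sech x * tanh x ^+ 2 + sech x ^+ 3); first by ring.
by rewrite h; ring.
Qed.

Let csechX n : continuous (fun x => sech x ^+ n : R).
Proof.
move=> x; apply: (@continuous_comp _ _ _ (@sech R) (fun y => y ^+ n)); first exact: csech.
exact: exprn_continuous.
Qed.

(** With [z = (1 - y) ^ 2], the identity [z ^ 3 - 3 z + 2 = (z - 1) ^ 2 * (z + 2)] gives
    [z ^ 3 >= 3 z - 2], and [z >= 1 - 2 y]. It holds for every real [y], which matters because
    [eps / sech x] is unbounded. *)
Lemma bernoulli6 y : 1 - 6 * y <= (1 - y) ^+ 6.
Proof.
rewrite (exprM _ 2 3); set z := (1 - y) ^+ 2.
have z0 : 0 <= z by exact: sqr_ge0.
have : 0 <= (z - 1) ^+ 2 * (z + 2) by rewrite mulr_ge0 ?sqr_ge0 //; lra.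
have : z = 1 - 2 * y + y ^+ 2 by rewrite /z; ring.
have := sqr_ge0 y; lra.
Qed.

(** Antiderivatives for [rsech - eps / rsech]: of its square, of a majorant of its squared
    derivative where [tanh ^ 2 <= 1] is applied to the terms in [eps], and of the Bernoulli minorant
    of its sixth power. *)
Definition sech_mass eps x : R := gudermann x - 2 * eps * x + eps ^+ 2 * sinh x.
Definition sech_kin eps x : R :=
  8^-1 * (gudermann x - sech x * tanh x) + eps / 2 * x + eps ^+ 2 / 4 * sinh x.
Definition sech_pot eps x : R :=
  2^-1 * (sech x * tanh x + gudermann x) - 6 * eps * tanh x.

(* [rsech] is the optimiser on the halfline; subtracting [eps / rsech] makes it
   vanish at the point where [sech = eps] and keeps the mass elementary. *)
Lemma trial_sech eps : 0 <= eps -> trial (fun x => rsech x - eps * (rsech x)^-1)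
  (fun x => - 2^-1 * (tanh x * (rsech x + eps * (rsech x)^-1)))
  (sech_mass eps) (sech_kin eps)
  (fun x => 4^-1 * (sech x + (-1) * sech x ^+ 3) + (eps / 2 + eps ^+ 2 / 4 * (sech x)^-1))
  (sech_pot eps) (fun x => sech x ^+ 3 + (- (6 * eps)) * sech x ^+ 2).
Proof.
move=> eps0.
have tE x : tanh x ^+ 2 = 1 - sech x ^+ 2 :> R by have := sech2Dtanh2 x; lra.
split.
- move=> x; apply: derive_eq (derive_sub (is_derive_rsech x) (derive_scale eps (drsechV x))) _.
  by field; rewrite rsech_neq0.
- apply: continuous_mulf; first exact: continuous_cstf.
  apply: continuous_mulf; first exact: ctanh.
  apply: continuous_addf; first exact: crsech.
  by apply: continuous_mulf; [exact: continuous_cstf|exact: crsechV].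
- move=> x; rewrite /sech_mass; apply: derive_eq (derive_add (derive_sub (is_derive_gudermann x)
    (derive_scale (2 * eps) (derive1_idfun x))) (derive_scale (eps ^+ 2) (is_derive_sinh x))) _.
  rewrite -rsech_sqr; by field; rewrite rsech_neq0.
- move=> x; rewrite /sech_kin; apply: derive_eq (derive_add (derive_add (derive_scale 8^-1
    (derive_sub (is_derive_gudermann x) (derive_sech_tanh x)))
    (derive_scale (eps / 2) (derive1_idfun x))) (derive_scale (eps ^+ 2 / 4) (is_derive_sinh x))) _.
  by field; rewrite sech_neq0.
- apply: continuous_addf.
    apply: continuous_mulf; first exact: continuous_cstf.
    apply: continuous_addf; first exact: csech.
    by apply: continuous_mulf; [exact: continuous_cstf|exact: csechX].
  apply: continuous_addf; first exact: continuous_cstf.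
  by apply: continuous_mulf; [exact: continuous_cstf|exact: csechV].
- move=> x; have s0 := sech_gt0 x.
  have -> : (- 2^-1 * (tanh x * (rsech x + eps * (rsech x)^-1))) ^+ 2 =
     4^-1 * (tanh x ^+ 2 * sech x + tanh x ^+ 2 * (2 * eps + eps ^+ 2 / sech x)).
    by rewrite -rsech_sqr; field; rewrite rsech_neq0.
  have X0 : 0 <= 2 * eps + eps ^+ 2 / sech x.
    by apply: addr_ge0; [exact: mulr_ge0|rewrite divr_ge0 ?sqr_ge0 // ltW].
  have := ler_wpM2r X0 (tanh2_le1 x); rewrite mul1r.
  have e1 : tanh x ^+ 2 * sech x = sech x - sech x ^+ 3 by rewrite tE; ring.
  by rewrite e1; lra.
- move=> x; rewrite /sech_pot; apply: derive_eq (derive_sub (derive_scale 2^-1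
    (derive_add (derive_sech_tanh x) (is_derive_gudermann x))) (derive_scale (6 * eps) (is_derive_tanh x))) _.
  by field.
- apply: continuous_addf; first exact: csechX.
  by apply: continuous_mulf; [exact: continuous_cstf|exact: csechX].
- move=> x; have s0 := sech_gt0 x.
  have -> : (rsech x - eps * (rsech x)^-1) ^+ 6 = sech x ^+ 3 * (1 - eps / sech x) ^+ 6.
    by rewrite -rsech_sqr; field; rewrite rsech_neq0.
  have -> : sech x ^+ 3 + - (6 * eps) * sech x ^+ 2 = sech x ^+ 3 * (1 - 6 * (eps / sech x)).
    by field; rewrite sech_neq0.
  by rewrite ler_wpM2l ?bernoulli6 // exprn_ge0 // ltW.
Qed.

(** A function vanishing at 0, hence extendable by zero from one halfline of any graph. It serves
    only to make the energy small by spreading, so the sextic minorant may be 0. *)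
Lemma trial_tanh_rsech : trial (fun x => tanh x * rsech x)
  (fun x => sech x ^+ 2 * rsech x + (- 2^-1) * (tanh x ^+ 2 * rsech x))
  (fun x => 2^-1 * (gudermann x - sech x * tanh x)) gudermann sech (fun=> 0) (fun=> 0).
Proof.
have tE x : tanh x ^+ 2 = 1 - sech x ^+ 2 :> R by have := sech2Dtanh2 x; lra.
split.
- move=> x; apply: derive_eq (derive_mul (is_derive_tanh x) (is_derive_rsech x)) _.
  by field.
- apply: continuous_addf.
    by apply: continuous_mulf; [exact: csechX|exact: crsech].
  apply: continuous_mulf; first exact: continuous_cstf.
  apply: continuous_mulf; last exact: crsech.
  by apply: (@continuous_mulf tanh tanh); exact: ctanh.
- move=> x; apply: derive_eq (derive_scale 2^-1 (derive_sub (is_derive_gudermann x)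
    (derive_sech_tanh x))) _.
  by rewrite [RHS]exprMn rsech_sqr tE; field.
- by move=> x; exact: is_derive_gudermann.
- exact: csech.
- move=> x; have s0 := sech_gt0 x.
  have -> : (sech x ^+ 2 * rsech x + - 2^-1 * (tanh x ^+ 2 * rsech x)) ^+ 2 =
    sech x * (sech x ^+ 2 - 2^-1 * tanh x ^+ 2) ^+ 2.
    transitivity (rsech x ^+ 2 * (sech x ^+ 2 - 2^-1 * tanh x ^+ 2) ^+ 2); first by ring.
    by rewrite rsech_sqr.
  rewrite -[leRHS]mulr1 ler_wpM2l ?(ltW s0) //.
  have := sqr_ge0 (tanh x); have := sqr_ge0 (sech x); rewrite tE.
  by move=> h1 h2; have := mulr_ge0 h1 h2; lra.
- by move=> x; exact: derive1_cstfun.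
- exact: continuous_cstf.
- by move=> x; rewrite exprn_even_ge0.
Qed.

Lemma gudermann0 : gudermann 0 = 0 :> R.
Proof. by rewrite /gudermann expR0 atan1; lra. Qed.

Lemma tanh0 : tanh 0 = 0 :> R.
Proof. by rewrite /tanh oppr0 subrr mul0r. Qed.

Lemma sinh0 : sinh 0 = 0 :> R.
Proof. by rewrite /sinh oppr0 subrr mul0r. Qed.

Lemma sech_le_expRN x : sech x <= 2 * expR (- x) :> R.
Proof.
rewrite /sech ler_pdivrMr ?addr_gt0 ?expR_gt0 //.
have : expR x * expR (- x) = 1 :> R by rewrite -expRD subrr expR0.
have := sqr_ge0 (expR (- x)); lra.
Qed.

Lemma sech_tanh_norm_le x : `|sech x * tanh x| <= sech x :> R.
Proof.
rewrite normrM (gtr0_norm (sech_gt0 x)) ler_piMr ?(ltW (sech_gt0 x)) //.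
by rewrite -(@ler_pXn2r _ 2) ?nnegrE // expr1n real_normK ?num_real // tanh2_le1.
Qed.

Lemma cvgy_gudermann : @gudermann R x @[x --> +oo] --> (pi / 2 : R).
Proof.
have -> : pi / 2 = 2 * (pi / 2) - pi / 2 :> R by lra.
apply: cvgB; last exact: cvg_cst.
apply: cvgM; first exact: cvg_cst.
apply: (@cvg_comp _ _ _ (@expR R) (@atan R) _ +oo); last exact: cvgy_atan.
apply/cvgryPge => c; near=> x.
apply: le_trans (expR_ge1Dx x); rewrite -lerBlDl.
by near: x; apply: nbhs_pinfty_ge; exact: num_real.
Unshelve. all: end_near.
Qed.

Lemma cvgy_sech_tanh : (sech x * tanh x : R) @[x --> +oo] --> (0 : R).
Proof.
apply/norm_cvg0P; apply: (@squeeze_cvgr _ _ _ _ (fun=> 0) (fun x => 2 * expR (- x))).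
- near=> x; rewrite normr_ge0 /=; apply: le_trans (sech_tanh_norm_le x) _.
  exact: sech_le_expRN.
- exact: cvg_cst.
- rewrite -(mulr0 2); apply: cvgM; first exact: cvg_cst.
  exact: cvgr_expR.
Unshelve. all: end_near.
Qed.

Lemma cvg_dilate h r c l : 0 < r -> h x @[x --> +oo] --> l ->
  c * h (r * x) @[x --> +oo] --> c * l.
Proof.
move=> r0 hl; apply: cvgM; first exact: cvg_cst.
apply: (@cvg_comp _ _ _ (fun x => r * x) h _ +oo) => //.
apply/cvgryPge => d; near=> x.
rewrite mulrC -ler_pdivrMr //; near: x; apply: nbhs_pinfty_ge; exact: num_real.
Unshelve. all: end_near.
Qed.

End TrialTheory.

(** * Placing trial functions on the graph *)

Section Placement.
Context {R : realType} {G : graph R}.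
Implicit Types (e : 'I_(nE G)) (v w : 'I_(nV G)) (L : seq 'I_(nE G)) (c : R).

(* Placing a path isometrically on [c, +oo[: [pos] is the coordinate of the
   vertices, and the contributions of the edges telescope. *)
Lemma spath_place v L c : spath v L ->
  exists (a k : 'I_(nE G) -> R) (pos : 'I_(nV G) -> R),
  [/\ forall e, k e ^+ 2 = 1, pos v = c,
      forall e, e \in L -> a e = pos (src G e),
      forall e, e \in L -> bnd G e -> a e + k e * len G e = pos (tgt G e) &
      (forall e, e \in L -> ~~ bnd G e -> k e = 1) /\
      forall H l, \sum_(e <- L) edge_val a k H l e = l - H c].
Proof.
move=> pL; elim: pL c => [e be|e {}v w {}L ej pL IH nv] c.
  exists (fun=> c), (fun=> 1), (fun=> c); split=> //.
  - by move=> ?; rewrite expr1n.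
  - by move=> e'; rewrite inE => /eqP ->; rewrite (negbTE be).
  - by split=> // H l; rewrite big_seq1 /edge_val (negbTE be).
have [a [k [pos [k1 pw ha hb [hc hs]]]]] := IH (c + len G e).
have eL : e \notin L.
  apply: contra nv => eL; apply/hasP; exists e => //; exact: joins_touches ej.
have neL e' : e' \in L -> e' != e by move=> e'L; apply: contraNneq eL => <-.
have vw : v != w by apply: contra nv => /eqP ->; exact: spath_touches pL.
have nt e' : e' \in L -> ~~ touches e' v.
  by move=> e'L; apply: contra nv => h; apply/hasP; exists e'.
(* Only the coordinate of [v] is overwritten; the rest of the path never touches [v], so its edges
   keep their placement. *)
pose pos' x := if x == v then c else pos x.
pose fwd := src G e == v.
exists (fun e' => if e' == e then (if fwd then c else c + len G e) else a e').
exists (fun e' => if e' == e then (if fwd then 1 else -1) else k e').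
exists pos'.
have es : (if fwd then c else c + len G e) = pos' (src G e).
  rewrite /pos' -/fwd; case: ifP => // f; move: ej; rewrite /joins -/fwd f /=.
  by move=> /andP[_ /andP[/eqP -> _]]; rewrite pw.
split.
- by move=> e'; case: eqP => _; last exact: k1; case: (fwd); rewrite ?expr1n ?sqrrN ?expr1n.
- by rewrite /pos' eqxx.
- move=> e'; rewrite inE; case: eqP => [->|_] //= e'L; rewrite (ha _ e'L) /pos'.
  by move: (nt _ e'L); rewrite /touches negb_or => /andP[/negbTE -> _].
- move=> e'; rewrite inE; case: eqP => [-> _ be|_] /=; last first.
    move=> e'L be; rewrite (hb _ e'L be) /pos'.
    by move: (nt _ e'L); rewrite /touches negb_or be /= => /andP[_ /negbTE ->].
  move: ej; rewrite /joins be /= -/fwd; case: (boolP fwd) => f /=.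
    rewrite /pos' mul1r => /orP[/eqP ->|/andP[/eqP h1 /eqP h2]].
      by rewrite eq_sym (negbTE vw) pw.
    by move: f vw; rewrite /fwd h1 => /eqP ->; rewrite eqxx.
  by move=> /andP[_ /eqP ->]; rewrite /pos' eqxx mulN1r addrK.
- split.
    move=> e'; rewrite inE; case: eqP => [->|_] /=; last exact: hc.
    by case/andP: ej => ->.
  move=> H l; rewrite big_cons.
  have -> : \sum_(e' <- L) edge_val
      (fun e' => if e' == e then (if fwd then c else c + len G e) else a e')
      (fun e' => if e' == e then (if fwd then 1 else -1) else k e') H l e' =
      \sum_(e' <- L) edge_val a k H l e'.
    by apply: eq_big_seq => e' e'L; rewrite /edge_val (negbTE (neL _ e'L)).
  rewrite hs /edge_val eqxx; case/andP: ej => -> _; case: (fwd).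
    by rewrite !mul1r; ring.
  by rewrite !mulN1r addrK; ring.
Qed.

End Placement.

Section TrialExistence.
Context {R : realType} {G : graph R}.
Hypothesis wf : wf_graph G.
Implicit Types (e : 'I_(nE G)) (v : 'I_(nV G)) (L : seq 'I_(nE G)) (k r : R).

Lemma degree1_touches v e e' : degree G v = 1%N -> touches e v -> touches e' v -> e' = e.
Proof.
move=> dv ev e'v; apply/eqP; apply: contraT => ee; move: dv.
rewrite degreeE (bigD1 e) //= (bigD1 e') //=.
case: (edge_deg e v) (edge_deg_gt0 ev) => // n _.
by case: (edge_deg e' v) (edge_deg_gt0 e'v) => // p _; rewrite !addSn addnS.
Qed.

(** The uncorrected optimiser ([eps = 0]) along a path to infinity. As no outside edge meets the
    path, extension by zero is continuous although the function vanishes nowhere on it. The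
    constants are the limits of the three antiderivatives at infinity. *)
Lemma halfline_trial v L k r : 0 < r -> spath v L ->
  (forall e v', e \notin L -> touches e v' -> ~~ has (fun e => touches e v') L) ->
  exists u du, [/\ is_H1 G u du, mass G u = (k ^+ 2 * (pi / 2))%:E,
    (Lp_pow G 2 du <= (k ^+ 2 * r ^+ 4 * (pi / 16))%:E)%E &
    ((k ^+ 6 * r ^+ 4 * (pi / 4))%:E <= Lp_pow G 6 u)%E].
Proof.
move=> r0 pL out.
have [a [s [pos [s1 pv ha hb [hc hs]]]]] := spath_place 0 pL.
have [t1 t2 t3 t4 t5 t6 t7 t8 t9] := trial_dilate k r (trial_sech (lexx (0 : R))).
set F := (fun x => k * r * _) in t1 t3 t9.
have r20 : 0 < r ^+ 2 by rewrite exprn_gt0.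
have cA : sech_mass 0 x @[x --> +oo] --> (pi / 2 : R).
  rewrite (_ : sech_mass 0 = gudermann); first exact: cvgy_gudermann.
  by apply/funext => x; rewrite /sech_mass; ring.
have cB : sech_kin 0 x @[x --> +oo] --> (pi / 16 : R).
  rewrite (_ : sech_kin 0 = fun x => 8^-1 * (gudermann x - sech x * tanh x)); last first.
    by apply/funext => x; rewrite /sech_kin; ring.
  rewrite (_ : pi / 16 = 8^-1 * (pi / 2 - 0)); last by field.
  apply: cvgM; first exact: cvg_cst.
  by apply: cvgB; [exact: cvgy_gudermann|exact: cvgy_sech_tanh].
have cC : sech_pot 0 x @[x --> +oo] --> (pi / 4 : R).
  rewrite (_ : sech_pot 0 = fun x => 2^-1 * (sech x * tanh x + gudermann x)); last first.
    by apply/funext => x; rewrite /sech_pot; ring.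
  rewrite (_ : pi / 4 = 2^-1 * (0 + pi / 2)); last by field.
  apply: cvgM; first exact: cvg_cst.
  by apply: cvgD; [exact: cvgy_sech_tanh|exact: cvgy_gudermann].
have [||||e eL be|u [du [h1 h2 h3 h4]]] := @build_H1 R G L _ _ _ _ _ _ _ a s
  (fun v' => if has (fun e => touches e v') L then F (pos v') else 0)
  (k ^+ 2 * (pi / 2)) (k ^+ 2 * r ^+ 4 * (pi / 16)) (k ^+ 6 * r ^+ 4 * (pi / 4))
  wf (spath_uniq pL) t1 t2 t3 t4 t5 t6 t7 t8 t9 s1.
- move=> e eL; rewrite (ha _ eL) ifT //.
  by apply/hasP; exists e => //; rewrite /touches eqxx.
- move=> e eL be; rewrite (hb _ eL be) ifT //.
  by apply/hasP; exists e => //; rewrite /touches be eqxx orbT.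
- by move=> e eL; rewrite ifF //; apply: negbTE; apply: (out e) => //; rewrite /touches eqxx.
- move=> e eL be; rewrite ifF //; apply: negbTE; apply: (out e) => //.
  by rewrite /touches be eqxx orbT.
- split.
  + exact: hc.
  + move=> x; rewrite mulr0 oppr0 mul0r addr0.
    apply: mulr_ge0; first by apply: mulr_ge0; rewrite exprn_even_ge0.
    by apply: mulr_ge0; rewrite ?sqr_ge0 // exprn_ge0 // ltW // sech_gt0.
  + exact: cvg_dilate.
  + exact: cvg_dilate.
  + exact: cvg_dilate.
exists u, du; split=> //.
- by rewrite h2 hs mulr0 /sech_mass gudermann0 sinh0 !mulr0 subrr add0r mulr0 subr0.
- move: h3; rewrite hs mulr0 /sech_kin gudermann0 sinh0 tanh0 !mulr0 subrr mulr0.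
  by rewrite !add0r mulr0 subr0.
- move: h4; rewrite hs mulr0 /sech_pot gudermann0 tanh0 !mulr0 addr0 mulr0 subrr.
  by rewrite mulr0 subr0.
Qed.

(** A small [r] spreads the function along a halfline: the mass stays fixed and the kinetic term
    tends to 0. *)
Lemma spread_trial k r : 0 < r -> noncompact G ->
  exists u du, [/\ is_H1 G u du, mass G u = (k ^+ 2 * (pi / 4))%:E &
    (Lp_pow G 2 du <= (k ^+ 2 * r ^+ 4 * (pi / 2))%:E)%E].
Proof.
move=> r0 [e be]; have r20 : 0 < r ^+ 2 by rewrite exprn_gt0.
have [t1 t2 t3 t4 t5 t6 t7 t8 t9] := trial_dilate k r (@trial_tanh_rsech R).
have cA : 2^-1 * (gudermann x - sech x * tanh x) @[x --> +oo] --> (pi / 4 : R).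
  rewrite (_ : pi / 4 = 2^-1 * (pi / 2 - 0)); last by field.
  apply: cvgM; first exact: cvg_cst.
  by apply: cvgB; [exact: cvgy_gudermann|exact: cvgy_sech_tanh].
have [|||||e'|u [du [h1 h2 h3 h4]]] := @build_H1 R G [:: e] _ _ _ _ _ _ _ (fun=> 0) (fun=> 1)
  (fun=> 0) (k ^+ 2 * (pi / 4)) (k ^+ 2 * r ^+ 4 * (pi / 2)) (k ^+ 6 * r ^+ 4 * 0)
  wf isT t1 t2 t3 t4 t5 t6 t7 t8 t9.
- by move=> ?; rewrite expr1n.
- by move=> ? _; rewrite mulr0 tanh0 mul0r mulr0.
- by move=> ?; rewrite inE => /eqP ->; rewrite (negbTE be).
- by [].
- by [].
- rewrite inE => /eqP -> _; split=> //.
  + by move=> x; rewrite !mulr0.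
  + exact: (cvg_dilate (h := fun x => 2^-1 * (gudermann x - sech x * tanh x))).
  + exact: cvg_dilate cvgy_gudermann.
  + exact: (cvg_dilate (h := fun=> 0)) (cvg_cst _).
exists u, du; split=> //.
- rewrite h2 big_seq1 /edge_val (negbTE be) mulr0 gudermann0 tanh0 mulr0 subrr.
  by rewrite !mulr0 subr0.
- by move: h3; rewrite big_seq1 /edge_val (negbTE be) mulr0 gudermann0 mulr0 subr0.
Qed.

(** Dilation by [r ^ 2] turns the edge into [[0, T]]. The peak sits at the terminal point, and
    [eps = sech T] makes the function vanish at the end attached to the rest of the graph. *)
Lemma bounded_trial v e k r : degree G v = 1%N -> touches e v -> bnd G e -> 0 < r ->
  let T := r ^+ 2 * len G e in let eps := sech T in
  exists u du, [/\ is_H1 G u du, mass G u = (k ^+ 2 * sech_mass eps T)%:E,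
    (Lp_pow G 2 du <= (k ^+ 2 * r ^+ 4 * sech_kin eps T)%:E)%E &
    ((k ^+ 6 * r ^+ 4 * sech_pot eps T)%:E <= Lp_pow G 6 u)%E].
Proof.
move=> dv ev be r0 T eps; have l0 := wf be.
have [t1 t2 t3 t4 t5 t6 t7 t8 t9] := trial_dilate k r (trial_sech (ltW (sech_gt0 T))).
set F := (fun x => k * r * _) in t1 t3 t9.
have FT : F (len G e) = 0.
  by rewrite /F -/T -[X in _ - X * _]rsech_sqr expr2 mulfK ?rsech_neq0 // subrr mulr0.
have other e' : e' != e -> ~~ touches e' v.
  by move=> ee; apply/negP => /(degree1_touches dv ev) e'e; rewrite e'e eqxx in ee.
(* Degree one excludes a loop: exactly one end of [e] is [v], and the edge can be parametrised from
   there. *)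
have deg1 : edge_deg e v = 1%N.
  move: dv; rewrite degreeE (bigD1 e) //=.
  case: (edge_deg e v) (edge_deg_gt0 ev) => // n _; rewrite addSn => -[] /eqP.
  by rewrite addn_eq0 => /andP[/eqP -> _].
pose fwd := src G e == v.
pose s := if fwd then 1 else -1 : R.
pose a := if fwd then 0 else len G e : R.
have tsrc : (tgt G e == v) = ~~ fwd.
  by move: deg1; rewrite /edge_deg be /= -/fwd; case: (fwd) => //=; case: eqP.
have val H l : edge_val (fun=> a) (fun=> s) H l e = H (len G e) - H 0.
  rewrite /edge_val be /a /s; case: (fwd); first by rewrite !mul1r add0r.
  by rewrite !mulN1r subrr opprB.
have [|||||e'|u [du [h1 h2 h3 h4]]] := @build_H1 R G [:: e] _ _ _ _ _ _ _ (fun=> a) (fun=> s)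
  (fun v' => if v' == v then F 0 else 0) 0 0 0
  wf isT t1 t2 t3 t4 t5 t6 t7 t8 t9.
- by move=> _; rewrite /s; case: (fwd); rewrite ?sqrrN expr1n.
- by move=> e'; rewrite inE => /eqP ->; rewrite -/fwd /a; case: (fwd).
- move=> e'; rewrite inE => /eqP -> _; rewrite tsrc /a /s; case: (fwd) => /=.
    by rewrite mul1r add0r FT.
  by rewrite mulN1r subrr.
- move=> e'; rewrite inE => /other; rewrite /touches negb_or => /andP[/negbTE -> _] //.
- move=> e'; rewrite inE => /other; rewrite /touches negb_or => /andP[_].
  by move=> + be'; rewrite be' /= => /negbTE ->.
- by rewrite inE => /eqP ->; rewrite be.
exists u, du; split=> //.
- rewrite h2 big_seq1 val mulr0 /sech_mass gudermann0 sinh0 !mulr0 subrr add0r mulr0 subr0 //.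
- move: h3; rewrite big_seq1 val mulr0 /sech_kin gudermann0 sinh0 tanh0 !mulr0 subrr mulr0.
  by rewrite !add0r mulr0 subr0.
- move: h4; rewrite big_seq1 val mulr0 /sech_pot gudermann0 tanh0 !mulr0 addr0 mulr0 subrr.
  by rewrite mulr0 subr0.
Qed.

End TrialExistence.

(** * Concentration at a terminal point *)

Section Asymptotics.
Context {R : realType}.
Implicit Types (T eta : R).

Lemma sech_asymptotics eta : 0 < eta -> exists2 T0, 1 <= T0 & forall T, T0 <= T ->
  [/\ sech T * T <= eta, sech T <= eta & pi / 2 - eta <= gudermann T].
Proof.
move=> eta0; have /cvgrPdist_le /(_ _ eta0) [M [_ hM]] := @cvgy_gudermann R.
(* From [expR T >= T ^ 2 / 2] one gets [sech T * T <= 4 / T], whence [4 / eta]; [M + 1] is there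
   because the limit holds strictly beyond [M]. *)
exists (Num.max 1 (Num.max (M + 1) (4 / eta))); first by rewrite le_max lexx.
move=> T; rewrite !ge_max => /and3P[T1 TM Te].
have s0 := sech_gt0 T.
have sT : sech T * T <= eta.
  rewrite ler_pdivrMr // in Te.
  have e1 := expR_ge1Dxn 1 (le_trans ler01 T1); rewrite (_ : (2`!)%N = 2%N) // in e1.
  have D0 : 0 < expR T + expR (- T) by rewrite addr_gt0 ?expR_gt0.
  have e2 : T ^+ 2 / 2 <= expR T + expR (- T) by have := expR_gt0 (- T); lra.
  have : sech T * (T ^+ 2 / 2) <= 2.
    apply: le_trans (ler_wpM2l (ltW s0) e2) _.
    by rewrite /sech divfK // lt0r_neq0.
  move=> h; have T0 : 0 < T by lra.
  by rewrite -(ler_pM2r T0); lra.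
split=> //.
  by apply: le_trans sT; rewrite ler_peMr // ltW.
have := hM T ltac:(lra); rewrite ler_norml => /andP[_]; lra.
Qed.

Lemma gudermann_lt T : gudermann T < pi / 2 :> R.
Proof. by rewrite /gudermann; have := atan_ltpi2 (expR T); lra. Qed.

Lemma sech_trial_bounds T eta : 1 <= T -> sech T * T <= eta -> sech T <= eta ->
  pi / 2 - eta <= gudermann T ->
  [/\ sech_mass (sech T) T <= pi / 2, pi / 2 - 4 * eta <= sech_mass (sech T) T,
      sech_kin (sech T) T <= pi / 16 + eta & pi / 4 - 7 * eta <= sech_pot (sech T) T].
Proof.
move=> T1 h1 h2 h3; have s0 := sech_gt0 T; have g1 := gudermann_lt T.
(* The growing [sinh T] is always multiplied by [eps ^ 2 = sech T ^ 2], and the product is at most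
   [sech T]. *)
have eq1 : sech T ^+ 2 * sinh T = sech T * tanh T.
  rewrite /sinh /sech /tanh; field.
  by rewrite lt0r_neq0 // addr_gt0 ?expR_gt0.
have := sech_tanh_norm_le T; rewrite ler_norml => /andP[t1 t2].
have sT : sech T <= sech T * T by rewrite ler_peMr // ltW.
rewrite /sech_mass /sech_kin /sech_pot; split.
- by rewrite eq1; lra.
- by rewrite eq1; lra.
- have -> : sech T ^+ 2 / 4 * sinh T = sech T ^+ 2 * sinh T / 4 by ring.
  by rewrite eq1; lra.
- by rewrite -[6 * sech T * tanh T]mulrA; lra.
Qed.

(** For [eta = 0] and [A = pi / 2] the factor [B - k ^ 4 * C / 3] would equal minus the gap
    [mu ^ 2 / (3 pi) - pi / 16], which is positive exactly above the critical mass. The smallness of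
    [eta] costs at most half of the gap, and [eta <= 28^-1] keeps [pi / 4 - 7 eta] nonnegative. *)
Lemma deep_energy (mu A B C k eta : R) : 0 < mu -> 0 < eta -> eta <= 28^-1 ->
  0 < A -> A <= pi / 2 -> B <= pi / 16 + eta -> pi / 4 - 7 * eta <= C ->
  k ^+ 2 = mu / A -> eta * (2 * (1 + 3 * mu ^+ 2)) <= mu ^+ 2 / (3 * pi) - pi / 16 ->
  k ^+ 2 * B / 2 - k ^+ 6 * C / 6 <=
    - (mu * (mu ^+ 2 / (3 * pi) - pi / 16) / (2 * pi)).
Proof.
move=> mu0 eta0 eta1 A0 Api Bu Cl kE etaD.
set Dl := mu ^+ 2 / (3 * pi) - pi / 16 in etaD *.
have p2 := pi_ge2 R; have p0 := pi_gt0 R.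
have k2l : 2 * mu / pi <= k ^+ 2.
  rewrite kE ler_pdivrMr // mulrAC ler_pdivlMr //; nra.
have C0 : 0 <= C by lra.
have Dl0 : 0 <= Dl.
  by apply: le_trans etaD; rewrite !mulr_ge0 ?ltW //; have := sqr_ge0 mu; lra.
have m0 : 0 <= 2 * mu / pi by rewrite divr_ge0 ?mulr_ge0 ?ltW.
have k20 : 0 <= k ^+ 2 by lra.
have k4l : (2 * mu / pi) ^+ 2 <= k ^+ 4.
  by rewrite (exprM _ 2 2) ler_sqr ?nnegrE.
have k4C : (2 * mu / pi) ^+ 2 * (pi / 4 - 7 * eta) <= k ^+ 4 * C.
  by apply: ler_pM; [exact: sqr_ge0|lra|exact: k4l|exact: Cl].
have e1 : (2 * mu / pi) ^+ 2 * (pi / 4 - 7 * eta) / 3 =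
    mu ^+ 2 / (3 * pi) - eta * (28 / 3 * (mu ^+ 2 / pi ^+ 2)).
  by move: (pi) (lt0r_neq0 p0) => P P0; field.
have mp : mu ^+ 2 / pi ^+ 2 <= mu ^+ 2 / 4.
  by rewrite ler_wpM2l ?sqr_ge0 // lef_pV2 ?posrE ?exprn_gt0 //; nra.
have mpe : eta * (28 / 3 * (mu ^+ 2 / pi ^+ 2)) <= eta * (3 * mu ^+ 2).
  by rewrite ler_wpM2l ?(ltW eta0) //; have := sqr_ge0 mu; lra.
have key : B - k ^+ 4 * C / 3 <= - (Dl / 2) by rewrite /Dl in etaD *; lra.
have -> : k ^+ 2 * B / 2 - k ^+ 6 * C / 6 = k ^+ 2 / 2 * (B - k ^+ 4 * C / 3) by field.
have h1 : k ^+ 2 / 2 * (B - k ^+ 4 * C / 3) <= k ^+ 2 / 2 * - (Dl / 2).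
  by rewrite ler_wpM2l // divr_ge0.
have h2 : 2 * mu / pi * Dl <= k ^+ 2 * Dl by rewrite ler_wpM2r.
have -> : mu * Dl / (2 * pi) = 2 * mu / pi * Dl / 4.
  by move: (pi) (lt0r_neq0 p0) (Dl) => P P0 D; field.
by lra.
Qed.

End Asymptotics.

(** * Critical mass and ground energy *)

Section Assembly.
Context {R : realType}.
Implicit Types (G : graph R) (mu k r : R).

(* pi * sqrt 3 / 4 *)
Definition mu_half : R := Num.sqrt (3 / (16 / pi ^+ 2)).

Lemma mu_half_sqr : mu_half ^+ 2 = 3 * pi ^+ 2 / 16.
Proof.
have p0 := pi_gt0 R.
rewrite sqr_sqrtr; last by rewrite divr_ge0 // divr_ge0 // sqr_ge0.
by move: (pi) (lt0r_neq0 p0) => P P0; field.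
Qed.

Lemma mu_half_gt0 : 0 < mu_half.
Proof. by rewrite sqrtr_gt0 divr_gt0 // divr_gt0 // exprn_gt0 // pi_gt0. Qed.

(** This value of [b ^ 2] turns the sharp inequality into nonnegativity of the energy. *)
Lemma mu_half_b : (pi / (4 * mu_half)) ^+ 2 = 3^-1.
Proof.
have p0 := pi_gt0 R; rewrite expr_div_n exprMn mu_half_sqr.
by move: (pi) (lt0r_neq0 p0) => P P0; field.
Qed.

Lemma H1_inequality G u du mu : wf_graph G -> connected_graph G -> noncompact G ->
  is_H1 G u du -> mass G u = mu%:E -> 0 < mu ->
  exists q w, [/\ Lp_pow G 2 du = q%:E, Lp_pow G 6 u = w%:E, 0 < w,
    (pi / (4 * mu)) ^+ 2 * w <= q &
    (q = (pi / (4 * mu)) ^+ 2 * w -> is_halfline G)].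
Proof.
move=> wf cG nG hu hm mu0.
have [S [Q [W [m [q [w [phi [hd Em Eq Ew]]]]]]]] := is_H1_data wf hu.
have mE : \sum_e m e = mu by apply: EFin_inj; rewrite -Em.
have [h1 h2 h3] := h1_inequality wf cG nG hd ltac:(by rewrite mE).
by exists (\sum_e q e), (\sum_e w e); rewrite mE in h2 h3.
Qed.

Lemma energyE G u du q w : Lp_pow G 2 du = q%:E -> Lp_pow G 6 u = w%:E ->
  energy G u du = (q / 2 - w / 6)%:E.
Proof. by move=> hq hw; rewrite /energy hq hw -!EFinM -EFinB; congr EFin; ring. Qed.

Lemma energy_le G u du B C : wf_graph G -> is_H1 G u du ->
  (Lp_pow G 2 du <= B%:E)%E -> (C%:E <= Lp_pow G 6 u)%E ->
  (energy G u du <= (B / 2 - C / 6)%:E)%E.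
Proof.
move=> wf hu; have [S [Q [W [m [q [w [phi [_ _ Eq Ew]]]]]]]] := is_H1_data wf hu.
by rewrite (energyE Eq Ew) Eq Ew !lee_fin; lra.
Qed.

(** At [p = 6] both energy terms scale by [r ^ 4] under dilations preserving the mass, so negative
    energy at one scale drives it to minus infinity. On a bounded edge the correction changes with
    [r], but [c] does not. *)
Lemma deep_trial G mu : wf_graph G -> connected_graph G -> noncompact G ->
  has_terminal_point G -> mu_half < mu ->
  exists c r0 : R, 0 < c /\ forall r, r0 <= r -> 0 < r -> exists u du,
    [/\ is_H1 G u du, mass G u = mu%:E & (energy G u du <= (- (r ^+ 4 * c))%:E)%E].
Proof.
move=> wf cG nG [v dv] hmu.
have p0 := pi_gt0 R; have p2 := pi_ge2 R.
have mu0 : 0 < mu := lt_trans mu_half_gt0 hmu.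
pose Dl := mu ^+ 2 / (3 * pi) - pi / 16.
have Dl0 : 0 < Dl.
  have : mu_half ^+ 2 < mu ^+ 2 by rewrite ltr_sqr ?nnegrE ?(ltW mu0) ?(ltW mu_half_gt0).
  rewrite mu_half_sqr subr_gt0 ltr_pdivlMr ?mulr_gt0 // => h.
  suff -> : pi / 16 * (3 * pi) = 3 * pi ^+ 2 / 16 :> R by [].
  by ring.
pose c := mu * Dl / (2 * pi).
have c0 : 0 < c by rewrite divr_gt0 ?mulr_gt0.
have [L pL] := spath_exists v cG nG.
have /hasP[e _ ev] := spath_touches pL.
(* A halfline issuing from a vertex of degree one meets no other edge, so the uncorrected optimiser
   fits on it at every scale. *)
case: (boolP (bnd G e)) => be; last first.
  have sv : src G e = v by move: ev; rewrite /touches (negbTE be) orbF => /eqP.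
  have pe : spath v [:: e] by rewrite -sv; exact: spath_half.
  exists c, 0; split=> // r _ r0.
  pose k := Num.sqrt (2 * mu / pi).
  have k2 : k ^+ 2 = 2 * mu / pi by rewrite sqr_sqrtr // divr_ge0 ?mulr_ge0 ?ltW.
  have [|u [du [h1 h2 h3 h4]]] := halfline_trial wf k r0 pe.
    move=> e' v'; rewrite inE => e'e e'v'; rewrite /= orbF; apply/negP.
    rewrite /touches (negbTE be) orbF sv => /eqP vv'; rewrite -vv' in e'v'.
    by rewrite (degree1_touches dv ev e'v') eqxx in e'e.
  exists u, du; split=> //.
    by rewrite h2 k2; congr EFin; move: (pi) (lt0r_neq0 p0) => P P0; field.
  apply: le_trans (energy_le wf h1 h3 h4) _; rewrite lee_fin.
  have -> : k ^+ 2 * r ^+ 4 * (pi / 16) / 2 - k ^+ 6 * r ^+ 4 * (pi / 4) / 6 =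
    - (r ^+ 4 * (2 * c)).
    rewrite (exprM _ 2 3) k2 /c /Dl.
    by move: (pi) (lt0r_neq0 p0) => P P0; field.
  have : 0 <= r ^+ 4 * c by rewrite mulr_ge0 ?exprn_even_ge0 // ltW.
  by lra.
pose eta := Num.min 28^-1 (Dl / (2 * (1 + 3 * mu ^+ 2))).
have m2 := sqr_ge0 mu.
have eta0 : 0 < eta by rewrite lt_min invr_gt0 ltr0n divr_gt0 //; lra.
have eta1 : eta <= 28^-1 by rewrite ge_min lexx.
have eta2 : eta * (2 * (1 + 3 * mu ^+ 2)) <= Dl.
  by rewrite -ler_pdivlMr; [rewrite ge_min lexx orbT|lra].
have [T0 T01 hT] := sech_asymptotics eta0.
have l0 := wf e be.
(* [1 <= r] gives [r <= r ^ 2], so the dilated length [r ^ 2 * len G e] is at least [T0]. *)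
exists c, (Num.max 1 (T0 / len G e)); split=> // r; rewrite ge_max => /andP[r1 rT] r0.
have TT : T0 <= r ^+ 2 * len G e.
  rewrite -ler_pdivrMr //; apply: le_trans rT _.
  by rewrite expr2 ler_peMr // ltW.
have [s1 s2 s3] := hT _ TT.
have [A1 A2 B1 C1] := sech_trial_bounds (le_trans T01 TT) s1 s2 s3.
set T := r ^+ 2 * len G e in A1 A2 B1 C1.
have A0 : 0 < sech_mass (sech T) T by lra.
pose k := Num.sqrt (mu / sech_mass (sech T) T).
have k2 : k ^+ 2 = mu / sech_mass (sech T) T by rewrite sqr_sqrtr // divr_ge0 // ltW.
have [u [du [h1 h2 h3 h4]]] := bounded_trial wf k dv ev be r0.
exists u, du; split=> //.
  by rewrite h2 k2 divfK // lt0r_neq0.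
apply: le_trans (energy_le wf h1 h3 h4) _; rewrite lee_fin -/T.
have := deep_energy mu0 eta0 eta1 A0 A1 B1 C1 k2 eta2; rewrite -/Dl -/c.
have r40 : 0 <= r ^+ 4 by rewrite exprn_even_ge0.
by move=> /(ler_wpM2l r40); lra.
Qed.

Section MainGraph.
Variable G : graph R.
Hypotheses (wf : wf_graph G) (cG : connected_graph G) (nG : noncompact G)
  (tG : has_terminal_point G).

(** The sharp inequality bounds every ratio by [16 / pi ^ 2]. Conversely, nonpositive energy means
    that the sextic term is at least three times the kinetic one, so such a function of mass [mu]
    has ratio at least [3 / mu ^ 2]; they exist for all [mu] above [mu_half], and
    [3 / mu_half ^ 2 = 16 / pi ^ 2]. *)
Lemma K_constE : K_const G = (16 / pi ^+ 2)%:E.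
Proof.
have p0 := pi_gt0 R; have p20 : 0 < pi ^+ 2 :> R by rewrite exprn_gt0.
have upper : (K_const G <= (16 / pi ^+ 2)%:E)%E.
  apply: ge_ereal_sup => _ [u [du [hu [hm ->]]]].
  have [S [Q [W [m [q0 [w0 [phi [_ Em _ _]]]]]]]] := is_H1_data wf hu.
  have mpos : 0 < \sum_e m e.
    have : (0 <= mass G u)%E.
      by apply: sume_ge0 => e _; apply: integral_ge0 => x _; rewrite lee_fin exprn_ge0.
    by rewrite le_eqVlt eq_sym (negbTE hm) /= Em lte_fin.
  have [q [w [Eq Ew w0' le1 _]]] := H1_inequality wf cG nG hu Em mpos.
  set mm := \sum_e m e in Em mpos le1.
  have q0' : 0 < q.
    by apply: lt_le_trans le1; rewrite mulr_gt0 // exprn_gt0 // divr_gt0 // mulr_gt0.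
  rewrite /GN_ratio Eq Ew Em /= gt_eqF // lee_fin.
  rewrite ler_pdivrMr ?mulr_gt0 ?exprn_gt0 //.
  have -> : w = 16 * mm ^+ 2 / pi ^+ 2 * ((pi / (4 * mm)) ^+ 2 * w).
    move: (pi) (lt0r_neq0 p0) (mm) (lt0r_neq0 mpos) => P P0 M M0; field.
    by rewrite M0 P0.
  have -> : 16 / pi ^+ 2 * (mm ^+ 2 * q) = 16 * mm ^+ 2 / pi ^+ 2 * q by ring.
  by rewrite ler_wpM2l // divr_ge0 ?(ltW p20) // mulr_ge0 // sqr_ge0.
have lower mu : mu_half < mu -> ((3 / mu ^+ 2)%:E <= K_const G)%E.
  move=> hmu; have mu0 : 0 < mu := lt_trans mu_half_gt0 hmu.
  have [c [r0 [c0 H]]] := deep_trial wf cG nG tG hmu.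
  have [||u [du [hu Em he]]] := H (Num.max 1 r0).
  - by rewrite le_max lexx orbT.
  - by rewrite lt_max ltr01.
  have [q [w [Eq Ew w0' le1 _]]] := H1_inequality wf cG nG hu Em mu0.
  have q0' : 0 < q.
    by apply: lt_le_trans le1; rewrite mulr_gt0 // exprn_gt0 // divr_gt0 // mulr_gt0.
  apply: le_trans (ereal_sup_ubound _); last first.
    by exists u, du; split=> //; split=> //; rewrite Em eqe gt_eqF.
  rewrite /GN_ratio Eq Ew Em /= gt_eqF // lee_fin.
  rewrite ler_pdivlMr ?mulr_gt0 ?exprn_gt0 // mulrA divfK ?expf_neq0 ?gt_eqF //.
  rewrite (energyE Eq Ew) lee_fin in he.
  have : 0 <= Num.max 1 r0 ^+ 4 * c by rewrite mulr_ge0 ?exprn_even_ge0 // ltW.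
  by lra.
apply/eqP; rewrite eq_le upper /=.
have K0 : (0 <= K_const G)%E.
  by apply: le_trans (lower (mu_half + 1) ltac:(lra)); rewrite lee_fin divr_ge0 // sqr_ge0.
have Kfin : K_const G \is a fin_num.
  by rewrite fin_numElt (lt_le_trans (ltNyr 0) K0) (le_lt_trans upper (ltry _)).
rewrite -(fineK Kfin) lee_fin.
have kp0 : 0 <= fine (K_const G) by rewrite fine_ge0.
set kp := fine (K_const G) in kp0 *.
rewrite ler_pdivrMr //; suff : 3 <= kp * (3 * pi ^+ 2 / 16) by lra.
apply/ler_addgt0Pr => d d0.
(* A squared mass slightly above the critical one: [kp * (d / (kp + 1)) <= d] bounds the excess. *)
pose t := 3 * pi ^+ 2 / 16 + d / (kp + 1).
have dk : 0 < d / (kp + 1) by rewrite divr_gt0 //; lra.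
have t0 : 0 < t by rewrite /t; lra.
have st : mu_half < Num.sqrt t.
  rewrite -(@ltr_pXn2r _ 2) ?nnegrE ?sqrtr_ge0 ?(ltW mu_half_gt0) //.
  by rewrite mu_half_sqr sqr_sqrtr ?(ltW t0) // /t; lra.
have := lower _ st; rewrite -(fineK Kfin) lee_fin -/kp sqr_sqrtr ?(ltW t0) //.
rewrite ler_pdivrMr // => h; apply: le_trans h _.
rewrite /t mulrDr lerD2l mulrCA ler_piMr ?(ltW d0) // ler_pdivrMr; lra.
Qed.

Lemma mu_critE : mu_crit G = mu_half.
Proof. by rewrite /mu_crit K_constE. Qed.

Lemma ground_energy_above mu : mu_half < mu -> ground_energy G mu = -oo%E.
Proof.
move=> hmu; have [c [r0 [c0 H]]] := deep_trial wf cG nG tG hmu.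
suff below (M : R) : (ground_energy G mu <= M%:E)%E.
  case E : (ground_energy G mu) below => [x||] // below.
    by have := below (x - 1)%R; rewrite lee_fin lerBrDr gerDl ler10.
  by have := below 0%R; rewrite leye_eq.
pose r := Num.max 1 (Num.max r0 (`|M| / c)).
have r1 : 1 <= r by rewrite le_max lexx.
have rr : r0 <= r by rewrite !le_max lexx orbT.
have rM : `|M| / c <= r by rewrite !le_max lexx !orbT.
have [u [du [hu Em he]]] := H r rr ltac:(lra).
apply: le_trans (ereal_inf_lbound _) _; first by exists u, du; split=> //; split.
apply: le_trans he _; rewrite lee_fin.
have r4 : r <= r ^+ 4.
  by rewrite -[leLHS]expr1; apply: ler_weXn2l.
rewrite ler_pdivrMr // in rM.
have : r * c <= r ^+ 4 * c by rewrite ler_pM2r.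
have := lerNnormlW (lexx `|M|); lra.
Qed.

Lemma energy_ge0 u du : is_H1 G u du -> mass G u = mu_half%:E ->
  (0 <= energy G u du)%E /\ (energy G u du = 0%E -> is_halfline G).
Proof.
move=> hu Em.
have [q [w [Eq Ew w0 le1 eq1]]] := H1_inequality wf cG nG hu Em mu_half_gt0.
rewrite mu_half_b in le1 eq1; rewrite (energyE Eq Ew) lee_fin; split; first by lra.
by move=> h0; have {h0} h : q / 2 - w / 6 = 0 by [case: h0]; apply: eq1; lra.
Qed.

(** From above, 0 is approached by spreading along one halfline: the energy is at most
    [mu_half * r ^ 4] even after the sextic term is dropped. *)
Lemma ground_energy_critical : ground_energy G mu_half = 0%E.
Proof.
have p0 := pi_gt0 R; have m0 := mu_half_gt0.
apply/eqP; rewrite eq_le; apply/andP; split; last first.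
  apply: le_ereal_inf_tmp => _ [u [du [hu [Em ->]]]].
  by have [] := energy_ge0 hu Em.
apply/lee_addgt0Pr => d d0; rewrite add0e.
pose k := Num.sqrt (4 * mu_half / pi).
have k2 : k ^+ 2 = 4 * mu_half / pi by rewrite sqr_sqrtr // divr_ge0 ?mulr_ge0 ?ltW.
pose r := Num.min 1 (d / mu_half).
have dm : 0 < d / mu_half by rewrite divr_gt0.
have r0 : 0 < r by rewrite lt_min ltr01.
have r1 : r <= 1 by rewrite ge_min lexx.
have rd : r * mu_half <= d by rewrite -ler_pdivlMr // ge_min lexx orbT.
have [u [du [hu Em Q1]]] := spread_trial wf k r0 nG.
apply: le_trans (ereal_inf_lbound _) _.
  exists u, du; split=> //; split=> //; rewrite Em k2; congr EFin.
  by move: (pi) (lt0r_neq0 p0) => P P0; field.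
have W0 : (0%:E <= Lp_pow G 6 u)%E.
  by apply: sume_ge0 => e _; apply: integral_ge0 => x _; rewrite lee_fin exprn_ge0.
apply: le_trans (energy_le wf hu Q1 W0) _; rewrite lee_fin k2.
have -> : 4 * mu_half / pi * r ^+ 4 * (pi / 2) / 2 - 0 / 6 = mu_half * r ^+ 4.
  by move: (pi) (lt0r_neq0 p0) => P P0; field.
apply: le_trans rd; rewrite mulrC ler_wpM2r ?(ltW m0) //.
by rewrite exprS ler_piMr ?(ltW r0) // exprn_ile1 // ltW.
Qed.

(** The path from the terminal point to infinity covers the graph, so the optimiser lives on it
    without correction; its one-sided bounds give energy at most 0 and the sharp inequality gives
    the converse. *)
Lemma attained_halfline : is_halfline G -> exists u du,
  [/\ is_H1 G u du, mass G u = mu_half%:E & energy G u du = 0%E].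
Proof.
move=> hG; have [v dv] := tG; have [L pL] := spath_exists v cG nG.
have allL := halfline_spath_cover cG hG dv pL.
have p0 := pi_gt0 R; have m0 := mu_half_gt0.
pose k := Num.sqrt (2 * mu_half / pi).
have k2 : k ^+ 2 = 2 * mu_half / pi by rewrite sqr_sqrtr // divr_ge0 ?mulr_ge0 ?ltW.
have [|u [du [hu Em Q1 W1]]] := halfline_trial wf k ltr01 pL.
  by move=> e v'; rewrite allL.
have Em' : mass G u = mu_half%:E.
  by rewrite Em k2; congr EFin; move: (pi) (lt0r_neq0 p0) => P P0; field.
exists u, du; split=> //; apply/eqP; rewrite eq_le; apply/andP; split; last first.
  by have [] := energy_ge0 hu Em'.
apply: le_trans (energy_le wf hu Q1 W1) _; rewrite lee_fin expr1n !mulr1.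
(* For this amplitude the kinetic part [pi / 32] and the sextic part [k ^ 4 * pi / 24] balance
   exactly. *)
have k4 : k ^+ 4 = 3 / 4.
  rewrite (exprM _ 2 2) k2 !expr_div_n exprMn mu_half_sqr.
  by move: (pi) (lt0r_neq0 p0) => P P0; field.
by rewrite (exprD _ 4 2) k4; lra.
Qed.

End MainGraph.

(** The halfline belongs to the class under study, its origin being terminal, so [mu_critE]
    evaluates the critical mass of both graphs. *)
Lemma halfline_graph_ok : [/\ wf_graph (halfline_graph R), connected_graph (halfline_graph R),
  noncompact (halfline_graph R) & has_terminal_point (halfline_graph R)].
Proof.
split.
- by [].
- split=> // v w; rewrite (ord1 v) (ord1 w); exact: connect0.
- by exists ord0.
- by exists ord0; rewrite degreeE big_ord1.
Qed.

End Assembly.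

Theorem theorem7p1 (R : realType) (G : graph R) :
  wf_graph G -> connected_graph G -> noncompact G -> has_terminal_point G ->
  mu_crit G = mu_crit (halfline_graph R) /\
  (forall mu : R, mu_crit (halfline_graph R) < mu <= mu_crit (line_graph R) ->
     ground_energy G mu = -oo%E) /\
  ground_energy G (mu_crit (halfline_graph R)) = 0%E /\
  ((exists u du : 'I_(nE G) -> R -> R,
      is_H1 G u du /\ mass G u = (mu_crit (halfline_graph R))%:E /\
      energy G u du = ground_energy G (mu_crit (halfline_graph R)))
   <-> is_halfline G).
Proof.
move=> wf cG nG tG; have [wfh ch nh th] := @halfline_graph_ok R.
rewrite (mu_critE wf cG nG tG) (mu_critE wfh ch nh th) (ground_energy_critical wf cG nG).
split=> //; split.
  by move=> mu /andP[hmu _]; exact: ground_energy_above.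
split=> //; split=> [[u [du [hu [Em E0]]]]|hG].
  by have [_] := energy_ge0 wf cG nG hu Em; exact.
have [u [du [hu Em E0]]] := attained_halfline wf cG nG tG hG.
by exists u, du.
Qed.
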